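(* Consider weighted scale-free percolation $\mathrm{SFP}_{W,L}$ on $\mathbb{Z}^d$ with parameters $\lambda>0$, $\alpha>d$, $\tau>1$ and $\gamma=\alpha(\tau-1)/d\in(1,2)$. Let $\mathcal{W}(\mathrm{SFP})$ be the set of edge-weight distributions $L$ for which the first passage profile of the origin in $\mathrm{SFP}_{W,L}$ is explosive. Let $\mathcal{W}(\mathrm{BP})$ be the set of life-length distributions $L$ that produce explosive age-dependent branching processes with power-law offspring distribution with tail exponent $\gamma'$ for some $\gamma'\in(0,1)$. Then $$\mathcal{W}(\mathrm{SFP})=\mathcal{W}(\mathrm{BP}).$$
   Context: Scale-free percolation model. Fix $d\ge1$, $\alpha>d$ and $\lambda>0$. Each $x\in\mathbb{Z}^d$ gets an i.i.d. vertex-weight $W_x$ distributed as $W$, where $\mathbb{P}(W\ge1)=1$ and $\mathbb{P}(W>t)=\ell(t)/t^{\tau-1}$, with $\tau>1$ and $\ell$ slowly varying at infinity. Conditionally on $(W_x)_{x\in\mathbb{Z}^d}$, edges are present independently: each pair $x,y$ with $\|x-y\|=1$ (Euclidean norm) is always connected by an edge, and each pair with $\|x-y\|>1$ is connected with probability $1-\exp\{-\lambda W_xW_y/\|x-y\|^\alpha\}$. Then every present edge $e$ is given an i.i.d. edge-weight $L_e\ge0$ distributed as $L$, independent of everything else; the resulting weighted graph is $\mathrm{SFP}_{W,L}$. Set $\gamma:=\alpha(\tau-1)/d$. $\mathrm{d}_L(x,y)$ is the infimum over paths $\pi$ from $x$ to $y$ of $\sum_{e\in\pi}L_e$, and $B^L_t(0)=\{y:\mathrm{d}_L(0,y)\le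 t\}$. The first passage profile $(B^L_t(0))_{t\ge0}$ of the origin is explosive if infinitely many vertices are reached from the origin within finite time, i.e. if the almost sure limit, as $n\to\infty$, of $\inf\{t:|B_t^L(0)|\ge n\}$ is almost surely finite. Age-dependent branching process: it starts from one individual; individuals have i.i.d. life lengths distributed as $L$, and upon death each produces an i.i.d. number of offspring, independent of the life lengths. It is explosive if with positive probability it produces infinitely many individuals within finite time. The offspring distribution is power-law with tail exponent $\gamma'$ if the number $D$ of offspring satisfies $\mathbb{P}(D>x)=\tilde\ell(x)/x^{\gamma'}$ for some $\tilde\ell$ slowly varying at infinity. *)

(* Defs.v *)
From HB Require Import structures.
From mathcomp Require Import all_boot all_order all_algebra finmap.
From mathcomp Require Import all_classical all_reals all_analysis.

Set Implicit Arguments.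
Unset Strict Implicit.
Unset Printing Implicit Defensive.

Import Order.TTheory GRing.Theory Num.Theory.
Import numFieldNormedType.Exports.

Local Open Scope classical_set_scope.
Local Open Scope ring_scope.

Definition slowly_varying (R : realType) (l : R -> R) : Prop :=
  (exists2 x0 : R, 0 < x0 &
     measurable_fun `[x0, +oo[ l /\ (forall x, x0 <= x -> 0 < l x)) /\
  (forall c : R, 0 < c -> l (c * x) / l x @[x --> +oo] --> (1 : R)).

Definition power_law_tail (R : realType) (tail : R -> \bar R) (rho : R) : Prop :=
  exists2 l : R -> R, slowly_varying l &
    forall x : R, 0 < x -> tail x = (l x / x `^ rho)%:E.

(* Families of random variables are indexed by a subset J of a choice type I. *)
Definition independent_rvs (R : realType) (d d' : measure_display)
    (Omega : measurableType d) (T : measurableType d')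
    (P : probability Omega R) (I : choiceType) (J : set I)
    (X : I -> {RV P >-> T}) : Prop :=
  forall (F : {fset I}) (B : I -> set T),
    [set` F] `<=` J -> (forall i, measurable (B i)) ->
    P (\bigcap_(i in [set` F]) (X i @^-1` B i)) =
      (\prod_(i <- F) P (X i @^-1` B i))%E.

Definition iid (R : realType) (d d' : measure_display)
    (Omega : measurableType d) (T : measurableType d')
    (P : probability Omega R) (mu : probability T R)
    (I : choiceType) (J : set I) (X : I -> {RV P >-> T}) : Prop :=
  (forall i B, J i -> measurable B -> distribution P (X i) B = mu B) /\
  independent_rvs J X.

Definition sigma_rvs (R : realType) (d d' : measure_display)
    (Omega : measurableType d) (T : measurableType d')
    (P : probability Omega R) (I : choiceType) (J : set I)
    (X : I -> {RV P >-> T}) : set (set Omega) :=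
  <<s [set X i @^-1` B | i in J & B in measurable] >>.

Definition independent_systems (R : realType) (d : measure_display)
    (Omega : measurableType d) (P : probability Omega R)
    (G H : set (set Omega)) : Prop :=
  forall A B, G A -> H B -> P (A `&` B) = (P A * P B)%E.

Section ScaleFreePercolation.
Context (R : realType) (n : nat).

Definition eucl_dist (x y : 'rV[int]_n) : R :=
  Num.sqrt (\sum_(i < n) ((x 0 i - y 0 i)%:~R) ^+ 2).

Definition edge (x y : 'rV[int]_n) : {fset 'rV[int]_n} := [fset x; y]%fset.

Definition all_edges : set {fset 'rV[int]_n} := [set e | #|` e| = 2%N].

Definition conn_prob (alpha lambda : R) (x y : 'rV[int]_n) (wx wy : R) : R :=
  if eucl_dist x y == 1 then 1
  else 1 - expR (- (lambda * wx * wy / eucl_dist x y `^ alpha)).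

Section Realization.
Context (d : measure_display) (Omega : measurableType d)
  (P : probability Omega R).
(* [W x] is the weight of vertex [x], [E e] tells whether the unordered pair [e]
   is an edge. Lengths [L e] are attached to all unordered pairs, and only those
   of the present edges are used below. *)
Variables (W : 'rV[int]_n -> {RV P >-> R})
  (E : {fset 'rV[int]_n} -> {RV P >-> bool})
  (L : {fset 'rV[int]_n} -> {RV P >-> R}).

(* The second field says that, for all distinct pairs [e_1], ..., [e_k], the
   conditional probability given [(W x)_x] that they are all present is
   the product of their connection probabilities; this characterizes the
   conditional law of [E]. *)
Record is_SFP (alpha lambda : R) (muW muL : probability R R) : Prop := {
  SFP_weights : iid muW setT W ;
  SFP_edges : forall (s : seq ('rV[int]_n * 'rV[int]_n)) (A : set Omega),
    all (fun p => p.1 != p.2) s -> uniq [seq edge p.1 p.2 | p <- s] ->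
    sigma_rvs setT W A ->
    P (A `&` \bigcap_(p in [set` s]) (E (edge p.1 p.2) @^-1` [set true])) =
    (\int[P]_(w in A)
      (\prod_(p <- s) conn_prob alpha lambda p.1 p.2 (W p.1 w) (W p.2 w))%:E)%E ;
  SFP_lengths : iid muL all_edges L ;
  SFP_lengths_indep : independent_systems P (sigma_rvs all_edges L)
    <<s sigma_rvs setT W `|` sigma_rvs all_edges E >> }.

Definition adjacent (w : Omega) : rel 'rV[int]_n :=
  fun x y => (x != y) && E (edge x y) w.

Fixpoint path_length (w : Omega) (x : 'rV[int]_n) (p : seq 'rV[int]_n) : R :=
  if p is y :: p' then L (edge x y) w + path_length w y p' else 0.

Definition dL (w : Omega) (x y : 'rV[int]_n) : \bar R :=
  ereal_inf [set (path_length w x p)%:E |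
             p in [set p | path (adjacent w) x p /\ last x p = y]].

Definition ballL (w : Omega) (t : R) : set 'rV[int]_n :=
  [set y | (dL w 0 y <= t%:E)%E].

Definition reach_time (w : Omega) (k : nat) : \bar R :=
  ereal_inf [set t%:E | t in [set t : R | 0 <= t /\ (`I_k #<= ballL w t)%card]].

Definition explosive_profile : Prop :=
  {ae P, forall w, (limn (reach_time w) < +oo)%E}.

End Realization.

(* Explosiveness only depends on the law of the model, hence the quantification
   over all its realizations. *)
Definition W_SFP (alpha lambda : R) (muW : probability R R) :
    set (probability R R) :=
  [set muL : probability R R | muL `[0, +oo[%classic = 1%E /\
    forall (d : measure_display) (Omega : measurableType d)
      (P : probability Omega R) (W : 'rV[int]_n -> {RV P >-> R})
      (E : {fset 'rV[int]_n} -> {RV P >-> bool})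
      (L : {fset 'rV[int]_n} -> {RV P >-> R}),
    is_SFP W E L alpha lambda muW muL -> explosive_profile E L].

End ScaleFreePercolation.

Section AgeDependentBranchingProcess.
Context (R : realType).

Section Realization.
Context (d : measure_display) (Omega : measurableType d)
  (P : probability Omega R).
(* Individuals are Ulam-Harris labels read from the individual up to the root:
   [i :: u] is the [i]-th child (counted from 0) of [u], [[::]] the ancestor.
   [D u] and [L u] are the number of offspring and the life length of [u]. *)
Variables (D : seq nat -> {RV P >-> nat}) (L : seq nat -> {RV P >-> R}).

Record is_BP (muD : probability nat R) (muL : probability R R) : Prop := {
  BP_offspring : iid muD setT D ;
  BP_lengths : iid muL setT L ;
  BP_indep : independent_systems P (sigma_rvs setT D) (sigma_rvs setT L) }.

Fixpoint is_born (w : Omega) (u : seq nat) : bool :=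
  if u is i :: v then is_born w v && (i < D v w)%N else true.

Fixpoint birth_time (w : Omega) (u : seq nat) : R :=
  if u is i :: v then birth_time w v + L v w else 0.

Definition infinite_progeny : set Omega :=
  [set w | exists t : R,
     infinite_set [set u | is_born w u /\ birth_time w u <= t]].

Definition explosive_BP : Prop := (0 < P infinite_progeny)%E.

End Realization.

Definition W_BP : set (probability R R) :=
  [set muL : probability R R | muL `[0, +oo[%classic = 1%E /\
    exists (gamma' : R) (muD : probability nat R),
    [/\ 0 < gamma' < 1,
        power_law_tail (fun x : R => muD [set k | x < k%:R]) gamma' &
        forall (d : measure_display) (Omega : measurableType d)
          (P : probability Omega R) (D : seq nat -> {RV P >-> nat})
          (L : seq nat -> {RV P >-> R}),
        is_BP D L muD muL -> explosive_BP D L]].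

End AgeDependentBranchingProcess.

Arguments W_BP R : clear implicits.

(* Main.v *)
(** Both sides are characterized by one condition on [F t = P (L <= t)]: there are
    [eps k >= 0] with bounded partial sums and [exp (- C ^ k) <= F (eps k)] for all
    [k]. The condition does not depend on the base [C > 1].

    If it holds, both processes reach infinity along a chain whose [k]-th step costs
    at most [eps k]: in the tree, individuals with doubly exponentially growing
    offspring; in the lattice, vertices in cubes of doubly exponentially growing side
    [exp (K * c ^ k)], whose weights are so large that two consecutive ones are
    joined by an edge. The latter needs [gamma < 2], and [c] close to 1.

    If it fails, there are [delta k > 0] with unbounded partial sums and
    [F (delta k) <= exp (- C ^ k)]. Individuals (resp. vertices) in the [k]-th of a
    sequence of doubly exponentially growing boxes then have neither too many
    children (resp. no edge jumping over the next box) nor a life length (resp. an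
    edge weight) below [delta k], so that leaving the [k]-th box costs [delta k].
    In the lattice this needs [alpha > d] and [gamma > 1].

    Each time the exceptional events have summable probabilities by union bounds. *)
Require Import Defs.
From HB Require Import structures.
From mathcomp Require Import all_boot all_order all_algebra finmap.
From mathcomp Require Import all_classical all_reals all_analysis.
From mathcomp Require Import measurable_realfun.
From mathcomp Require Import ring lra zify.

Set Implicit Arguments.
Unset Strict Implicit.
Unset Printing Implicit Defensive.

Import Order.TTheory GRing.Theory Num.Theory.
Import numFieldNormedType.Exports.

Local Open Scope classical_set_scope.
Local Open Scope ring_scope.

(** Both classes quantify over all realizations of a model, so excluding a law [muL] requires at
    least one realization to exist. That is the purpose of the coin tosses: one uniform number is
    split into countably many independent ones, and quantiles turn these into the prescribed laws.

    Slowly varying functions enter only through bounds by pure powers with a slightly perturbed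
    exponent; the strict inequalities on [gamma] and [alpha] leave room for the perturbation.
    Freedom in the base [C] lets each argument use its own: 2 for explosion of the tree, a base near
    1 for explosion of the lattice, a large integer for both non-explosions.

    The two models ask for different strengths. A tree needs to explode only with positive
    probability, so one fixed starting scale is enough there, while its non-explosion has to be
    almost sure. The lattice has to explode almost surely, while refuting this takes only positive
    probability. Almost sure statements come from letting the starting scale [m] tend to infinity;
    in the lattice this is possible since nearest-neighbour edges lead from the origin to any first
    hub at finite cost. *)

Lemma nneseries_geometric_le (R : realType) (u : nat -> \bar R) (K q : R) :
  0 <= K -> 0 <= q < 1 -> (forall k, (0 <= u k)%E) ->
  (forall k, (u k <= (K * q ^+ k)%:E)%E) ->
  (\sum_(0 <= k <oo) u k <= (K / (1 - q))%:E)%E.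
Proof.
move=> K0 /andP[q0 q1] u0 bu.
have q1' : 0 < 1 - q by rewrite subr_gt0.
apply: lime_le; first by apply: is_cvg_ereal_nneg_natsum.
near=> n; rewrite /=.
apply: (@le_trans _ _ (\sum_(0 <= k < n) (K * q ^+ k)%:E)%E); first exact: lee_sum.
rewrite sumEFin lee_fin -mulr_sumr; apply: ler_wpM2l => //.
rewrite -[leRHS]mul1r ler_pdivlMr// mulrC.
suff -> : (1 - q) * \sum_(0 <= i < n) q ^+ i = 1 - q ^+ n.
  by rewrite gerBl exprn_ge0.
elim: (n) => [|l IHl]; first by rewrite big_geq// mulr0 expr0 subrr.
by rewrite big_nat_recr//= mulrDr IHl exprS; lra.
Unshelve. all: by end_near. Qed.

(** * Union bounds and independent events *)

Section UnionBounds.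
Context d (Omega : measurableType d) (R : realType) (P : probability Omega R).
Local Open Scope ereal_scope.

Lemma union_bound_seq (I : eqType) (s : seq I) (A : I -> set Omega) (b : R) :
  (forall i, i \in s -> measurable (A i)) -> (forall i, i \in s -> P (A i) <= b%:E) ->
  P (\bigcup_(i in [set` s]) A i) <= ((size s)%:R * b)%:E.
Proof.
elim: s => [|i s IHs] mA bA.
  by rewrite set_nil bigcup_set0 measure0 mul0r.
have -> : \bigcup_(j in [set` i :: s]) A j = A i `|` \bigcup_(j in [set` s]) A j.
  apply/seteqP; split => w.
    move=> [j]; rewrite /= inE => /orP[/eqP ->|js] Aj; first by left.
    by right; exists j.
  move=> [Ai|[j js Aj]]; first by exists i => //=; rewrite inE eqxx.
  by exists j => //=; rewrite inE js orbT.
apply: le_trans (measureU2 _ _ _) _.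
- by apply: mA; rewrite inE eqxx.
- apply: fin_bigcup_measurable => //= j js.
  by apply: mA; rewrite inE js orbT.
rewrite /= -natr1 mulrDl mul1r addrC EFinD; apply: leeD; last first.
  by apply: bA; rewrite inE eqxx.
by apply: IHs => j js; [apply: mA|apply: bA]; rewrite inE js orbT.
Qed.

Lemma union_bound_geometric (A : nat -> set Omega) (K q : R) :
  (0 <= K)%R -> (0 <= q < 1)%R -> (forall k, measurable (A k)) ->
  (forall k, P (A k) <= (K * q ^+ k)%:E) ->
  P (\bigcup_k A k) <= (K / (1 - q))%:E.
Proof.
move=> K0 q01 mA bA.
apply: le_trans (measure_sigma_subadditive P mA (bigcup_measurable (fun k _ => mA k)) (@subset_refl _ _)) _.
exact: nneseries_geometric_le.
Qed.

Definition product_rule (I : eqType) (s : seq I) (G : I -> set Omega) (q : R) : Prop :=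
  forall t, uniq t -> {subset t <= s} -> P (\bigcap_(i in [set` t]) G i) = (q ^+ size t)%:E.

Lemma bigcap_cons (I : eqType) (i : I) (s : seq I) (G : I -> set Omega) :
  \bigcap_(j in [set` i :: s]) G j = G i `&` \bigcap_(j in [set` s]) G j.
Proof.
apply/seteqP; split => w /=.
  move=> H; split; first by apply: H => /=; rewrite inE eqxx.
  by move=> j js; apply: H => /=; rewrite inE js orbT.
by move=> [Gi H] j /=; rewrite inE => /orP[/eqP ->//|]; exact: H.
Qed.

Lemma prob_none (I : eqType) (s : seq I) (G : I -> set Omega) (q : R) :
  uniq s -> (forall i, i \in s -> measurable (G i)) -> product_rule s G q ->
  P (\bigcap_(i in [set` s]) ~` G i) = ((1 - q) ^+ size s)%:E.
Proof.
move=> us mG rule.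
(* Present and absent events are mixed so that an event can move from [u] to [t]: the probability
   with [G i] absent is a difference of two instances with a shorter [u]. *)
suff H (t u : seq I) : uniq (t ++ u) -> {subset t ++ u <= s} ->
    P (\bigcap_(i in [set` t]) G i `&` \bigcap_(i in [set` u]) ~` G i) =
    (q ^+ size t * (1 - q) ^+ size u)%:E.
  have := H [::] s us (fun x => id).
  by rewrite set_nil bigcap_set0 setTI expr0 mul1r.
have mI (v : seq I) : {subset v <= s} -> measurable (\bigcap_(i in [set` v]) G i).
  by move=> vs; apply: fin_bigcap_measurable => //= i /vs; exact: mG.
have mC (v : seq I) : {subset v <= s} -> measurable (\bigcap_(i in [set` v]) ~` G i).
  move=> vs; apply: fin_bigcap_measurable => //= i /vs si.
  by apply: measurableC; exact: mG.
elim: u t => [|i u IHu] t.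
  rewrite cats0 set_nil bigcap_set0 setIT mulr1 => ut ts; exact: rule.
move=> utu tus.
have tsub : {subset t <= s} by move=> j jt; apply: tus; rewrite mem_cat jt.
have usub : {subset u <= s} by move=> j ju; apply: tus; rewrite mem_cat inE ju !orbT.
have si : i \in s by apply: tus; rewrite mem_cat inE eqxx orbT.
have mGi := mG i si.
set A := \bigcap_(i in [set` t]) G i; set B := \bigcap_(i in [set` u]) ~` G i.
have mA : measurable A by exact: mI.
have mB : measurable B by exact: mC.
rewrite bigcap_cons (_ : A `&` (~` G i `&` B) = (A `&` B) `\` (G i)); last first.
  by apply/seteqP; split => w /=; [move=> [? []]|move=> [[? ?] ?]].
have mAB := measurableI _ _ mA mB.
rewrite measureD//; last by rewrite -ge0_fin_numE// fin_num_measure.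
rewrite (_ : A `&` B `&` G i = \bigcap_(j in [set` i :: t]) G j `&` B); last first.
  by rewrite bigcap_cons setIC setIA.
have e1 : P (A `&` B) = (q ^+ size t * (1 - q) ^+ size u)%:E.
  apply: IHu; first by apply: subseq_uniq utu; rewrite cat_subseq// subseq_cons.
  by move=> j; rewrite mem_cat => /orP[/tsub|/usub].
have e2 : P (\bigcap_(j in [set` i :: t]) G j `&` B) =
    (q ^+ size (i :: t) * (1 - q) ^+ size u)%:E.
  apply: IHu; first by rewrite (uniq_catCA [:: i]).
  by move=> j; rewrite /= inE mem_cat => /or3P[/eqP ->//|/tsub|/usub].
transitivity (P (A `&` B) - P (\bigcap_(j in [set` i :: t]) G j `&` B)) => //.
by rewrite e1 e2 -EFinB; congr EFin; rewrite /= !exprS; ring.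
Qed.

End UnionBounds.

Lemma measurable_preimage d d' (T : measurableType d) (T' : measurableType d')
    (f : T -> T') (B : set T') :
  measurable_fun setT f -> measurable B -> measurable (f @^-1` B).
Proof. by move=> mf mB; rewrite -[X in measurable X]setTI; exact: mf. Qed.

(** * Independent families on the space of coin tosses *)

Definition to_mfun d d' (T : measurableType d) (T' : measurableType d')
    (f : T -> T') (mf : measurable_fun setT f) : {mfun T >-> T'} :=
  HB.pack f (isMeasurableFun.Build d d' T T' f mf).

Section LawOnEvent.
Context d d' (T : measurableType d) (T' : measurableType d') (R : realType).
Variables (P : probability T R) (X : {mfun T >-> T'}) (D : set T).
Hypothesis mD : measurable D.

(** The unnormalized conditional law of [X] given [D]. As it is a measure in [B], uniqueness of
    measures can extend an independence identity from generators while the event [D] stays fixed. *)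
Definition law_on of measurable D := fun B : set T' => P (D `&` X @^-1` B).

Local Notation nu := (law_on mD).

Let law_on0 : nu set0 = 0%E.
Proof. by rewrite /law_on preimage_set0 setI0 measure0. Qed.

Let law_on_ge0 A : (0 <= nu A)%E.
Proof. exact: measure_ge0. Qed.

Let law_on_sigma_additive : semi_sigma_additive nu.
Proof.
move=> F mF tF mUF; rewrite /law_on preimage_bigcup setI_bigcupr.
apply: measure_semi_sigma_additive.
- by move=> i; apply: measurableI => //; exact: measurable_funPTI.
- apply: trivIset_setIl; apply/trivIsetP => i j _ _ ij; rewrite -preimage_setI.
  by move/trivIsetP : tF => /(_ _ _ _ _ ij) ->//; rewrite preimage_set0.
- rewrite -setI_bigcupr -preimage_bigcup; apply: measurableI => //.
  exact: measurable_funPTI.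
Qed.

HB.instance Definition _ := isMeasure.Build _ _ _ nu
  law_on0 law_on_ge0 law_on_sigma_additive.
End LawOnEvent.

Section UniformBits.
Context (R : realType).
Local Notation lambda := (@lebesgue_measure R).

(** Lebesgue measure lives on [measurableTypeR R]; the identity carries the uniform law to the
    measurable structure on [R] that the model uses. *)
Lemma measurable_to_default : measurable_fun setT (idfun : measurableTypeR R -> R).
Proof. by move=> _ A mA; rewrite setTI. Qed.

Definition unif : probability R R :=
  distribution (uniform_prob (@ltr01 R)) (to_mfun measurable_to_default).

Lemma unifE (A : set R) : measurable A -> unif A = lambda (A `&` `[0, 1]).
Proof.
move=> mA; rewrite /unif/= /distribution /pushforward/= /uniform_prob integral_uniform_pdf.
rewrite (eq_integral (fun=> 1%E)); last first.
  move=> x; rewrite inE => -[_ /=]; rewrite in_itv/= => x01.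
  by rewrite /uniform_pdf x01 subr0 invr1.
by rewrite integral_cst ?mul1e//; exact: measurableI.
Qed.

Lemma eq_measure_tail (m1 m2 : {measure set R -> \bar R}) :
  (m1 setT < +oo)%E ->
  (forall x, m1 `]x, +oo[%classic = m2 `]x, +oo[%classic) ->
  forall A : set R, measurable A -> m1 A = m2 A.
Proof.
move=> fin1 m12 A mA.
apply: (@measure_unique _ R R (@RGenOInfty.G R)
  (fun k => `]- k%:R, +oo[%classic) _ _ _ _ m1 m2) => //.
- exact: RGenOInfty.measurableE.
- move=> _ _ [x ->] [y ->]; exists (Num.max x y).
  apply/seteqP; split => z /=; rewrite !in_itv/= !andbT gt_max.
    by move=> [-> ->].
  by move/andP.
- by move=> i; exists (- i%:R).
- apply/seteqP; split => // x _; exists (Num.bound `|x : R|) => //=.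
  by rewrite in_itv/= andbT ltrNl (le_lt_trans (ler_norm _))// -(normrN (- x)) opprK; apply: archi_boundP; exact: (normr_ge0 (x : R)).
- by move=> _ [x ->].
- by move=> k; apply: le_lt_trans fin1; apply: le_measure; rewrite ?inE.
Qed.

(** On [[0, 1[] these are the first binary digit and the shift of the binary expansion. Elsewhere
    the values are irrelevant to the uniform law. *)
Definition half_bit (w : R) : bool := 2^-1 <= w.
Definition doubling (w : R) : R := 2 * w - (half_bit w)%:R.

Lemma measurable_half_bit : measurable_fun setT half_bit.
Proof. exact: measurable_fun_ler. Qed.

Lemma measurable_doubling : measurable_fun setT doubling.
Proof.
apply: measurable_funB; first exact: measurable_funM.
rewrite [X in measurable_fun _ X](_ : _ = (fun w : R => if half_bit w then 1 else 0)).
  by apply: measurable_fun_ifT => //; exact: measurable_half_bit.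
by apply/funext => w; case: half_bit.
Qed.

(** On either half of the unit interval [doubling] is affine with slope 2 onto the whole interval,
    up to end points, so preimages have half the length. *)
Lemma unif_half_bit_tail (e : bool) (x : R) :
  (unif ([set w | half_bit w = e] `&` doubling @^-1` `]x, +oo[%classic) =
  (2^-1)%:E * unif `]x, +oo[%classic)%E.
Proof.
have mb : measurable [set w | half_bit w = e].
  exact: (measurable_preimage measurable_half_bit (B := [set e])).
have md : measurable (doubling @^-1` `]x, +oo[%classic).
  exact: measurable_preimage measurable_doubling _.
rewrite !unifE//; last exact: measurableI.
have [x0|x0] := ltP x 0.
  have -> : `]x, +oo[%classic `&` `[0, 1]%classic = `[0, 1]%classic :> set R.
    apply/seteqP; split => w /=; rewrite !in_itv/= ?andbT; first by case.
    by move=> w01; split => //; lra.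
  rewrite lebesgue_measure_itv/= lte_fin ltr01 oppr0 adde0 mule1.
  case: e mb => _.
    have -> : [set w | half_bit w = true] `&` doubling @^-1` `]x, +oo[%classic
        `&` `[0, 1]%classic = `[2^-1, 1]%classic.
      apply/seteqP; split => w /=; rewrite /doubling /half_bit !in_itv/= ?andbT.
        by move=> [[-> _] /andP[_ ->]].
      by move=> /andP[w0 w1]; rewrite w0; split; [split => //=; lra|lra].
    by rewrite lebesgue_measure_itv/= lte_fin ifT; [congr EFin; lra|lra].
  have -> : [set w | half_bit w = false] `&` doubling @^-1` `]x, +oo[%classic
        `&` `[0, 1]%classic = `[0, 2^-1[%classic.
    apply/seteqP; split => w /=; rewrite /doubling /half_bit !in_itv/= ?andbT.
      by move=> [[/negbT + _] /andP[-> _]]; rewrite -ltNge.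
    move=> /andP[w0 w1]; have -> : 2^-1 <= w = false by apply/negbTE; rewrite -ltNge.
    by split; [split => //=; lra|lra].
  by rewrite lebesgue_measure_itv/= lte_fin ifT; [congr EFin; lra|lra].
have -> : `]x, +oo[%classic `&` `[0, 1]%classic = `]x, 1]%classic :> set R.
  apply/seteqP; split => w /=; rewrite !in_itv/= ?andbT.
    by move=> [-> /andP[]].
  by move=> xw1; split => //; lra.
have -> : [set w | half_bit w = e] `&` doubling @^-1` `]x, +oo[%classic
    `&` `[0, 1]%classic = (if e then `](x + 1) / 2, 1] else `]x / 2, 2^-1[)%classic.
  case: e {mb}; apply/seteqP; split => w /=; rewrite /doubling /half_bit !in_itv/= ?andbT.
  - by move=> [[->]] /=; lra.
  - move=> h; have -> : 2^-1 <= w by lra.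
    by split; [split => //=; lra|lra].
  - case; case=> e1; rewrite e1 subr0; have : w < 2^-1 by rewrite ltNge e1.
    by lra.
  - move=> h; have -> : 2^-1 <= w = false by apply/negbTE; rewrite -ltNge; lra.
    by split; [split => //=; lra|lra].
rewrite lebesgue_measure_itv/= lte_fin.
case: e {mb}; rewrite lebesgue_measure_itv/= lte_fin.
  case: ifPn => h1; case: ifPn => h2; rewrite ?mule0//; last 2 first.
  - by exfalso; move: h1 h2; rewrite -leNgt; lra.
  - by exfalso; move: h1 h2; rewrite -leNgt; lra.
  - by rewrite -EFinM; congr EFin; lra.
case: ifPn => h1; case: ifPn => h2; rewrite ?mule0//; last 2 first.
- by exfalso; move: h1 h2; rewrite -leNgt; lra.
- by exfalso; move: h1 h2; rewrite -leNgt; lra.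
- by rewrite -EFinM; congr EFin; lra.
Qed.

(** The first digit is a fair coin, independent of the shifted expansion, which is again uniform. *)
Lemma unif_half_bit (e : bool) (A : set R) : measurable A ->
  (unif ([set w | half_bit w = e] `&` doubling @^-1` A) = (2^-1)%:E * unif A)%E.
Proof.
have mb : measurable [set w | half_bit w = e].
  exact: (measurable_preimage measurable_half_bit (B := [set e])).
have h2 : (0 <= 2^-1 :> R) by lra.
move=> mA.
have := @eq_measure_tail (law_on unif (to_mfun measurable_doubling) mb) (mscale (NngNum h2) unif).
rewrite /= /law_on => /(_ _ _ A mA); apply; last exact: unif_half_bit_tail.
apply: le_lt_trans (ltry 1); apply: probability_le1; apply: measurableI => //.
exact: measurable_preimage measurable_doubling _.
Qed.
End UniformBits.

Section BitSpace.

Definition bit_box (B : nat -> bool -> bool) (n : nat) : set (nat -> bool) :=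
  [set f | forall i, (i < n)%N -> B i (f i)].

Definition bit_boxes := [set bit_box B n | B in setT & n in setT].

Definition bit_space := g_sigma_algebraType bit_boxes.

Lemma measurable_bit_box B n : measurable (bit_box B n : set bit_space).
Proof. by apply: sub_sigma_algebra; exists B => //; exists n. Qed.

Lemma bit_boxT B : bit_box B 0 = setT.
Proof. by apply/seteqP; split. Qed.

Lemma bit_box_widen B n N : (n <= N)%N ->
  bit_box B n = bit_box (fun i => if (i < n)%N then B i else xpredT) N.
Proof.
move=> nN; apply/seteqP; split => f /= Hf i ilt.
  by case: ifP => // /Hf.
by have := Hf i (leq_trans ilt nN); rewrite ilt.
Qed.

Lemma bit_boxI (A B : nat -> bool -> bool) n :
  bit_box A n `&` bit_box B n = bit_box (fun i b => A i b && B i b) n.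
Proof.
apply/seteqP; split => f /=.
  by move=> [Af Bf] i ilt; rewrite /= Af// Bf.
by move=> AB; split => i /AB /andP[].
Qed.

Lemma setI_closed_bit_boxes : setI_closed bit_boxes.
Proof.
move=> _ _ [A _ [n _ <-]] [B _ [m _ <-]].
rewrite (bit_box_widen A (leq_maxl n m)) (bit_box_widen B (leq_maxr n m)) bit_boxI.
by eexists => //; eexists.
Qed.

Lemma measurable_bit_coord (s : nat -> nat) :
  measurable_fun setT ((fun f i => f (s i)) : bit_space -> bit_space).
Proof.
apply: (@measurability _ _ bit_space bit_space setT _ bit_boxes) => // _ [_ [B _ [n _ <-]] <-].
rewrite setTI.
rewrite (_ : _ @^-1` _ = \bigcap_(i in `I_n)
   bit_box (fun j => if j == s i then B i else xpredT) (s i).+1); last first.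
  apply/seteqP; split => f /= Hf.
    move=> i /= ilt j; rewrite ltnS => _; case: eqP => // ->; exact: Hf.
  by move=> i ilt; have := Hf i ilt (s i) (ltnSn _); rewrite eqxx.
apply: fin_bigcap_measurable; first exact: finite_II.
by move=> i _; exact: measurable_bit_box.
Qed.

Context (R : realType).

Definition digits (w : R) : bit_space := fun i => half_bit (iter i (@doubling R) w).

Lemma measurable_digits : measurable_fun setT digits.
Proof.
apply: (@measurability _ _ R bit_space setT _ bit_boxes) => // _ [_ [B _ [n _ <-]] <-].
rewrite setTI.
rewrite (_ : _ @^-1` _ = \bigcap_(i in `I_n)
   ((fun w => half_bit (iter i (@doubling R) w)) @^-1` [set e | B i e])); last first.
  by apply/seteqP; split.
apply: fin_bigcap_measurable; first exact: finite_II.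
move=> i _; apply: measurable_preimage => //.
apply: measurableT_comp; first exact: measurable_half_bit.
elim: i => [|i IH]; first exact: measurable_id.
by apply: measurableT_comp => //; exact: measurable_doubling.
Qed.

Definition coin : probability bit_space R :=
  distribution (unif R) (to_mfun measurable_digits).

Definition bit_weight (B : bool -> bool) : R := ((B true)%:R + (B false)%:R) / 2.

(** The remaining digits of [w] are the digits of [doubling w], so [unif_half_bit] splits off the
    factor of the first bit. *)
Lemma coin_box (B : nat -> bool -> bool) n :
  coin (bit_box B n) = (\prod_(i < n) bit_weight (B i))%:E.
Proof.
have coinE A : coin A = unif R (digits @^-1` A) by [].
elim: n B => [|n IHn] B.
  by rewrite bit_boxT big_ord0 probability_setT.
rewrite big_ord_recl EFinM.
have -> : (\prod_(i < n) bit_weight (B (lift ord0 i)))%:E =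
  coin (bit_box (fun i => B i.+1) n) by rewrite IHn.
rewrite !coinE.
set A := digits @^-1` bit_box (fun i => B i.+1) n.
have mA : measurable A.
  apply: (measurable_preimage measurable_digits); exact: measurable_bit_box.
have mb e : measurable [set w | @half_bit R w = e].
  exact: (measurable_preimage (@measurable_half_bit R) (B := [set e])).
have mS e : measurable ([set w | @half_bit R w = e] `&` @doubling R @^-1` A).
  by apply: measurableI => //; exact: (measurable_preimage (@measurable_doubling R)).
have split e : digits @^-1` bit_box B n.+1 `&` [set w | half_bit w = e] =
    if B 0 e then [set w | @half_bit R w = e] `&` @doubling R @^-1` A else set0.
  case: ifPn => Be; apply/seteqP; split => w //=.
  - move=> [Hw we]; split => // i ilt /=.
    by have := Hw i.+1 ilt; rewrite /digits iterSr.
  - move=> [we Hw]; split => // -[|i] ilt; first by rewrite /digits/= we.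
    by rewrite /digits iterSr; exact: Hw.
  - by move=> [Hw we]; have := Hw 0%N isT; rewrite /digits/= we (negbTE Be).
have -> : digits @^-1` bit_box B n.+1 =
   (digits @^-1` bit_box B n.+1 `&` [set w | half_bit w = true]) `|`
   (digits @^-1` bit_box B n.+1 `&` [set w | half_bit w = false]).
  rewrite -setIUr (_ : _ `|` _ = setT) ?setIT//.
  by apply/seteqP; split => // w _ /=; case: half_bit; [left|right].
rewrite !split measureU; last 3 first.
- by case: ifP.
- by case: ifP.
- case: ifP => _; case: ifP => _; rewrite ?set0I ?setI0//.
  by apply/seteqP; split => w //= [[-> _] []].
rewrite /bit_weight mulrDl EFinD muleDl ?fin_num_measure//.
congr (_ + _)%E; case: ifP => _.
- by rewrite mul1r; exact: unif_half_bit.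
- by rewrite measure0 mul0r mul0e.
- by rewrite mul1r; exact: unif_half_bit.
- by rewrite measure0 mul0r mul0e.
Qed.

Definition bit_even (f : bit_space) : bit_space := fun i => f i.*2.
Definition bit_odd (f : bit_space) : bit_space := fun i => f i.*2.+1.

Lemma measurable_bit_even : measurable_fun setT bit_even.
Proof. exact: (measurable_bit_coord double). Qed.

Lemma measurable_bit_odd : measurable_fun setT bit_odd.
Proof. exact: (measurable_bit_coord (fun i => i.*2.+1)). Qed.

Lemma coin_split_box_eq A B N :
  coin (bit_even @^-1` bit_box A N `&` bit_odd @^-1` bit_box B N) =
  (coin (bit_box A N) * coin (bit_box B N))%E.
Proof.
have -> : bit_even @^-1` bit_box A N `&` bit_odd @^-1` bit_box B N =
    bit_box (fun i => if odd i then B i./2 else A i./2) N.*2.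
  apply/seteqP; split => f /=.
    move=> [Af Bf] i ilt; have i2 : (i./2 < N)%N by lia.
    case: ifPn => oi.
      by have := Bf _ i2; rewrite /bit_odd; congr (B _ (f _)); lia.
    by have := Af _ i2; rewrite /bit_even; congr (A _ (f _)); lia.
  move=> Hf; split => i ilt.
    by have := Hf i.*2; rewrite odd_double/= doubleK ltn_double; exact.
  by have := Hf i.*2.+1; rewrite /= odd_double/= uphalf_double; apply; lia.
rewrite !coin_box -EFinM; congr EFin.
elim: N => [|N IHN]; first by rewrite !big_ord0 mulr1.
rewrite doubleS !big_ord_recr/= IHN odd_double/= doubleK uphalf_double.
by ring.
Qed.

Lemma coin_split_box A B n m :
  coin (bit_even @^-1` bit_box A n `&` bit_odd @^-1` bit_box B m) =
  (coin (bit_box A n) * coin (bit_box B m))%E.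
Proof.
rewrite (bit_box_widen A (leq_maxl n m)) (bit_box_widen B (leq_maxr n m)).
exact: coin_split_box_eq.
Qed.

(** Cylinders generate the events: the identity is extended in [A] with [B] a cylinder ([half]),
    then in [B], each time by uniqueness of measures. *)
Lemma coin_split (A B : set bit_space) : measurable A -> measurable B ->
  coin (bit_even @^-1` A `&` bit_odd @^-1` B) = (coin A * coin B)%E.
Proof.
have me := measurable_bit_even; have mo := measurable_bit_odd.
pose scaled C : {measure set bit_space -> \bar R} :=
  mscale (NngNum (fine_ge0 (measure_ge0 coin C))) coin.
have scaledE C D : measurable C -> scaled C D = (coin C * coin D)%E.
  move=> mC; have -> : scaled C D = ((fine (coin C))%:E * coin D)%E by [].
  by rewrite fineK// fin_num_measure.
have unique (m1 m2 : {measure set bit_space -> \bar R}) :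
    (m1 setT < +oo)%E -> (forall C n, m1 (bit_box C n) = m2 (bit_box C n)) ->
    forall C, measurable C -> m1 C = m2 C.
  move=> fin1 m12 C mC.
  apply: (@measure_unique _ R bit_space bit_boxes (fun=> setT) _ _ _ _ m1 m2) => //.
  - exact: setI_closed_bit_boxes.
  - by move=> i; exists (fun=> xpredT) => //; exists 0%N => //; rewrite bit_boxT.
  - by apply/seteqP; split => // x _; exists 0%N.
  - by move=> _ [D _ [n _ <-]]; exact: m12.
have half C n D : measurable D ->
    coin (bit_even @^-1` D `&` bit_odd @^-1` bit_box C n) =
    (coin D * coin (bit_box C n))%E.
  move=> mD; have mC := measurable_bit_box C n.
  have mC' := measurable_preimage mo mC.
  rewrite muleC -scaledE// setIC.
  apply: (unique (law_on coin (to_mfun me) mC')) => //.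
    rewrite /= /law_on preimage_setT setIT.
    exact: le_lt_trans (probability_le1 coin mC') (ltry 1).
  by move=> E m; rewrite scaledE// muleC -coin_split_box setIC.
move=> mA mB; rewrite -scaledE//.
apply: (unique (law_on coin (to_mfun mo) (measurable_preimage me mA))) => //.
  rewrite /= /law_on preimage_setT setIT.
  exact: le_lt_trans (probability_le1 coin (measurable_preimage me mA)) (ltry 1).
by move=> E m; rewrite scaledE//; exact: half.
Qed.

(* Splitting the even from the odd bits infinitely often yields independent copies
   of the whole bit sequence. *)
Definition bit_proj (j : nat) (f : bit_space) : bit_space :=
  bit_even (iter j bit_odd f).

Lemma measurable_bit_proj j : measurable_fun setT (bit_proj j).
Proof.
apply: measurableT_comp; first exact: measurable_bit_even.
elim: j => [|j IH]; first exact: measurable_id.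
by apply: measurableT_comp => //; exact: measurable_bit_odd.
Qed.

Lemma coin_bit_proj n (B : nat -> set bit_space) : (forall j, measurable (B j)) ->
  coin (\bigcap_(j < n) bit_proj j @^-1` B j) = (\prod_(j < n) coin (B j))%E.
Proof.
elim: n B => [|n IHn] B mB.
  by rewrite big_ord0 bigcap_mkord big_ord0 probability_setT.
rewrite big_ord_recl.
have -> : (\prod_(i < n) coin (B (lift ord0 i)))%E =
    coin (\bigcap_(j < n) bit_proj j @^-1` B j.+1) by rewrite (IHn (fun i => B i.+1)).
rewrite -coin_split//; last first.
  apply: fin_bigcap_measurable; first exact: finite_II.
  by move=> i _; exact: measurable_preimage (measurable_bit_proj i) _.
congr (coin _); apply/seteqP; split => f /=.
  move=> Hf; split; first exact: (Hf 0%N).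
  by move=> i ilt; have := Hf i.+1 ilt; rewrite /= /bit_proj iterSr.
move=> [H0 H1] [|i] ilt //=; rewrite /bit_proj iterSr; exact: H1.
Qed.

(** An arbitrary finite set of indices reduces to an initial segment by giving the missing indices
    the event [setT]. *)
Lemma coin_bit_proj_uniq (s : seq nat) (B : nat -> set bit_space) :
  uniq s -> (forall j, measurable (B j)) ->
  coin (\bigcap_(j in [set` s]) bit_proj j @^-1` B j) = (\prod_(j <- s) coin (B j))%E.
Proof.
move=> us mB.
pose n := (\max_(j <- s) j).+1.
have sn j : j \in s -> (j < n)%N by move=> js; rewrite ltnS; exact: leq_bigmax_seq.
have := @coin_bit_proj n (fun j => if j \in s then B j else setT).
rewrite (_ : \bigcap_(j < n) _ = \bigcap_(j in [set` s]) bit_proj j @^-1` B j); last first.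
  apply/seteqP; split => f /= Hf j.
    by move=> js; have := Hf j (sn j js); rewrite /= js.
  by move=> jn /=; case: ifPn => // js; exact: Hf.
move=> ->; last by move=> j; case: ifP.
rewrite -(big_mkord xpredT (fun j => coin (if j \in s then B j else setT))).
rewrite (eq_bigr (fun j => if j \in s then coin (B j) else 1%E)); last first.
  by move=> j _; case: ifP; rewrite ?probability_setT.
rewrite -big_mkcond -big_filter; apply: perm_big; apply: uniq_perm => //.
  by rewrite filter_uniq// iota_uniq.
move=> j; rewrite mem_filter mem_index_iota /=.
by case: (boolP (j \in s)) => //= /sn ->.
Qed.

(** Each index reads its own block of bits, selected by its code, so a single space carries i.i.d.
    families over any countable index type. *)
Definition iid_copy d' (T' : measurableType d') (X : {mfun bit_space >-> T'})
    (I : countType) (i : I) : {RV coin >-> T'} :=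
  to_mfun (measurableT_comp (measurable_funPT X) (measurable_bit_proj (choice.pickle i))).

Lemma iid_iid_copy d' (T' : measurableType d') (X : {mfun bit_space >-> T'})
    (mu : probability T' R) (I : countType) (J : set I) :
  (forall B, measurable B -> distribution coin X B = mu B) ->
  iid mu J (iid_copy X (I := I)).
Proof.
move=> lawX.
have law (i : I) B : measurable B ->
    coin (iid_copy X i @^-1` B) = coin (X @^-1` B).
  move=> mB; have := @coin_bit_proj_uniq [:: choice.pickle i] (fun=> X @^-1` B) isT.
  rewrite big_seq1 => <-; last by move=> _; exact: measurable_funPTI.
  congr (coin _); apply/seteqP; split => f /= Hf; last by apply: Hf; rewrite /= inE.
  by move=> j /=; rewrite inE => /eqP ->.
split; first by move=> i B _ mB; rewrite -lawX//; exact: law.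
move=> F B _ mB.
pose B' j := if choice.unpickle j is Some i then X @^-1` (B i) else setT.
have := @coin_bit_proj_uniq [seq choice.pickle i | i <- F] B'.
rewrite map_inj_uniq ?fset_uniq; last exact: (pcan_inj (@choice.pickleK I)).
rewrite big_map (eq_bigr (fun i => coin (iid_copy X i @^-1` B i))); last first.
  by move=> i _; rewrite /B' choice.pickleK law.
move=> <- //; last by move=> j; rewrite /B'; case: choice.unpickle => // i; exact: measurable_funPTI.
congr (coin _); apply/seteqP; split => f /= Hf.
  by move=> _ /mapP[i iF ->]; have := Hf i iF; rewrite /B' /= choice.pickleK.
move=> i iF; have := Hf (choice.pickle i); rewrite /B' /= choice.pickleK; apply.
exact: map_f.
Qed.

End BitSpace.

(** * Prescribed laws on the reals and the naturals from coin tosses *)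

Section Quantile.
Context (R : realType).

Definition bits_approx (n : nat) (f : bit_space) : R :=
  \sum_(i < n) (f i)%:R * 2^-1 ^+ i.+1.

Definition bits_real (f : bit_space) : R := limn (bits_approx ^~ f).

Lemma bits_approx_digits n (w : R) :
  bits_approx n (digits w) = w - 2^-1 ^+ n * iter n (@doubling R) w.
Proof.
rewrite /bits_approx; elim: n => [|n IHn]; first by rewrite big_ord0 expr0 mul1r subrr.
rewrite big_ord_recr/= IHn /digits; set v := iter n _ _.
rewrite [in RHS]/doubling exprS; move: (half_bit v)%:R (2^-1 ^+ n) => a b.
by field.
Qed.

Lemma doubling_itv n (w : R) : 0 <= w < 1 -> 0 <= iter n (@doubling R) w < 1.
Proof.
move=> w01; elim: n => //= n; move: (iter n _ _) => v; rewrite /doubling /half_bit.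
by case: (leP 2^-1 v) => /=; lra.
Qed.

Lemma bits_real_digits (w : R) : 0 <= w < 1 -> bits_real (digits w) = w.
Proof.
move=> w01; apply/cvg_lim => //.
have -> : bits_approx ^~ (digits w) =
    (fun n => w - 2^-1 ^+ n * iter n (@doubling R) w).
  by apply/funext => n; exact: bits_approx_digits.
rewrite -[X in _ --> X]subr0; apply: cvgB; first exact: cvg_cst.
apply: (@squeeze_cvgr _ _ _ _ (cst 0) (fun n => 2^-1 ^+ n)); last 2 first.
- exact: cvg_cst.
- by apply: cvg_expr; rewrite ger0_norm; lra.
near=> n; have /andP[d0 d1] := doubling_itv n w01.
have p0 : 0 <= 2^-1 ^+ n :> R by apply: exprn_ge0; lra.
by rewrite /= mulr_ge0//= ler_piMr// ltW.
Unshelve. all: by end_near. Qed.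

Lemma bits_approx_bounds (f : bit_space) n : 0 <= bits_approx n f <= 1 - 2^-1 ^+ n.
Proof.
rewrite /bits_approx; elim: n => [|n IHn]; first by rewrite big_ord0 expr0 subrr lexx.
rewrite big_ord_recr/= exprS.
have p0 : 0 <= 2^-1 ^+ n :> R by apply: exprn_ge0; lra.
by case: (f n) => /=; rewrite ?mulr1n ?mulr0n ?mul1r ?mul0r; lra.
Qed.

Lemma measurable_bits_real : measurable_fun setT bits_real.
Proof.
apply: (measurable_fun_cvg (h := bits_approx)).
  move=> n; rewrite /bits_approx.
  apply: (@measurable_sum _ bit_space R setT 'I_n (index_enum 'I_n) (fun i (f : bit_space) => (f (val i))%:R * 2^-1 ^+ i.+1)).
  move=> i; apply: measurable_funM => //.
  apply: (measurable_comp (F := setT) (f := fun b : bool => b%:R : R)) => //.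
  apply: (measurable_fun_bool true); rewrite setTI.
  rewrite (_ : _ @^-1` _ = bit_box (fun j b => (j == i) ==> b) i.+1).
    exact: measurable_bit_box.
  apply/seteqP; split => f /=.
    by move=> fi j _; apply/implyP => /eqP ->.
  by move=> /(_ i (ltnSn _)); rewrite eqxx.
move=> f _; apply: nondecreasing_is_cvgn.
  apply/nondecreasing_seqP => n; rewrite /bits_approx big_ord_recr/= lerDl.
  by rewrite mulr_ge0// exprn_ge0//; lra.
exists 1 => _ [n _ <-]; have /andP[_] := bits_approx_bounds f n.
by move=> /le_trans; apply; rewrite gerBl exprn_ge0//; lra.
Qed.

Variable mu : probability R R.

Local Notation idrv := (to_mfun (@measurable_id _ R setT) : {RV mu >-> R}).

Definition cumul (x : R) : R := fine (mu `]-oo, x]%classic).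

Lemma cumulE x : mu `]-oo, x]%classic = (cumul x)%:E.
Proof. by rewrite fineK// fin_num_measure. Qed.

Lemma tail_cumul x : mu `]x, +oo[%classic = (1 - cumul x)%:E.
Proof. by rewrite -setCitvl probability_setC// cumulE. Qed.

Lemma cumul_ge0 x : 0 <= cumul x. Proof. exact: fine_ge0. Qed.

Lemma cumul_le1 x : cumul x <= 1.
Proof. by rewrite -lee_fin -cumulE; exact: probability_le1. Qed.

Lemma cumul_le x y : x <= y -> cumul x <= cumul y.
Proof.
move=> xy; rewrite -lee_fin -!cumulE; apply: le_measure; rewrite ?inE//.
by move=> z /=; rewrite !in_itv/= => /le_trans; apply.
Qed.

Lemma cumul_cvg1 : cumul x @[x --> +oo] --> (1 : R).
Proof.
apply: fine_cvg; exact: (@cvg_cdfy1 _ _ _ mu idrv).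
Qed.

Lemma cumul_cvg0 : cumul x @[x --> -oo] --> (0 : R).
Proof.
apply: fine_cvg; exact: (@cvg_cdfNy0 _ _ _ mu idrv).
Qed.

Lemma cumul_right_continuous a : cumul x @[x --> a^'+] --> cumul a.
Proof.
apply: fine_cvg; rewrite -cumulE.
exact: (@cdf_right_continuous _ _ _ mu idrv).
Qed.

(* The guard keeps the infimum away from the sets without lower bound ([u <= 0]) and
   the empty ones ([u >= 1]). *)
Definition quantile (u : R) : R :=
  if 0 < u < 1 then inf [set x | u <= cumul x] else 0.

(** Galois connection between quantile and distribution function. The infimum is attained because
    [cumul] is right-continuous. *)
Lemma quantile_le (u x : R) : 0 < u < 1 -> (quantile u <= x) = (u <= cumul x).
Proof.
move=> u01; rewrite /quantile u01; case/andP: u01 => u0 u1.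
set S := [set x | _].
have hlb : has_lbound S.
  have [a _ Ha] : exists2 a, a \is Num.real & forall y, y < a -> cumul y < u.
    have := cvgr_lt _ cumul_cvg0 u u0; case=> a [ar Ha]; exists a => //.
  exists a => y /= Sy; rewrite leNgt; apply/negP => /Ha; by rewrite ltNge Sy.
have Sne : S !=set0.
  have := cvgr_gt _ cumul_cvg1 u u1; case=> a [ar Ha].
  by exists (a + 1); apply/ltW/Ha; rewrite ltrDl.
apply/idP/idP => [qx|]; last by move=> Sx; apply: ge_inf.
apply: le_trans (cumul_le qx).
rewrite leNgt; apply/negP => ltu.
have := cvgr_lt _ (@cumul_right_continuous (inf S)) u ltu.
move=> [e /= e0 He].
have [y Sy ylt] := inf_adherent e0 (conj Sne hlb).
have Sley := ge_inf hlb Sy.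
suff : cumul y < u by rewrite ltNge Sy.
apply: He => /=; first by rewrite /ball_/= ler0_norm; lra.
rewrite lt_neqAle Sley andbT; apply: contraTneq ltu => ->.
by rewrite -leNgt.
Qed.

Lemma quantile_tail x : quantile @^-1` `]x, +oo[%classic `&` `]0, 1[%classic =
  `]cumul x, 1[%classic.
Proof.
apply/seteqP; split => u /=; rewrite !in_itv/= ?andbT.
  by move=> [+ u01]; rewrite ltNge quantile_le// -ltNge => ->; case/andP: u01.
move=> /andP[cu u1]; have u01 : 0 < u < 1.
  by rewrite u1 andbT (le_lt_trans (cumul_ge0 x)).
by rewrite u01 ltNge quantile_le// -ltNge.
Qed.

Lemma measurable_quantile : measurable_fun setT quantile.
Proof.
apply: (@measurability _ _ R R setT _ (@RGenOInfty.G R)).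
  exact: RGenOInfty.measurableE.
move=> _ [_ [x ->] <-]; rewrite setTI.
rewrite -(setIT (_ @^-1` _)) -(setUv (`]0, 1[%classic : set R)) setIUr quantile_tail.
apply: measurableU => //.
rewrite (_ : _ `&` _ = if x < 0 then ~` `]0, 1[%classic else set0).
  by case: ifP => // _; exact: measurableC.
apply/seteqP; split => u /=; rewrite !in_itv/= andbT /quantile.
  by move=> [+ /negP/negbTE nu]; rewrite nu => -> /=; rewrite in_itv/= nu.
by case: ifP => // x0 /=; rewrite in_itv/= => /negP nu; rewrite (negbTE nu).
Qed.

Definition quantile_bits : {mfun bit_space >-> R} :=
  to_mfun (measurableT_comp measurable_quantile measurable_bits_real).

Lemma distribution_quantile_bits B : measurable B ->
  distribution (coin R) quantile_bits B = mu B.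
Proof.
apply: (@eq_measure_tail R (distribution (coin R) quantile_bits) mu).
  by rewrite [X in (X < _)%E](probability_setT (coin R)) ltry.
move=> x.
rewrite [RHS](_ : _ = (1 - cumul x)%:E); last exact: tail_cumul.
set S := (quantile \o bits_real \o @digits R) @^-1` `]x, +oo[%classic.
have mS : measurable S.
  have mq : measurable (quantile_bits @^-1` `]x, +oo[%classic) by exact: measurable_funPTI.
  exact: (measurable_preimage (@measurable_digits R) mq).
rewrite [LHS](_ : _ = unif R S)// unifE//.
(* The end points form a null set and are removed: [quantile] takes its default value there. *)
have m01 : measurable ([set 0; 1] : set R) by apply: measurableU.
rewrite (@measureDI _ (measurableTypeR R) R lebesgue_measure _ [set 0; 1] _ m01); last exact: measurableI.
rewrite [X in (_ + X)%E](_ : _ = 0%E) ?adde0; last first.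
  apply: countable_lebesgue_measure0; apply: finite_set_countable.
  by apply: (sub_finite_set (B := [set 0; 1])) => // w [].
have -> : S `&` `[0, 1]%classic `\` [set 0; 1] = `]cumul x, 1[%classic.
  rewrite -quantile_tail; apply/seteqP; split => u.
    move=> [[Su]] /=; rewrite !in_itv/= => u01 /not_orP[/eqP u0 /eqP u1].
    have u01' : 0 < u < 1 by lra.
    split=> //; move: Su; rewrite /S /= bits_real_digits ?in_itv//=.
    by case/andP: u01' => /ltW -> ->.
  move=> [/= + ]; rewrite !in_itv/= => Su u01; split; last first.
    by case=> u_; move: u01; rewrite u_; lra.
  split; last by lra.
  by rewrite /S /= bits_real_digits ?in_itv//=; lra.
rewrite [LHS](@lebesgue_measure_itv R `]cumul x, 1[)/= lte_fin EFinB.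
have := cumul_le1 x; rewrite le_eqVlt => /orP[/eqP ->|->//].
by rewrite ltxx -EFinB subrr.
Qed.
End Quantile.

Section NatCopy.
Context (R : realType) (mu : probability nat R).

Let measurable_natr : measurable_fun setT (fun k : nat => k%:R : R).
Proof. by []. Qed.

Lemma measurable_truncn : measurable_fun setT (@Num.truncn R).
Proof.
move=> _ B _; rewrite setTI.
rewrite (_ : _ @^-1` _ = \bigcup_(k in B) (@Num.truncn R @^-1` [set k])); last first.
  apply/seteqP; split => x /=; first by move=> Bx; exists (Num.truncn x).
  by move=> [k Bk /= ->].
apply: bigcup_measurable => k _.
rewrite (_ : _ @^-1` _ = if k == 0%N then `]-oo, 1[%classic else `[k%:R, k.+1%:R[%classic).
  by case: ifP.
case: eqP => [->|/eqP k0]; apply/seteqP; split => x /=; rewrite in_itv/=.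
- by move=> tx; have := truncnS_gt x; rewrite tx.
- by move=> x1; apply/truncn0Pn; rewrite -ltNge.
- move=> tx; have x0 : 0 <= x by apply: le_trans (ler01) _; rewrite -truncn_gt0 tx lt0n.
  by rewrite -tx; exact: truncn_itv.
- by move=> xk; apply: truncn_def.
Qed.

(** Embedding the law in [R] makes the quantile construction available for [nat]; [Num.truncn]
    undoes the embedding. *)
Definition natr_law : probability R R := distribution mu (to_mfun measurable_natr).

Definition nat_bits : {mfun bit_space >-> nat} :=
  to_mfun (measurableT_comp measurable_truncn (measurable_funPT (quantile_bits natr_law))).

Lemma distribution_nat_bits B : measurable B ->
  distribution (coin R) nat_bits B = mu B.
Proof.
move=> mB; have mtB := measurable_preimage measurable_truncn mB.
have := distribution_quantile_bits natr_law mtB.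
rewrite /distribution /pushforward /= => ->; rewrite /distribution /pushforward /=.
by congr (mu _); apply/seteqP; split => k /=; rewrite natrK.
Qed.

End NatCopy.

(** * Elementary estimates on powers and partial sums *)

Lemma dyadic_floor (R : realType) (x : R) : 1 <= x ->
  exists j, 2 ^+ j <= x < 2 ^+ j.+1.
Proof.
move=> x1; set m := Num.truncn x.
have m0 : (0 < m)%N by rewrite truncn_gt0.
have /andP[mx xm] : m%:R <= x < m.+1%:R by apply: truncn_itv; exact: le_trans x1.
exists (trunc_log 2 m); apply/andP; split.
  by apply: le_trans mx; rewrite -natrX ler_nat; exact: trunc_logP.
by apply: lt_le_trans xm _; rewrite -natrX ler_nat; exact: trunc_log_ltn.
Qed.

Lemma exprn_unbounded (R : realType) (C S : R) : 1 < C -> exists m, S <= C ^+ m.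
Proof.
move=> C1; have h : 0 < C - 1 by rewrite subr_gt0.
have bern n : 1 + n%:R * (C - 1) <= C ^+ n.
  elim: n => [|n IHn]; first by rewrite mul0r addr0 expr0.
  rewrite exprS -natr1; have Cn : 0 <= C - 1 by exact: ltW.
  have : C * (1 + n%:R * (C - 1)) <= C * C ^+ n by rewrite ler_pM2l//; lra.
  apply: le_trans; have : 0 <= n%:R * (C - 1) * (C - 1) by rewrite !mulr_ge0.
  by move: (n%:R : R) => y; nra.
exists (Num.truncn (S / (C - 1))).+1; apply: le_trans (bern _).
have := truncnS_gt (S / (C - 1)); rewrite ltr_pdivrMr// => /ltW; lra.
Qed.

Lemma ler_sum_prefix (R : realType) (f : nat -> R) (n m : nat) :
  (forall k, 0 <= f k) -> (n <= m)%N -> \sum_(k < n) f k <= \sum_(k < m) f k.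
Proof.
move=> f0 nm; rewrite -(subnKC nm) big_split_ord/= lerDl.
by apply: sumr_ge0 => k _; exact: f0.
Qed.

(** * The explosion criterion *)

Section Criterion.
Context (R : realType) (mu : probability R R).
Local Notation F := (cumul mu).

Definition explosion_criterion (C : R) : Prop :=
  exists eps : nat -> R, [/\ forall k, 0 <= eps k,
    forall k, expR (- C ^+ k) <= F (eps k) &
    exists S, forall n, \sum_(k < n) eps k <= S].

(** With [C <= C' ^ m], repeat every term [m] times: the sums grow only by the factor [m], and
    [C' ^ k] is at least [C ^ (k %/ m)]. *)
Lemma explosion_criterion_change (C C' : R) : 1 < C -> 1 < C' ->
  explosion_criterion C -> explosion_criterion C'.
Proof.
move=> C1 C'1 [eps [eps0 epsF [S epsS]]].
have [m0 Hm0] := exprn_unbounded C C'1; pose m := m0.+1.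
have Cm : C <= C' ^+ m.
  by apply: le_trans Hm0 _; rewrite ler_weXn2l// ltW.
exists (fun k => eps (k %/ m)%N); split => //.
  move=> k; apply: le_trans (epsF (k %/ m)%N); rewrite ler_expR lerN2.
  apply: (@le_trans _ _ ((C' ^+ m) ^+ (k %/ m)%N)).
    by apply: lerXn2r; rewrite ?nnegrE//; [lra|apply: exprn_ge0; lra].
  rewrite -exprM ler_weXn2l//; first exact: ltW.
  by rewrite mulnC leq_divM.
have sumM n : \sum_(k < n * m) eps (k %/ m)%N = m%:R * \sum_(k < n) eps k.
  elim: n => [|n IHn]; first by rewrite mul0n !big_ord0 mulr0.
  rewrite mulSn addnC big_split_ord/= IHn [in RHS]big_ord_recr/= mulrDr; congr (_ + _).
  rewrite (eq_bigr (fun=> eps n)); last first.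
    by move=> i _; rewrite divnMDl// divn_small// addn0.
  by rewrite sumr_const card_ord mulr_natl.
exists (m%:R * S) => n; apply: (@le_trans _ _ (\sum_(k < n * m) eps (k %/ m)%N)).
  by apply: (ler_sum_prefix (fun k => eps0 (k %/ m)%N)); rewrite leq_pmulr.
by rewrite sumM ler_wpM2l.
Qed.

(** [q k] is the nonnegative quantile at level [exp (- C ^ k)]. Were its sums bounded, [q k] plus
    the summable margin [2^-1 ^+ k], which steps off the infimum, would satisfy the criterion. *)
Lemma not_explosion_criterion (C : R) : 1 < C -> ~ explosion_criterion C ->
  exists delta : nat -> R, [/\ forall k, 0 < delta k,
    forall k, F (delta k) <= expR (- C ^+ k) &
    forall S, exists n, S < \sum_(k < n) delta k].
Proof.
move=> C1 ncrit.
pose A k := [set t : R | 0 <= t /\ expR (- C ^+ k) <= F t].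
have Ck0 k : 0 < C ^+ k by apply: exprn_gt0; lra.
have Alb k : has_lbound (A k) by exists 0 => t [].
have Ane k : A k !=set0.
  have := cvgr_ge _ (@cumul_cvg1 _ mu) (expR (- C ^+ k)).
  rewrite expR_lt1 oppr_lt0 => /(_ _ (Ck0 k)) [a [ar Ha]].
  exists (Num.max 0 (a + 1)); split; first by rewrite le_max lexx.
  by apply: Ha; rewrite lt_max ltrDl ltr01 orbT.
pose q k := inf (A k).
have q0 k : 0 <= q k by apply: lb_le_inf => // t [].
have AF k t : q k < t -> expR (- C ^+ k) <= F t.
  move=> qt; have [s [s0 sF] st] := inf_lt (Ane k) qt.
  by apply: le_trans sF _; apply: cumul_le; exact: ltW.
have unb S : exists n, S < \sum_(k < n) q k.
  apply: contrapT => H; apply: ncrit.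
  exists (fun k => q k + 2^-1 ^+ k); split.
  - by move=> k; rewrite addr_ge0// exprn_ge0//; lra.
  - by move=> k; apply: AF; rewrite ltrDl exprn_gt0//; lra.
  exists (S + 2) => n; rewrite big_split/=; apply: lerD.
    by rewrite leNgt; apply/negP => Hn; apply: H; exists n.
  have -> : \sum_(k < n) 2^-1 ^+ k = 2 - 2 * 2^-1 ^+ n :> R.
    elim: n => [|n IHn]; first by rewrite big_ord0 expr0; lra.
    by rewrite big_ord_recr/= IHn exprS; lra.
  by rewrite gerBl mulr_ge0// exprn_ge0//; lra.
have qmono k j : (k <= j)%N -> q j <= q k.
  move=> kj; apply: lb_le_inf => // t [t0 tF]; apply: ge_inf => //; split => //.
  by apply: le_trans tF; rewrite ler_expR lerN2 ler_weXn2l// ltW.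
(* [q] is nonincreasing, so a zero at [k] would freeze the sums from there on and bound them. *)
have qpos k : 0 < q k.
  rewrite lt_neqAle q0 andbT; apply/eqP => qk0.
  have [n Hn] := unb (\sum_(j < k) q j).
  have [nk|kn] := leqP n k.
    by move: Hn; rewrite ltNge => /negP; apply; exact: ler_sum_prefix.
  move: Hn; rewrite -(subnKC (ltnW kn)) big_split_ord/= [X in _ + X]big1 ?addr0 ?ltxx//.
  by move=> j _; apply/eqP; rewrite eq_le q0 andbT qk0 qmono// leq_addr.
(* [F] may jump at [q k]; half of it lies strictly below the infimum, where [F] is still under the
   level. *)
exists (fun k => q k / 2); split.
- by move=> k; rewrite divr_gt0.
- move=> k; rewrite leNgt; apply/negP => /ltW Fq.
  have : q k <= q k / 2 by apply: ge_inf => //; split=> //; rewrite divr_ge0.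
  by have := qpos k; lra.
move=> S; have [n Hn] := unb (2 * S); exists n.
by rewrite -mulr_suml ltr_pdivlMr// mulrC.
Qed.

End Criterion.

Lemma unbounded_shift (R : realType) (delta : nat -> R) (m : nat) :
  (forall k, 0 < delta k) -> (forall S, exists n, S < \sum_(k < n) delta k) ->
  forall S, exists n, S < \sum_(k < n) delta (k + m)%N.
Proof.
move=> d0 unb S; have [n Hn] := unb (S + \sum_(k < m) delta k).
exists n; rewrite -(ltrD2r (\sum_(k < m) delta k)); apply: lt_le_trans Hn _.
rewrite addrC [X in _ + X](eq_bigr (fun k : 'I_n => delta (m + k)%N)); last first.
  by move=> k _; rewrite addnC.
have <- : \sum_(k < m + n) delta k = \sum_(k < m) delta k + \sum_(k < n) delta (m + k)%N.
  by rewrite big_split_ord.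
by apply: ler_sum_prefix; [move=> k; exact: ltW|exact: leq_addl].
Qed.

(** * Bounding power-law tails by pure powers *)

Section PowerLaw.
Context (R : realType) (tail : R -> \bar R) (g : R -> R) (rho : R).
Hypothesis tailg : forall x, 0 < x -> tail x = (g x)%:E.
Hypothesis g_mono : forall x y, x <= y -> g y <= g x.
Hypothesis tail_rho : power_law_tail tail rho.

Let powR_exprn (s : R) j : (2 ^+ j) `^ s = (2 `^ s) ^+ j :> R.
Proof.
by rewrite -(@powR_mulrn R 2 j (ler0n _ 2)) -(@powR_mulrn R (2 `^ s) j (powR_ge0 _ _)) -!powRrM mulrC.
Qed.

Let powR2_lt : forall r s : R, r < s -> 2 `^ (- s) < 2 `^ (- r) :> R.
Proof.
move=> r s rs; rewrite /powR pnatr_eq0/= ltr_expR.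
by rewrite ltr_pM2r ?ltrN2// ln_gt0// ltr1n.
Qed.

Let ratio_cvg : (g (2 * x) / g x @[x --> +oo] --> 2 `^ (- rho)) /\
  \forall x \near +oo, 0 < g x.
Proof.
case: tail_rho => l [[x0 x00 [_ lpos]] lcvg] taill.
have gl x : 0 < x -> g x = l x / x `^ rho.
  by move=> xp; have := taill x xp; rewrite tailg// => -[].
split; last first.
  near=> x; have xp : 0 < x by near: x; apply: nbhs_pinfty_gt; exact: num_real.
  rewrite gl// divr_gt0 ?powR_gt0//; apply: lpos; near: x; apply: nbhs_pinfty_ge; exact: num_real.
have -> : 2 `^ (- rho) = 1 * 2 `^ (- rho) :> R by rewrite mul1r.
have H : l (2 * x) / l x * 2 `^ (- rho) @[x --> +oo] --> 1 * 2 `^ (- rho).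
  by apply: cvgM; [exact: lcvg|exact: cvg_cst].
apply: cvg_trans H; apply: near_eq_cvg; near=> x.
have xp : 0 < x by near: x; apply: nbhs_pinfty_gt; exact: num_real.
have lx : 0 < l x by apply: lpos; near: x; apply: nbhs_pinfty_ge; exact: num_real.
rewrite /= !gl ?mulr_gt0// powRM ?ltW// powRN.
have x1 := powR_gt0 rho xp; have x2 := @powR_gt0 _ 2 rho (ltr0n _ 2).
by field; rewrite !gt_eqF.
Unshelve. all: by end_near. Qed.

(** One-sided Potter bound. Slow variation is used for the factor 2 only: from [t0] on each doubling
    keeps at least the fraction [2 ^ (- rho')], and monotonicity of [g] bridges the gap between [t]
    and the next dyadic multiple of [t0]. *)
Lemma power_law_lower (rho' : R) : 0 < rho' -> rho < rho' ->
  exists2 kappa, 0 < kappa &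
  exists2 t0, 1 <= t0 & forall t, t0 <= t -> kappa / t `^ rho' <= g t.
Proof.
move=> r0 rr; have [gcvg gpos] := ratio_cvg.
have lt2 : 2 `^ (- rho') < 2 `^ (- rho) :> R by exact: powR2_lt.
have H : \forall t \near +oo, [/\ 1 <= t, 0 < g t & 2 `^ (- rho') <= g (2 * t) / g t].
  near=> t; split; near: t.
  - by apply: nbhs_pinfty_ge; exact: num_real.
  - exact: gpos.
  - exact: cvgr_ge gcvg _ lt2.
have [a [ar Ha]] := H; pose t0 := Num.max 1 (a + 1).
have Ht0 t : t0 <= t -> [/\ 1 <= t, 0 < g t & 2 `^ (- rho') <= g (2 * t) / g t].
  by rewrite ge_max => /andP[_ at0]; apply: Ha; lra.
have t01 : 1 <= t0 by rewrite le_max lexx.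
have [_ gt0 _] := Ht0 t0 (lexx _).
have iter j : (2 `^ (- rho')) ^+ j * g t0 <= g (2 ^+ j * t0).
  elim: j => [|j IHj]; first by rewrite !expr0 !mul1r.
  have t0j : t0 <= 2 ^+ j * t0 by rewrite ler_peMl ?exprn_ege1//; lra.
  have [_ gj] := Ht0 _ t0j; rewrite ler_pdivlMr// => dj.
  by rewrite !exprS -!mulrA; apply: le_trans dj; apply: ler_wpM2l => //; exact: powR_ge0.
exists (2 `^ (- rho') * g t0 * t0 `^ rho').
  by rewrite !mulr_gt0 ?powR_gt0//; lra.
exists t0 => // t tt0; have t0p : 0 < t0 by lra.
have [j /andP[j1 j2]] : exists j, 2 ^+ j <= t / t0 < 2 ^+ j.+1.
  by apply: dyadic_floor; rewrite ler_pdivlMr// mul1r.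
apply: le_trans (g_mono (_ : t <= 2 ^+ j.+1 * t0)); last first.
  by rewrite -ler_pdivrMr// ltW.
apply: le_trans (iter j.+1).
have tp : 0 < t by lra.
have T0 := powR_gt0 rho' tp.
have A0 : 0 < 2 `^ rho' :> R by exact: powR_gt0.
rewrite ler_pdivrMr// powRN.
have : (2 `^ rho') ^+ j * t0 `^ rho' <= t `^ rho'.
  rewrite -powR_exprn -powRM ?exprn_ge0//; last exact: ltW.
  apply: ge0_ler_powR; rewrite ?nnegrE ?mulr_ge0 ?exprn_ge0//; try exact: ltW.
  by rewrite -ler_pdivlMr.
move=> jt.
have -> : (2 `^ rho')^-1 * g t0 * t0 `^ rho' =
    (2 `^ rho')^-1 ^+ j.+1 * g t0 * ((2 `^ rho') ^+ j * t0 `^ rho').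
  rewrite exprS exprVn; have Aj : 0 < (2 `^ rho') ^+ j by exact: exprn_gt0.
  by field; rewrite !gt_eqF.
by apply: ler_wpM2l => //; rewrite mulr_ge0 ?exprn_ge0 ?invr_ge0//; exact: ltW.
Unshelve. all: by end_near. Qed.

(** The mirror image of the lower bound, where monotonicity bridges down to the previous dyadic
    multiple; below [t0] the bound [g <= 1] is absorbed by the constant. *)
Lemma power_law_upper (rho' : R) : (forall x, g x <= 1) -> (forall x, 0 <= g x) ->
  0 < rho' -> rho' < rho ->
  exists2 K, 0 < K & forall t, 1 <= t -> g t <= K / t `^ rho'.
Proof.
move=> g1 g0 r0 rr; have [gcvg gpos] := ratio_cvg.
have lt2 := powR2_lt rr.
have H : \forall t \near +oo, [/\ 1 <= t, 0 < g t & g (2 * t) / g t <= 2 `^ (- rho')].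
  near=> t; split; near: t.
  - by apply: nbhs_pinfty_ge; exact: num_real.
  - exact: gpos.
  - exact: cvgr_le gcvg _ lt2.
have [a [ar Ha]] := H; pose t0 := Num.max 1 (a + 1).
have Ht0 t : t0 <= t -> [/\ 1 <= t, 0 < g t & g (2 * t) / g t <= 2 `^ (- rho')].
  by rewrite ge_max => /andP[_ at0]; apply: Ha; lra.
have t01 : 1 <= t0 by rewrite le_max lexx.
have iter j : g (2 ^+ j * t0) <= (2 `^ (- rho')) ^+ j.
  elim: j => [|j IHj]; first by rewrite !expr0 !mul1r.
  have t0j : t0 <= 2 ^+ j * t0 by rewrite ler_peMl ?exprn_ege1//; lra.
  have [_ gj] := Ht0 _ t0j; rewrite ler_pdivrMr// => dj.
  by rewrite !exprS -!mulrA; apply: le_trans dj _; apply: ler_wpM2l => //; exact: powR_ge0.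
have t0p : 0 < t0 by lra.
have A0 : 0 < 2 `^ rho' :> R by exact: powR_gt0.
have A1 : 1 <= 2 `^ rho' :> R.
  by rewrite -[leLHS](powRr0 2); apply: ler_powR; [lra|exact: ltW].
have B0 : 0 < t0 `^ rho' by exact: powR_gt0.
exists (2 `^ rho' * t0 `^ rho'); first by rewrite mulr_gt0.
move=> t t1; have tp : 0 < t by lra.
have T0 := powR_gt0 rho' tp; rewrite ler_pdivlMr//.
have [tt0|tt0] := ltP t t0.
  apply: (@le_trans _ _ (1 * t0 `^ rho')).
    apply: ler_pM => //; first exact: ltW.
    by apply: ge0_ler_powR; rewrite ?nnegrE; lra.
  by apply: ler_wpM2r => //; exact: ltW.
have [j /andP[j1 j2]] : exists j, 2 ^+ j <= t / t0 < 2 ^+ j.+1.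
  by apply: dyadic_floor; rewrite ler_pdivlMr// mul1r.
have gt : g t <= (2 `^ (- rho')) ^+ j.
  by apply: le_trans (g_mono _) (iter j); rewrite -ler_pdivlMr.
have tj : t `^ rho' <= (2 `^ rho') ^+ j.+1 * t0 `^ rho'.
  rewrite -powR_exprn -powRM ?exprn_ge0//; last exact: ltW.
  apply: ge0_ler_powR; rewrite ?nnegrE ?mulr_ge0 ?exprn_ge0//; try exact: ltW.
  by rewrite -ler_pdivrMr// ltW.
apply: (le_trans (ler_pM (g0 t) (ltW T0) gt tj)).
rewrite powRN exprS exprVn; have Aj : 0 < (2 `^ rho') ^+ j by exact: exprn_gt0.
move: Aj; move: ((2 `^ rho') ^+ j) => X X0.
by rewrite le_eqVlt; apply/orP; left; apply/eqP; field; rewrite gt_eqF.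
Unshelve. all: by end_near. Qed.
End PowerLaw.

Lemma expRN1_bounds (R : realType) : (2^-1 : R) ^+ 2 <= expR (- 1) <= (2^-1 : R).
Proof.
apply/andP; split.
  have -> : - 1 = (- 2^-1) * 2%:R :> R by lra.
  rewrite expRM_natr; apply: lerXn2r; rewrite ?nnegrE ?expR_ge0//.
  by apply: le_trans (expR_ge1Dx _); lra.
by rewrite expRN lef_pV2 ?posrE ?expR_gt0//; apply: le_trans (expR_ge1Dx _); lra.
Qed.

Lemma expRN_nat (R : realType) (n : nat) : expR (- n%:R) = expR (- 1) ^+ n :> R.
Proof. by rewrite -expRM_natl mulrN1. Qed.

(** Box sizes are powers of two, so exponentials are compared with powers of [2^-1]. *)
Lemma expRN_nat_bounds (R : realType) (n : nat) :
  (2^-1 : R) ^+ (2 * n) <= expR (- n%:R) <= (2^-1 : R) ^+ n.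
Proof.
have /andP[e1 e2] := expRN1_bounds R; rewrite expRN_nat exprM.
by apply/andP; split; apply: lerXn2r; rewrite ?nnegrE ?expR_ge0// exprn_ge0//; lra.
Qed.

(** * Independence *)

Section ProductRule.
Context d (Omega : measurableType d) (R : realType) (P : probability Omega R).
Context d' (T : measurableType d') (mu : probability T R).

Lemma iid_bigcap (I : choiceType) (K : eqType) (J : set I) (X : I -> {RV P >-> T})
    (t : seq K) (f : K -> I) (B : set T) :
  iid mu J X -> uniq t -> {in t &, injective f} -> (forall i, i \in t -> J (f i)) ->
  measurable B ->
  P (\bigcap_(i in [set` t]) X (f i) @^-1` B) = (fine (mu B) ^+ size t)%:E.
Proof.
move=> [law indep] ut finj fJ mB.
pose F := [fset x in map f t]%fset.
have FE : enum_fset F =i map f t by move=> x; rewrite in_fset.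
have umap : uniq (map f t) by rewrite map_inj_in_uniq.
have -> : \bigcap_(i in [set` t]) X (f i) @^-1` B = \bigcap_(j in [set` F]) X j @^-1` B.
  apply/seteqP; split => w Hw i.
    by move=> /=; rewrite in_fset => /mapP[k kt ->]; exact: Hw.
  by move=> it; apply: Hw => /=; rewrite in_fset; exact: map_f.
rewrite (indep F (fun=> B))//; last first.
  by move=> j /=; rewrite in_fset => /mapP[k kt ->]; exact: fJ.
rewrite (perm_big (map f t)); last by apply: uniq_perm => //; exact: fset_uniq.
rewrite big_map big_seq (eq_bigr (fun=> (fine (mu B))%:E)); last first.
  move=> i it; rewrite fineK ?fin_num_measure//.
  by rewrite -(law (f i) B (fJ i it) mB).
rewrite -big_seq; elim: (t) => [|i u IHu]; first by rewrite big_nil.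
by rewrite big_cons IHu exprS.
Qed.

Lemma sigma_rvs_measurable (I : choiceType) (J : set I) (X : I -> {RV P >-> T}) A :
  sigma_rvs J X A -> measurable A.
Proof.
apply; split.
  split; first exact: measurable0.
    by move=> B mB; rewrite setTD; exact: measurableC.
  by move=> F mF; exact: bigcupT_measurable.
by move=> _ [i Ji [B mB <-]]; exact: measurable_funPTI.
Qed.

Lemma sigma_rvs_preimage (I : choiceType) (J : set I) (X : I -> {RV P >-> T}) i B :
  J i -> measurable B -> sigma_rvs J X (X i @^-1` B).
Proof. by move=> Ji mB; apply: sub_sigma_algebra; exists i => //; exists B. Qed.

Lemma sigma_algebra_setI (G : set (set Omega)) A B :
  <<s G >> A -> <<s G >> B -> <<s G >> (A `&` B).
Proof.
exact: (@measurableI _ (g_sigma_algebraType G)).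
Qed.

Lemma sigma_algebra_bigcap_seq (G : set (set Omega)) (K : eqType) (t : seq K)
    (A : K -> set Omega) :
  (forall i, i \in t -> <<s G >> (A i)) -> <<s G >> (\bigcap_(i in [set` t]) A i).
Proof.
elim: t => [|i t IHt] HA.
  rewrite set_nil bigcap_set0; exact: (@measurableT _ (g_sigma_algebraType G)).
rewrite bigcap_cons; apply: sigma_algebra_setI.
  by apply: HA; rewrite inE eqxx.
by apply: IHt => j jt; apply: HA; rewrite inE jt orbT.
Qed.

End ProductRule.

Lemma iid_pair_product_rule d (Omega : measurableType d) (R : realType)
    (P : probability Omega R) d1 d2 (T1 : measurableType d1) (T2 : measurableType d2)
    (mu1 : probability T1 R) (mu2 : probability T2 R) (I1 I2 : choiceType)
    (K : eqType) (J1 : set I1) (J2 : set I2)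
    (X : I1 -> {RV P >-> T1}) (Y : I2 -> {RV P >-> T2})
    (t : seq K) (f : K -> I1) (g : K -> I2) (A : set T1) (B : set T2) :
  iid mu1 J1 X -> iid mu2 J2 Y ->
  independent_systems P (sigma_rvs J1 X) (sigma_rvs J2 Y) ->
  {in t &, injective f} -> {in t &, injective g} ->
  (forall i, i \in t -> J1 (f i)) -> (forall i, i \in t -> J2 (g i)) ->
  measurable A -> measurable B ->
  product_rule P t (fun i => X (f i) @^-1` A `&` Y (g i) @^-1` B)
    (fine (mu1 A) * fine (mu2 B)).
Proof.
move=> iidX iidY indep finj ginj fJ gJ mA mB u uu ut.
rewrite bigcapI indep; last 2 first.
- apply: sigma_algebra_bigcap_seq => i /ut it.
  by apply: sigma_rvs_preimage => //; exact: fJ.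
- apply: sigma_algebra_bigcap_seq => i /ut it.
  by apply: sigma_rvs_preimage => //; exact: gJ.
rewrite (iid_bigcap iidX)//; last 2 first.
- by move=> i j /ut it /ut jt; exact: finj.
- by move=> i /ut; exact: fJ.
rewrite (iid_bigcap iidY)//; last 2 first.
- by move=> i j /ut it /ut jt; exact: ginj.
- by move=> i /ut; exact: gJ.
by rewrite -EFinM exprMn.
Qed.

Lemma iid_prob d (Omega : measurableType d) (R : realType) (P : probability Omega R)
    d' (T : measurableType d') (mu : probability T R) (I : choiceType) (J : set I)
    (X : I -> {RV P >-> T}) i B :
  iid mu J X -> J i -> measurable B -> P (X i @^-1` B) = mu B.
Proof. by move=> [law _] Ji mB; exact: law. Qed.

(** * Lifting families to a product space *)

Section ProductSpace.
Context d1 d2 (O1 : measurableType d1) (O2 : measurableType d2) (R : realType).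
Variables (P1 : probability O1 R) (P2 : probability O2 R).

Definition prod_prob : probability (O1 * O2)%type R := (P1 \x P2)%E.

Local Notation P := prod_prob.

Lemma prod_probE A B : measurable A -> measurable B ->
  P (A `*` B) = (P1 A * P2 B)%E.
Proof. exact: product_measure1E. Qed.

Definition lift_fst d' (T : measurableType d') (X : {RV P1 >-> T}) : {RV P >-> T} :=
  to_mfun (measurableT_comp (measurable_funPT X) measurable_fst).

Definition lift_snd d' (T : measurableType d') (X : {RV P2 >-> T}) : {RV P >-> T} :=
  to_mfun (measurableT_comp (measurable_funPT X) measurable_snd).

Lemma prob_fst A : measurable A -> P (fst @^-1` A) = P1 A.
Proof.
move=> mA; have -> : fst @^-1` A = A `*` setT :> set (O1 * O2).
  by apply/seteqP; split => -[x y] //= [].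
by rewrite prod_probE// (probability_setT P2) mule1.
Qed.

Lemma prob_snd A : measurable A -> P (snd @^-1` A) = P2 A.
Proof.
move=> mA; have -> : snd @^-1` A = setT `*` A :> set (O1 * O2).
  by apply/seteqP; split => -[x y] //= [].
by rewrite prod_probE// (probability_setT P1) mul1e.
Qed.

Lemma prob_fst_snd A B : measurable A -> measurable B ->
  P (fst @^-1` A `&` snd @^-1` B) = (P1 A * P2 B)%E.
Proof.
by move=> mA mB; rewrite -prod_probE//.
Qed.

Lemma iid_lift_fst d' (T : measurableType d') (mu : probability T R) (I : choiceType)
    (J : set I) (X : I -> {RV P1 >-> T}) :
  iid mu J X -> iid mu J (fun i => lift_fst (X i)).
Proof.
move=> [law indep]; split => [i B Ji mB|F B FJ mB].
  by rewrite -(law i B Ji mB); apply: prob_fst; exact: measurable_funPTI.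
have -> : \bigcap_(i in [set` F]) lift_fst (X i) @^-1` B i =
  fst @^-1` (\bigcap_(i in [set` F]) X i @^-1` B i) by [].
rewrite prob_fst; last first.
  by apply: fin_bigcap_measurable => // i _; exact: measurable_funPTI.
rewrite indep//; apply: eq_bigr => i _.
by apply/esym; apply: prob_fst; exact: measurable_funPTI.
Qed.

Lemma iid_lift_snd d' (T : measurableType d') (mu : probability T R) (I : choiceType)
    (J : set I) (X : I -> {RV P2 >-> T}) :
  iid mu J X -> iid mu J (fun i => lift_snd (X i)).
Proof.
move=> [law indep]; split => [i B Ji mB|F B FJ mB].
  by rewrite -(law i B Ji mB); apply: prob_snd; exact: measurable_funPTI.
have -> : \bigcap_(i in [set` F]) lift_snd (X i) @^-1` B i =
  snd @^-1` (\bigcap_(i in [set` F]) X i @^-1` B i) by [].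
rewrite prob_snd; last first.
  by apply: fin_bigcap_measurable => // i _; exact: measurable_funPTI.
rewrite indep//; apply: eq_bigr => i _.
by apply/esym; apply: prob_snd; exact: measurable_funPTI.
Qed.

Definition fst_events := [set fst @^-1` A | A in (@measurable _ O1)] : set (set (O1 * O2)).
Definition snd_events := [set snd @^-1` A | A in (@measurable _ O2)] : set (set (O1 * O2)).

Lemma sigma_algebra_fst_events : sigma_algebra setT fst_events.
Proof.
have := @sigma_algebra_preimage (O1 * O2)%type O1 measurable setT fst
  (@sigma_algebra_measurable _ O1).
congr (sigma_algebra _ _); apply/seteqP; split => _ [A mA <-]; exists A => //.
  by rewrite setTI.
by rewrite setTI.
Qed.

Lemma sigma_algebra_snd_events : sigma_algebra setT snd_events.
Proof.
have := @sigma_algebra_preimage (O1 * O2)%type O2 measurable setT snd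
  (@sigma_algebra_measurable _ O2).
congr (sigma_algebra _ _); apply/seteqP; split => _ [A mA <-]; exists A => //.
  by rewrite setTI.
by rewrite setTI.
Qed.

Lemma sub_fst_events d' (T : measurableType d') (I : choiceType) (J : set I)
    (X : I -> {RV P1 >-> T}) : sigma_rvs J (fun i => lift_fst (X i)) `<=` fst_events.
Proof.
apply: smallest_sub; first exact: sigma_algebra_fst_events.
by move=> _ [i Ji [B mB <-]]; exists (X i @^-1` B) => //; exact: measurable_funPTI.
Qed.

Lemma sub_snd_events d' (T : measurableType d') (I : choiceType) (J : set I)
    (X : I -> {RV P2 >-> T}) : sigma_rvs J (fun i => lift_snd (X i)) `<=` snd_events.
Proof.
apply: smallest_sub; first exact: sigma_algebra_snd_events.
by move=> _ [i Ji [B mB <-]]; exists (X i @^-1` B) => //; exact: measurable_funPTI.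
Qed.

Lemma independent_fst_snd : independent_systems P fst_events snd_events.
Proof.
move=> _ _ [A mA <-] [B mB <-].
by rewrite prob_fst_snd// prob_fst// prob_snd.
Qed.

End ProductSpace.

(** * Branching processes *)

(** A deterministic finite set of labels, born or not. It contains generation [k] as long as
    offspring numbers stay below [M], which makes union bounds over a random generation possible. *)
Fixpoint label_box (M : nat -> nat) (k : nat) : seq (seq nat) :=
  if k is k'.+1 then [seq i :: u | u <- label_box M k', i <- iota 0 (M k')]
  else [:: [::]].

Lemma label_boxS M k i u :
  (i :: u \in label_box M k.+1) = (u \in label_box M k) && (i < M k)%N.
Proof.
apply/allpairsP/andP => [[[v j] /= [vk jM [-> ->]]]|[uk iM]].
  by rewrite vk; move: jM; rewrite mem_iota.
by exists (u, i); rewrite /= mem_iota.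
Qed.

Lemma label_box_size M k : size (label_box M k) = (\prod_(j < k) M j)%N.
Proof.
elim: k => [|k IHk]; first by rewrite big_ord0.
by rewrite /= size_allpairs size_iota IHk big_ord_recr.
Qed.

Section BranchingProcess.
Context (R : realType) d (Omega : measurableType d) (P : probability Omega R).
Variables (D : seq nat -> {RV P >-> nat}) (L : seq nat -> {RV P >-> R}).

Lemma measurable_is_born u : measurable [set w | is_born D w u].
Proof.
elim: u => [|i u IHu] /=.
  by rewrite (_ : [set _ | _] = setT)//; apply/seteqP; split.
rewrite (_ : [set _ | _] = [set w | is_born D w u] `&` D u @^-1` [set k | (i < k)%N]).
  by apply: measurableI => //; exact: measurable_funPTI.
by apply/seteqP; split => w /=; [move=> /andP[]|move=> [-> ->]].
Qed.

Lemma measurable_birth_time u : measurable_fun setT (fun w => birth_time L w u).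
Proof.
by elim: u => [|i u IHu] //=; apply: measurable_funD => //; exact: measurable_funPT.
Qed.

(** Infinitude in terms of countable quantifiers; this is what makes [infinite_progeny] an event. *)
Lemma infinite_labelsP (S : set (seq nat)) :
  infinite_set S <-> forall n, exists2 u, S u & (n <= choice.pickle u)%N.
Proof.
split.
  move=> Sinf n; apply: contrapT => H; apply: Sinf.
  apply: (@sub_finite_set _ _ (\bigcup_(j in `I_n)
     [set u | choice.unpickle j = Some u])).
    move=> u Su; exists (choice.pickle u); last by rewrite /= choice.pickleK.
    by rewrite /= ltnNge; apply/negP => nu; apply: H; exists u.
  apply: bigcup_finite; first exact: finite_II.
  move=> j _; case: choice.unpickle => [u|].
    by apply: (sub_finite_set (B := [set u])) => // v /= [->].
  by apply: (sub_finite_set (B := set0)) => // v.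
move=> H /finite_seqP[s Ss].
have [u] := H (\max_(u <- s) choice.pickle u).+1.
by rewrite Ss /= => us; rewrite ltnNge; apply/negP/negPn; apply: leq_bigmax_seq.
Qed.

Lemma measurable_infinite_progeny : measurable (infinite_progeny D L).
Proof.
have -> : infinite_progeny D L = \bigcup_t \bigcap_n \bigcup_(j in [set j | (n <= j)%N])
    (if choice.pickle_inv j is Some u then
       [set w | is_born D w u] `&` [set w | birth_time L w u <= t%:R] else set0).
  apply/seteqP; split => w.
    move=> [t /infinite_labelsP Hw].
    exists (Num.truncn t).+1 => // n _; have [u [bu tu] nu] := Hw n.
    exists (choice.pickle u) => //; rewrite choice.pickleK_inv; split => //=.
    by apply: le_trans tu _; exact: ltW (truncnS_gt t).
  move=> [t _ Hw]; exists t%:R; apply/infinite_labelsP => n.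
  have [j nj] := Hw n I; have := @choice.pickle_invK (seq nat) j.
  by case: choice.pickle_inv => [u|//] /= uj [bu tu]; exists u => //; rewrite uj.
apply: bigcup_measurable => t _; apply: bigcapT_measurable => n.
apply: bigcup_measurable => j _; case: choice.pickle_inv => [u|//].
apply: measurableI; first exact: measurable_is_born.
have := measurable_preimage (measurable_birth_time u) (measurable_itv `]-oo, t%:R]).
by congr measurable; apply/seteqP; split => w /=; rewrite in_itv.
Qed.

Lemma explosive_chain (M : nat -> nat) (eps : nat -> R) (S : R) w :
  (forall n, \sum_(k < n) eps k <= S) ->
  (M 0 <= D [::] w)%N ->
  (forall k u, u \in label_box M k -> (M k <= D u w)%N ->
     exists2 i, (i < M k)%N & (M k.+1 <= D (i :: u) w)%N && (L (i :: u) w <= eps k)) ->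
  infinite_progeny D L w.
Proof.
(* The life length of the ancestor is not controlled by [eps] and is added separately. Nothing makes
   this bound nonnegative, so the chain claims it for birth times only from generation 1 on. *)
move=> epsS D0 Hstep; exists (L [::] w + S).
move=> H; have {H}[s Ss] := (finite_seqP _).1 H.
have chain k : exists u, [/\ size u = k, u \in label_box M k, (M k <= D u w)%N,
    is_born D w u /\ ((0 < k)%N -> birth_time L w u <= L [::] w + S) &
    birth_time L w u + L u w <= L [::] w + \sum_(j < k) eps j].
  elim: k => [|k [u [su ubox Du [bu _] tu]]].
    by exists [::]; split => //; rewrite big_ord0 addr0 add0r.
  have [i iM /andP[Dv Lv]] := Hstep k u ubox Du.
  exists (i :: u); split => //=; first by rewrite su.
  - by rewrite label_boxS ubox.
  - split=> [|_]; first by rewrite bu; exact: leq_trans Du.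
    by apply: le_trans tu _; rewrite lerD2l.
  - by rewrite big_ord_recr/= addrA; exact: lerD.
(* A chain member in a generation beyond all those that occur in the supposedly finite progeny. *)
have [u [su _ _ [bu tu] _]] := chain (\max_(u <- s) size u).+1.
have us : u \in s.
  by have : [set` s] u by rewrite -Ss; split => //; exact: tu.
have := @leq_bigmax_seq _ s xpredT size u us isT.
by rewrite -ltnS -su ltnn.
Qed.

Lemma nonexplosive_labels (M : nat -> nat) (delta : nat -> R) w :
  (forall k, 0 < delta k) -> (forall S, exists n, S < \sum_(k < n) delta k) ->
  (forall k u, u \in label_box M k -> (D u w <= M k)%N /\ delta k < L u w) ->
  ~ infinite_progeny D L w.
Proof.
move=> d0 unb Hbox [t]; apply.
have born u : is_born D w u ->
    u \in label_box M (size u) /\ \sum_(k < size u) delta k <= birth_time L w u.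
  elim: u => [|i u IHu] /=; first by rewrite big_ord0.
  move=> /andP[/IHu[ubox tu] iD]; have [DM dL] := Hbox _ _ ubox.
  rewrite -/(label_box M (size u).+1) label_boxS ubox (leq_trans iD DM); split => //.
  by rewrite big_ord_recr/= lerD// ltW.
have [n Hn] := unb t.
apply: (@sub_finite_set _ _ [set` flatten [seq label_box M k | k <- iota 0 n]]).
  move=> u /= [/born[ubox tu] bt]; apply/flatten_mapP; exists (size u) => //.
  rewrite mem_iota add0n /= ltnNge; apply/negP => nu.
  have : t < t; last by rewrite ltxx.
  apply: lt_le_trans Hn (le_trans _ bt); apply: le_trans tu.
  by apply: ler_sum_prefix => // k; exact: ltW.
exact: finite_seq.
Qed.

End BranchingProcess.

Lemma le0_of_geometric (R : realType) (p K q : R) : 0 < q < 1 ->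
  (forall m, p <= K * q ^+ m) -> p <= 0.
Proof.
move=> /andP[q0 q1] H; rewrite leNgt; apply/negP => p0.
have K0 : 0 < K by have := H 0%N; rewrite expr0 mulr1; exact: lt_le_trans.
have qV1 : 1 < q^-1 by rewrite invf_gt1.
have [m Hm] := exprn_unbounded (K / p + 1) qV1.
have qm : 0 < q ^+ m by exact: exprn_gt0.
have := H m; rewrite leNgt => /negP; apply.
rewrite exprVn in Hm; have Hm' : K / p < (q ^+ m)^-1 by apply: lt_le_trans Hm; rewrite ltrDl.
by move: Hm'; rewrite ltr_pdivrMr// mulrC -ltr_pdivlMr ?invr_gt0// invrK.
Qed.

(** Offspring bounds [2 ^ (c ^ (j + m))] give boxes of size 2 to this sum. A large [c] makes the
    exponent a small fraction of the current one, so the tail at the current bound beats the size of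
    the box. *)
Lemma geometric_exponents (c k m : nat) : (2 <= c)%N ->
  ((\sum_(j < k) c ^ (j + m)) * c.-1 <= c ^ (k + m))%N.
Proof.
move=> c2; elim: k => [|k IHk]; first by rewrite big_ord0.
rewrite big_ord_recr/= mulnDl addSn expnS.
have -> : c = c.-1.+1 by lia.
rewrite [X in (_ <= X)%N]mulSn; apply: leq_add; first by rewrite prednK//; lia.
by rewrite prednK; [rewrite mulnC|lia].
Qed.

Section NonExplosion.
Context (R : realType) (mu : probability R R) (muD : probability nat R).
Context d (Omega : measurableType d) (P : probability Omega R).
Variables (D : seq nat -> {RV P >-> nat}) (L : seq nat -> {RV P >-> R}).
Hypotheses (iidD : iid muD setT D) (iidL : iid mu setT L).
Variables (K s : R) (c : nat) (delta : nat -> R).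
Hypotheses (K0 : 0 < K) (s0 : 0 < s) (c2 : (2 <= c)%N) (cs : 2 <= s * c.-1%:R).
Hypothesis tailD : forall t, 1 <= t -> (muD [set k | (t < k%:R)%R] <= (K / t `^ s)%:E)%E.
Hypotheses (delta0 : forall k, 0 < delta k)
  (delta_unb : forall S, exists n, S < \sum_(k < n) delta k)
  (deltaF : forall k, cumul mu (delta k) <= expR (- c%:R ^+ k)).

(** The slower of two decay rates: the first comes from offspring numbers, the second from life
    lengths. *)
Let q : R := Num.max (2 `^ (- (s / 2))) 2^-1.

Let q01 : 0 < q < 1.
Proof.
rewrite /q lt_max gt_max; have -> : 0 < 2^-1 :> R by lra.
rewrite orbT /= andbC; have -> : 2^-1 < 1 :> R by lra.
rewrite /= powRN invf_lt1 ?powR_gt0// -[ltLHS](powRr0 2) /powR pnatr_eq0/= ltr_expR.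
by rewrite mul0r mulr_gt0 ?divr_gt0// ln_gt0// ltr1n.
Qed.

(** Since [s * c.-1 >= 2], the exponent [e] is at most [s / 2 * a]: the box uses up half of the
    decay [2 ^ (- s * a)]. *)
Let size_bound (e a : nat) : (e * c.-1 <= a)%N ->
  (2 ^ e)%:R * (K / ((2 ^ a)%:R `^ s)) <= K * q ^+ a.
Proof.
move=> ea; rewrite mulrCA ler_pM2l//.
have p20 : 0 < 2 :> R by lra.
rewrite !natrX -(@powR_mulrn R 2 a (ltW p20)) -powRrM -(@powR_mulrn R 2 e (ltW p20)).
rewrite -powRN -powRD; last by rewrite pnatr_eq0/= implybT.
apply: (@le_trans _ _ ((2 `^ (- (s / 2))) ^+ a)); last first.
  by apply: lerXn2r; rewrite ?nnegrE ?powR_ge0 ?le_max ?lexx// powR_ge0.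
rewrite -powR_mulrn ?powR_ge0// -powRrM; apply: ler_powR; first by lra.
have : (e%:R * c.-1%:R : R) <= a%:R by rewrite -natrM ler_nat.
have e0 : 0 <= e%:R :> R by [].
have : 0 <= e%:R * (s * c.-1%:R - 2) :> R by rewrite mulr_ge0// subr_ge0.
move: (e%:R : R) (a%:R : R) (c.-1%:R : R) e0 => e' a' c' e0 h1 h2.
have := ler_wpM2l (ltW s0) h2; lra.
Qed.

(** [c >= 2] makes the exponent [c ^ k.+1] at least twice that of the box size. *)
Let length_bound (e k : nat) : (e <= c ^ k)%N ->
  (2 ^ e)%:R * expR (- c%:R ^+ k.+1) <= q ^+ (c ^ k).
Proof.
move=> ea; rewrite -natrX; have /andP[_ eb] := expRN_nat_bounds R (c ^ k.+1).
apply: (@le_trans _ _ (2 ^+ (c ^ k) * 2^-1 ^+ (2 * c ^ k))).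
  rewrite natrX; apply: ler_pM; rewrite ?expR_ge0 ?exprn_ge0//.
    by rewrite ler_eXn2l//; lra.
  apply: le_trans eb _; apply: ler_wiXn2l; try lra.
  by rewrite expnS leq_mul2r c2 orbT.
rewrite mul2n -addnn exprD mulrA -exprMn divff// expr1n mul1r.
by apply: lerXn2r; rewrite ?nnegrE ?le_max ?lexx ?orbT//; lra.
Qed.

Lemma prob_infinite_progeny0 : P (infinite_progeny D L) = 0%E.
Proof.
have mI := measurable_infinite_progeny D L.
apply/eqP; rewrite eq_le measure_ge0 andbT -[leLHS]fineK ?fin_num_measure// lee_fin.
have [q0 q1] := andP q01.
apply: (@le0_of_geometric _ _ ((K + 1) / (1 - q)) q q01) => m.
rewrite -lee_fin fineK ?fin_num_measure//.
pose M k := (2 ^ (c ^ (k + m)))%N.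
(* The index of [delta] runs one ahead of that of [M], so that [length_bound] applies. *)
pose A k u := D u @^-1` [set j | (M k < j)%N] `|` L u @^-1` `]-oo, delta (k + m).+1].
have mA k u : measurable (A k u).
  by apply: measurableU; exact: measurable_funPTI.
pose Bad k := \bigcup_(u in [set` label_box M k]) A k u.
have mBad k : measurable (Bad k) by apply: fin_bigcup_measurable.
apply: (@le_trans _ _ (P (\bigcup_k Bad k))).
  apply: le_measure; rewrite ?inE//; first exact: bigcup_measurable.
  move=> w Iw; apply: contrapT => nBad.
  apply: (@nonexplosive_labels _ _ _ _ D L M (fun k => delta (k + m.+1)%N) w _ _ _ Iw) => //.
    exact: unbounded_shift.
  move=> k u uk; have nA : ~ A k u w by move=> Aw; apply: nBad; exists k => //; exists u.
  split; first by rewrite leqNgt; apply/negP => h; apply: nA; left.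
  by rewrite ltNge; apply/negP => h; apply: nA; right; rewrite /= in_itv/= -addnS.
rewrite mulrAC; apply: union_bound_geometric => //.
- by rewrite mulr_ge0 ?addr_ge0 ?exprn_ge0// ltW.
- by rewrite (ltW q0).
move=> k.
pose e := (\sum_(j < k) c ^ (j + m))%N.
have ec : (e * c.-1 <= c ^ (k + m))%N by exact: geometric_exponents.
have ea : (e <= c ^ (k + m))%N.
  by apply: leq_trans ec; rewrite leq_pmulr//; lia.
have szE : size (label_box M k) = (2 ^ e)%N by rewrite label_box_size expn_sum.
pose b := K / ((2 ^ (c ^ (k + m)))%:R `^ s) + expR (- c%:R ^+ (k + m).+1).
apply: (@le_trans _ _ ((size (label_box M k))%:R * b)%:E).
  apply: union_bound_seq => // u _.
  apply: le_trans (measureU2 _ _ _) _; try exact: measurable_funPTI.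
  rewrite EFinD; apply: leeD.
    rewrite [leLHS](iid_prob (i := u) iidD)//; apply: le_trans (tailD _); last first.
      by rewrite ler1n expn_gt0.
    by apply: le_measure; rewrite ?inE// => j /=; rewrite ltr_nat.
  by rewrite [leLHS](iid_prob (i := u) iidL)// cumulE lee_fin.
rewrite lee_fin szE mulrDr.
apply: (@le_trans _ _ ((K + 1) * q ^+ (c ^ (k + m)))).
  by rewrite mulrDl mul1r; apply: lerD; [exact: size_bound|exact: length_bound].
(* [c ^ (k + m) >= k + m] weakens the doubly exponential bound to a geometric one, of size [q ^ m]
   in total. *)
rewrite -mulrA -exprD ler_pM2l ?addr_gt0//; apply: ler_wiXn2l; rewrite ?ltW//.
by rewrite addnC; apply: ltnW; exact: ltn_expl.
Qed.

End NonExplosion.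

Lemma independent_systemsS d (Omega : measurableType d) (R : realType)
    (P : probability Omega R) (G H G' H' : set (set Omega)) :
  G' `<=` G -> H' `<=` H -> independent_systems P G H -> independent_systems P G' H'.
Proof. by move=> GG HH indep A B /GG GA /HH HB; exact: indep. Qed.

(** * A realization of the branching process, and the criterion from explosion *)

Section BPRealization.
Context (R : realType) (mu : probability R R) (muD : probability nat R).

Definition BP_prob : probability (bit_space * bit_space)%type R :=
  prod_prob (coin R) (coin R).

Definition BP_D (u : seq nat) : {RV BP_prob >-> nat} :=
  lift_fst (coin R) (iid_copy R (nat_bits muD) u).

Definition BP_L (u : seq nat) : {RV BP_prob >-> R} :=
  lift_snd (coin R) (iid_copy R (quantile_bits mu) u).

Lemma is_BP_realization : is_BP BP_D BP_L muD mu.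
Proof.
split.
- by apply: iid_lift_fst; apply: iid_iid_copy => B; exact: distribution_nat_bits.
- by apply: iid_lift_snd; apply: iid_iid_copy => B; exact: distribution_quantile_bits.
- apply: independent_systemsS (@independent_fst_snd _ _ _ _ R (coin R) (coin R)).
    exact: sub_fst_events.
  exact: sub_snd_events.
Qed.

End BPRealization.

Lemma natr_tail_power_law (R : realType) (muD : probability nat R) (rho : R) :
  power_law_tail (fun x : R => muD [set k | x < k%:R]) rho ->
  forall s, 0 < s < rho -> exists2 K, 0 < K &
    forall t, 1 <= t -> (muD [set k | (t < k%:R)%R] <= (K / t `^ s)%:E)%E.
Proof.
move=> pl s /andP[s0 srho].
pose g (x : R) := fine (muD [set k | x < k%:R]).
have gE x : muD [set k | x < k%:R] = (g x)%:E by rewrite fineK// fin_num_measure.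
have [||||K K0 HK] := @power_law_upper R _ g rho _ _ pl s _ _ s0 srho.
- by move=> x _; exact: gE.
- move=> x y xy; rewrite -lee_fin -!gE; apply: le_measure; rewrite ?inE//.
  by move=> k /=; exact: le_lt_trans.
- by move=> x; rewrite -lee_fin -gE; exact: probability_le1.
- by move=> x; rewrite -lee_fin -gE.
by exists K => // t t1; rewrite gE lee_fin; exact: HK.
Qed.

Lemma W_BP_criterion (R : realType) (mu : probability R R) :
  W_BP R mu -> exists2 C, 1 < C & explosion_criterion mu C.
Proof.
move=> [_ [rho [muD [/andP[rho0 _] pl Hall]]]].
have s0 : 0 < rho / 2 by rewrite divr_gt0.
have s01 : 0 < rho / 2 < rho by rewrite s0; lra.
have [K K0 HK] := natr_tail_power_law pl s01.
(* Large enough for [2 <= rho / 2 * c.-1]. *)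
pose c := (Num.truncn (2 / (rho / 2))).+3.
have c1 : (1 : R) < c%:R by rewrite ltr1n.
exists c%:R => //; apply: contrapT => /(not_explosion_criterion c1)[delta [d0 dF dS]].
have := Hall _ _ _ _ _ (is_BP_realization mu muD).
rewrite /explosive_BP (@prob_infinite_progeny0 R mu muD _ _ _ _ _ _ _ K (rho / 2) c delta)//.
- by rewrite ltxx.
- by case: (is_BP_realization mu muD).
- by case: (is_BP_realization mu muD).
- rewrite -ler_pdivrMl// mulrC /c /=; apply/ltW; apply: lt_trans (truncnS_gt _) _.
  by rewrite ltr_nat.
Qed.

Lemma one_minus_exprn (R : realType) (q y : R) (M : nat) : q <= 1 -> y <= q * M%:R ->
  (1 - q) ^+ M <= expR (- y).
Proof.
move=> q1 yq; apply: (@le_trans _ _ (expR (- q) ^+ M)).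
  by apply: lerXn2r; rewrite ?nnegrE ?expR_ge0 ?subr_ge0//; exact: expR_ge1Dx.
by rewrite -expRM_natl ler_expR mulrN lerN2 mulrC.
Qed.

(** * A concrete heavy-tailed offspring law *)

Section HeavyOffspring.
Context (R : realType).

(* The tail is [P (D >= j) = j ^ (-1/4)]; any tail exponent below 1 would do. *)
Definition heavy_offspring (u : R) : nat := Num.truncn (u `^ (- 4)).

Lemma measurable_heavy_offspring : measurable_fun setT heavy_offspring.
Proof.
apply: measurableT_comp; first exact: measurable_truncn.
exact: measurable_powR.
Qed.

Definition heavy_law : probability nat R :=
  distribution (unif R) (to_mfun measurable_heavy_offspring).

Lemma heavy_lawE (j : nat) : (0 < j)%N ->
  heavy_law [set k | (j <= k)%N] = (j%:R `^ (- 4^-1))%:E.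
Proof.
move=> j0; set r : R := _ `^ _.
have jR : 0 < j%:R :> R by rewrite ltr0n.
have r0 : 0 < r by exact: powR_gt0.
have r4 : r ^+ 4 = j%:R^-1.
  rewrite -powR_mulrn ?ltW// -powRrM (_ : - 4^-1 * 4%:R = -1); last by lra.
  by rewrite powR_inv1// ltW.
have r1 : r <= 1.
  by rewrite -[leRHS](powRr0 j%:R); apply: ler_powR; [rewrite ler1n|lra].
have mS : measurable (heavy_offspring @^-1` [set k | (j <= k)%N]).
  exact: (measurable_preimage measurable_heavy_offspring).
rewrite [LHS](_ : _ = unif R (heavy_offspring @^-1` [set k | (j <= k)%N]))// unifE//.
have -> : heavy_offspring @^-1` [set k | (j <= k)%N] `&` `[0, 1]%classic = `]0, r]%classic.
  apply/seteqP; split => u /=; rewrite !in_itv/= /heavy_offspring truncn_ge_nat ?powR_ge0//.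
    move=> [ju /andP[u0 u1]]; have {}u0 : 0 < u.
      rewrite lt_neqAle u0 andbT; apply/eqP => u_; move: ju; rewrite -u_ powR0; last by lra.
      by rewrite leNgt jR.
    rewrite u0 /=; suff : u ^+ 4 <= r ^+ 4 by rewrite ler_pXn2r// nnegrE ltW.
    rewrite r4.
    move: ju; rewrite powRN (@powR_mulrn R u 4 (ltW u0)) => ju.
    by rewrite -[leLHS]invrK lef_pV2 ?posrE ?invr_gt0 ?exprn_gt0.
  move=> /andP[u0 ur]; split; last by rewrite ltW//= (le_trans ur).
  rewrite powRN (@powR_mulrn R u 4 (ltW u0)) -[leLHS]invrK lef_pV2 ?posrE ?invr_gt0 ?exprn_gt0//.
  by rewrite -r4; apply: lerXn2r; rewrite ?nnegrE//; exact: ltW.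
by rewrite [LHS](@lebesgue_measure_itv R `]0, r])/= lte_fin r0 oppr0 adde0.
Qed.

Let N (x : R) : R := (Num.truncn x).+1%:R.
(** The offspring number is an integer, so its tail at [x] is [N x ^ (- 1/4)]; [l] is the correction
    with respect to [x ^ (- 1/4)] and tends to 1. *)
Let l (x : R) : R := (x / N x) `^ 4^-1.

Let N_gt0 x : 0 < N x. Proof. by rewrite ltr0n. Qed.

Let l_bounds x : 0 < x -> x / (x + 1) <= l x <= 1.
Proof.
move=> x0; have N0 := N_gt0 x.
have xN : x <= N x by exact: ltW (truncnS_gt x).
have Nx : N x <= x + 1.
  by rewrite /N -natr1 lerD2r; have /andP[] := truncn_itv (ltW x0).
have h : 0 < x / N x <= 1 by rewrite divr_gt0// ler_pdivrMr// mul1r.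
apply/andP; split; last first.
  rewrite -[leRHS](powRr0 (x / N x)); apply: ger_powR => //; lra.
apply: (@le_trans _ _ (x / N x)); last by apply: ger1_powR => //; lra.
by rewrite ler_pM2l// lef_pV2 ?posrE//; lra.
Qed.

Let l_cvg1 : l x @[x --> +oo] --> (1 : R).
Proof.
apply/cvgrPdist_le => e e0; near=> x.
have x0 : 0 < x by near: x; apply: nbhs_pinfty_gt; exact: num_real.
have ex : 1 <= e * x.
  by rewrite mulrC -ler_pdivrMr//; near: x; apply: nbhs_pinfty_ge; exact: num_real.
have /andP[l1 l2] := l_bounds x0.
rewrite ger0_norm ?subr_ge0//; apply: (@le_trans _ _ (1 - x / (x + 1))); first by lra.
by rewrite lerBlDr -lerBlDl ler_pdivlMr; lra.
Unshelve. all: by end_near. Qed.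

Lemma heavy_law_power_law : power_law_tail (fun x : R => heavy_law [set k | x < k%:R]) 4^-1.
Proof.
exists l; last first.
  move=> x x0; have N0 := N_gt0 x.
  have -> : [set k | x < k%:R] = [set k | ((Num.truncn x).+1 <= k)%N].
    by apply/seteqP; split => k /=; rewrite truncn_lt_nat// ltW.
  rewrite heavy_lawE//; congr EFin; rewrite /l powRM ?invr_ge0 ?ltW//.
  rewrite -/(N x) mulrAC divff ?mul1r; last by rewrite gt_eqF// powR_gt0.
  by rewrite -(powR_inv1 (ltW N0)) -powRrM mulN1r.
split.
  exists 1 => //; split.
    apply: measurable_funTS.
    suff : measurable_fun setT ((@powR R ^~ 4^-1) \o (fun x => x / N x)) by [].
    apply: measurableT_comp; first exact: measurable_powR.
    apply: measurable_funM => //.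
    apply: (measurable_comp (F := setT) (f := fun k : nat => k.+1%:R^-1 : R)) => //.
    exact: measurable_truncn.
  by move=> x x1; have := l_bounds (lt_le_trans ltr01 x1); case/andP => + _; apply: lt_le_trans; rewrite divr_gt0//; lra.
move=> c c0; have cy : c * x @[x --> +oo] --> +oo.
  apply/cvgryPge => A; near=> x; rewrite -ler_pdivrMl//.
have lc : l (c * x) @[x --> +oo] --> (1 : R) by exact: (cvg_comp _ _ cy l_cvg1).
rewrite -[X in _ --> X]divr1; apply: cvgM => //.
by apply: cvgV => //; exact: oner_neq0.
Unshelve. all: by end_near. Qed.

End HeavyOffspring.

Section Explosion.
Context (R : realType) (mu : probability R R).
Context d (Omega : measurableType d) (P : probability Omega R).
Variables (D : seq nat -> {RV P >-> nat}) (L : seq nat -> {RV P >-> R}).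
Hypothesis BP : is_BP D L (heavy_law R) mu.
Variables (eps : nat -> R) (S : R).
Hypotheses (eps0 : forall k, 0 <= eps k)
  (epsF : forall k, expR (- 2 ^+ k) <= cumul mu (eps k))
  (epsS : forall n, \sum_(k < n) eps k <= S).

(** An individual has [M k] children with probability [2 ^ (- 2 * b k)]. A child with [M k.+1]
    children that lives at most [eps (k + 2)] has probability at least
    [2 ^ (- 4 * b k) * 2 ^ (- 2 * b k)], so among [M k] children [4 ^ b k] such are expected. None
    occurs with probability at most [2 ^ (- 4 ^ b k)], which beats the box of at most
    [2 ^ (8 * b k)] labels. The shift by 2 makes the sum of all failures smaller than the
    probability that the ancestor is good. *)
Let b k : nat := (2 ^ (k + 2))%N.
Let M k : nat := (2 ^ (8 * b k))%N.

Let heavy_law_M k : heavy_law R [set j | (M k <= j)%N] = (2^-1 ^+ (2 * b k))%:E.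
Proof.
rewrite heavy_lawE ?expn_gt0//; congr EFin.
have p20 : 0 <= 2 :> R by lra.
rewrite /M natrX -(@powR_mulrn R 2 _ p20) -powRrM -(@powR_inv1 R 2 p20).
rewrite -(@powR_mulrn R _ _ (powR_ge0 _ _)) -powRrM; congr (2 `^ _).
by rewrite !natrM; lra.
Qed.

Let good k u i : set Omega :=
  D (i :: u) @^-1` [set j | (M k.+1 <= j)%N] `&` L (i :: u) @^-1` `]-oo, eps (k + 2)%N].

Let measurable_good k u i : measurable (good k u i).
Proof. by apply: measurableI; exact: measurable_funPTI. Qed.

Let Bad k := \bigcup_(u in [set` label_box M k])
  \bigcap_(i in [set` iota 0 (M k)]) ~` good k u i.

Let mNone k u : measurable (\bigcap_(i in [set` iota 0 (M k)]) ~` good k u i).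
Proof. by apply: fin_bigcap_measurable => // i _; exact: measurableC. Qed.

Let prob_no_good k u : (P (\bigcap_(i in [set` iota 0 (M k)]) ~` good k u i) <=
  (2^-1 ^+ (4 ^ b k))%:E)%E.
Proof.
have [iidD iidL indep] := BP.
pose q := fine (heavy_law R [set j | (M k.+1 <= j)%N]) * fine (mu `]-oo, eps (k + 2)%N]%classic).
have rule : product_rule P (iota 0 (M k)) (good k u) q.
  by apply: (iid_pair_product_rule (f := fun i => i :: u) (g := fun i => i :: u) iidD iidL indep)
    => // i j _ _ [].
have qE : q = 2^-1 ^+ (4 * b k) * cumul mu (eps (k + 2)%N).
  rewrite /q heavy_law_M/=; congr (2^-1 ^+ _ * _).
  by rewrite /b addSn expnS; lia.
have bb : 2 ^+ (k + 2) = (b k)%:R :> R by rewrite natrX.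
have qlow : 2^-1 ^+ (6 * b k) <= q.
  rewrite qE (_ : 6 * b k = 4 * b k + 2 * b k)%N; last by lia.
  rewrite exprD ler_pM2l ?exprn_gt0//.
  apply: le_trans (epsF _); rewrite bb.
  by have /andP[] := expRN_nat_bounds R (b k).
have q1 : q <= 1.
  rewrite qE; apply: mulr_ile1; rewrite ?cumul_ge0 ?cumul_le1 ?exprn_ge0 ?exprn_ile1//; lra.
rewrite (prob_none (iota_uniq _ _) _ rule)// size_iota lee_fin.
apply: (@le_trans _ _ (expR (- (4 ^ b k)%:R))).
  apply: one_minus_exprn => //.
  apply: (@le_trans _ _ (2^-1 ^+ (6 * b k) * (M k)%:R)); last by rewrite ler_pM2r// ltr0n expn_gt0.
  rewrite /M (_ : 8 * b k = 6 * b k + 2 * b k)%N; last by lia.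
  rewrite [X in _ * X]natrX exprD mulrA -exprMn mulVf// expr1n mul1r.
  by rewrite natrX exprM; have -> : 2 ^+ 2 = 4 :> R by lra.
by have /andP[] := expRN_nat_bounds R (4 ^ b k).
Qed.

Let prob_Bad k : (P (Bad k) <= (2^-1 ^+ 16 * 2^-1 ^+ k)%:E)%E.
Proof.
have h2 : 0 <= 2^-1 :> R by lra.
apply: (@le_trans _ _ ((size (label_box M k))%:R * 2^-1 ^+ (4 ^ b k))%:E).
  by apply: union_bound_seq => u _; [exact: mNone|exact: prob_no_good].
rewrite lee_fin label_box_size -expn_sum.
have e8 : (\sum_(j < k) 8 * b j <= 8 * b k)%N.
  rewrite -big_distrr/= leq_mul2l/=.
  by have := @geometric_exponents 2 k 2 isT; rewrite muln1.
have b4 : (4 <= b k)%N by rewrite /b addn2 -[X in (X <= _)%N]/(2 ^ 2)%N leq_exp2l.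
have b12 : (12 * b k <= 4 ^ b k)%N.
  move: (b k) b4; elim=> // n IHn; rewrite leq_eqVlt => /orP[/eqP <-//|].
  by rewrite ltnS => n4; have := IHn n4; rewrite expnS; lia.
have bk : (16 + k <= 4 * b k)%N.
  have : (k < 2 ^ k)%N by exact: ltn_expl.
  by rewrite /b expnD; lia.
apply: (@le_trans _ _ (2 ^+ (8 * b k) * 2^-1 ^+ (12 * b k))).
  rewrite natrX; apply: ler_pM; rewrite ?exprn_ge0//.
    by rewrite ler_eXn2l//; lra.
  by apply: ler_wiXn2l => //; lra.
rewrite (_ : 12 * b k = 8 * b k + 4 * b k)%N; last by lia.
rewrite exprD mulrA -exprMn divff// expr1n mul1r -exprD.
by apply: ler_wiXn2l => //; lra.
Qed.

(** The ancestor has [M 0] children with probability [2 ^ (- 8)], while some step of the chain fails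
    with probability at most [2 ^ (- 15)]. *)
Lemma heavy_BP_explosive : explosive_BP D L.
Proof.
have [iidD iidL indep] := BP.
have mI := measurable_infinite_progeny D L.
have mBad k : measurable (Bad k) by apply: fin_bigcup_measurable.
have mUBad : measurable (\bigcup_k Bad k) by exact: bigcup_measurable.
pose root := D [::] @^-1` [set j | (M 0 <= j)%N].
have mroot : measurable root by exact: measurable_funPTI.
rewrite /explosive_BP lt_neqAle measure_ge0 andbT; apply/eqP => PI0.
have : (P root <= P (infinite_progeny D L `|` \bigcup_k Bad k))%E.
  apply: le_measure; rewrite ?inE//; first exact: measurableU.
  move=> w Dw; have [|nBad] := pselect ((\bigcup_k Bad k) w); first by right.
  left; apply: (@explosive_chain _ _ _ _ D L M (fun k => eps (k + 2)%N) S) => //.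
    move=> n; apply: le_trans (epsS (2 + n)%N); rewrite big_split_ord/=.
    rewrite [X in _ <= _ + X](eq_bigr (fun k : 'I_n => eps (k + 2)%N)); last first.
      by move=> i _; rewrite addnC.
    by rewrite lerDr sumr_ge0.
  move=> k u uk Du; apply: contrapT => H; apply: nBad; exists k => //; exists u => //.
  move=> i /=; rewrite mem_iota add0n /= => iM [Di Li]; apply: H; exists i => //.
  by apply/andP; split => //; move: Li => /=; rewrite in_itv.
rewrite leNgt => /negP; apply.
have : (P (infinite_progeny D L `|` \bigcup_k Bad k) <=
    P (infinite_progeny D L) + P (\bigcup_k Bad k))%E by exact: measureU2.
rewrite -PI0 add0e => /le_lt_trans; apply.
apply: (@le_lt_trans _ _ (2^-1 ^+ 16 / (1 - 2^-1))%:E).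
  apply: union_bound_geometric => //; lra.
rewrite [ltRHS](iid_prob (i := [::]) iidD)// heavy_law_M lte_fin.
have -> : (2 * b 0 = 8)%N by [].
rewrite (exprD _ 8 8); have a0 : 0 < 2^-1 ^+ 8 :> R by rewrite exprn_gt0.
have a1 : 2^-1 ^+ 8 <= 2^-1 ^+ 2 :> R by apply: ler_wiXn2l => //; lra.
move: (2^-1 ^+ 8) a0 a1 => a a0; rewrite expr2 => a1.
have -> : 1 - 2^-1 = 2^-1 :> R by lra.
by rewrite invrK; nra.
Qed.

End Explosion.

Lemma criterion_W_BP (R : realType) (mu : probability R R) :
  mu `[0, +oo[%classic = 1%E -> explosion_criterion mu 2 -> W_BP R mu.
Proof.
move=> mu0 [eps [eps0 epsF [S epsS]]]; split => //.
exists 4^-1, (heavy_law R); split; first by lra.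
  exact: heavy_law_power_law.
by move=> d Omega P D L BP; exact: (heavy_BP_explosive BP eps0 epsF epsS).
Qed.

(** * Scale-free percolation: explosion *)

Section EdgeLaw.
Context (R : realType) (n : nat) d (Omega : measurableType d) (P : probability Omega R).
Variables (W : 'rV[int]_n -> {RV P >-> R}) (E : {fset 'rV[int]_n} -> {RV P >-> bool})
  (L : {fset 'rV[int]_n} -> {RV P >-> R}).
Variables (alpha lambda : R) (muW muL : probability R R).
Hypothesis lambda0 : 0 < lambda.
Hypothesis SFP : is_SFP W E L alpha lambda muW muL.

Let conn x y w := conn_prob alpha lambda x y (W x w) (W y w).

Lemma measurable_conn_prob x y : measurable_fun setT (conn x y).
Proof.
rewrite /conn /conn_prob; case: (eucl_dist R x y == 1) => //.
apply: measurable_funB => //; apply: measurableT_comp => //.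
apply: measurableT_comp => //; apply: measurable_funM => //.
by do 2![apply: measurable_funM => //]; exact: measurable_funPT.
Qed.

Lemma prob_edge x y A : x != y -> sigma_rvs setT W A ->
  P (A `&` E (edge x y) @^-1` [set true]) = (\int[P]_(w in A) (conn x y w)%:E)%E.
Proof.
move=> xy WA; have := SFP_edges SFP (s := [:: (x, y)]) (A := A).
rewrite /= andbT => /(_ xy isT WA).
under eq_integral do rewrite big_seq1.
rewrite (_ : \bigcap_(p in _) _ = E (edge x y) @^-1` [set true])//.
apply/seteqP; split => w /=.
  by move=> /(_ (x, y)); apply; rewrite /= inE.
by move=> Ew [x' y']; rewrite /= inE => /eqP[-> ->].
Qed.

Lemma prob_non_edge x y A (delta : R) : x != y -> sigma_rvs setT W A ->
  0 <= delta <= 1 -> (forall w, A w -> 1 - delta <= conn x y w) ->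
  (P (A `&` E (edge x y) @^-1` [set false]) <= delta%:E)%E.
Proof.
move=> xy WA /andP[d0 d1] HA; have mA := sigma_rvs_measurable WA.
have mE e : measurable (E (edge x y) @^-1` [set e]) by exact: measurable_funPTI.
have Esplit : P A = (P (A `&` E (edge x y) @^-1` [set true]) +
    P (A `&` E (edge x y) @^-1` [set false]))%E.
  rewrite -measureU; try exact: measurableI.
    congr (P _); rewrite -setIUr (_ : _ `|` _ = setT) ?setIT//.
    by apply/seteqP; split => // w _ /=; case: (E _ w); [left|right].
  by apply/seteqP; split => w //= -[[_ ->] []].
have low : ((1 - delta)%:E * P A <= P (A `&` E (edge x y) @^-1` [set true]))%E.
  rewrite prob_edge// -integral_cst//; apply: ge0_le_integral => //=.
  - by move=> w _; rewrite lee_fin subr_ge0.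
  - by apply/measurable_EFinP; apply: measurable_funTS; exact: measurable_conn_prob.
have fA := fin_num_measure P A mA.
have ft := fin_num_measure P _ (measurableI _ _ mA (mE true)).
have ff := fin_num_measure P _ (measurableI _ _ mA (mE false)).
move: Esplit low; rewrite -(fineK fA) -(fineK ft) -(fineK ff) -EFinD -EFinM !lee_fin => -[e].
have : fine (P A) <= 1 by rewrite -lee_fin fineK//; exact: probability_le1.
have : 0 <= fine (P A) by exact: fine_ge0.
by rewrite e; move: (fine _) (fine (P (A `&` _))) => u v h1 h2 h3; nra.
Qed.

Lemma eucl_distC (x y : 'rV[int]_n) : eucl_dist R x y = eucl_dist R y x.
Proof.
rewrite /eucl_dist; congr Num.sqrt; apply: eq_bigr => i _.
by rewrite -opprB mulrNz sqrrN.
Qed.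

Lemma eucl_dist_le (x y : 'rV[int]_n) (b : nat) :
  (forall i, (`|x 0%R i - y 0%R i| <= b)%N) -> eucl_dist R x y <= (n * b)%:R.
Proof.
move=> xy; rewrite /eucl_dist -[leRHS]ger0_norm// -sqrtr_sqr.
apply: ler_wsqrtr; apply: (@le_trans _ _ (\sum_(i < n) b%:R ^+ 2)).
  apply: ler_sum => i _; rewrite -[leLHS]real_normK ?num_real//.
  apply: lerXn2r; rewrite ?nnegrE//.
  by rewrite -intr_norm -abszE -pmulrn ler_nat; exact: xy.
rewrite sumr_const card_ord natrM exprMn -[leLHS]mulr_natl; apply: ler_wpM2r.
  by rewrite exprn_ge0.
by case: (n) => [|k]; rewrite ?expr0n// -natrX ler_nat expnS leq_pmulr.
Qed.

Lemma eucl_dist_ge (x y : 'rV[int]_n) i : (`|x 0%R i - y 0%R i|%N)%:R <= eucl_dist R x y.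
Proof.
rewrite /eucl_dist -[leLHS]ger0_norm// -sqrtr_sqr; apply: ler_wsqrtr.
rewrite (bigD1 i)//= -[leLHS]addr0; apply: lerD; last first.
  by apply: sumr_ge0 => j _; exact: sqr_ge0.
by rewrite -[leRHS]real_normK ?num_real// -intr_norm.
Qed.

Lemma eucl_dist_gt0 (x y : 'rV[int]_n) : x != y -> 0 < eucl_dist R x y.
Proof.
move=> xy; have [i xyi] : exists i, x 0 i != y 0 i.
  apply: contrapT => H; move/eqP: xy; apply; apply/rowP => i.
  by apply/eqP; apply: contrapT => /negP h; apply: H; exists i.
apply: lt_le_trans (eucl_dist_ge x y i).
by rewrite ltr0n absz_gt0 subr_eq0.
Qed.

Lemma edge_all_edges (x y : 'rV[int]_n) : x != y -> all_edges (edge x y).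
Proof. by move=> xy; rewrite /all_edges /= cardfs2 xy. Qed.

Lemma edge_inj (x y z : 'rV[int]_n) : x != y -> x != z -> edge x y = edge x z -> y = z.
Proof.
move=> xy xz /fsetP/(_ y); rewrite !inE eqxx orbT => /esym/orP[/eqP yx|/eqP//].
by move: xy; rewrite yx eqxx.
Qed.

End EdgeLaw.

(** * Almost sure statements *)

Section AlmostSure.
Context d (Omega : measurableType d) (R : realType) (P : probability Omega R).

Lemma ae_forall_countable (I : countType) (Q : I -> Omega -> Prop) :
  (forall i, {ae P, forall w, Q i w}) -> {ae P, forall w, forall i, Q i w}.
Proof.
move=> HQ.
pose Q' (j : nat) w := if @choice.unpickle I j is Some i then Q i w else True.
have : {ae P, forall w, forall j, Q' j w}.
  apply: ae_foralln => j; rewrite /Q'; case: choice.unpickle => [i|]; first exact: HQ.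
  exact: aeW.
by apply: filterS => w H i; have := H (choice.pickle i); rewrite /Q' choice.pickleK.
Qed.

Lemma ae_of_prob0 (A : set Omega) (Q : Omega -> Prop) : measurable A -> P A = 0%E ->
  (forall w, ~ A w -> Q w) -> {ae P, forall w, Q w}.
Proof.
move=> mA A0 HQ; exists A; split => // w /= nQ.
by apply: contrapT => /HQ.
Qed.

(** [Q] can fail only on the intersection of all [B m], which is null. *)
Lemma ae_of_geometric (B : nat -> set Omega) (K q : R) (Q : Omega -> Prop) :
  0 < q < 1 -> (forall m, measurable (B m)) ->
  (forall m, (P (B m) <= (K * q ^+ m)%:E)%E) ->
  (forall m w, ~ B m w -> Q w) -> {ae P, forall w, Q w}.
Proof.
move=> q01 mB PB HQ.
have mI : measurable (\bigcap_m B m) by apply: bigcapT_measurable.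
apply: (ae_of_prob0 mI).
  apply/eqP; rewrite eq_le measure_ge0 andbT -[leLHS]fineK ?fin_num_measure// lee_fin.
  apply: (@le0_of_geometric _ _ K q q01) => m.
  rewrite -lee_fin fineK ?fin_num_measure//; apply: le_trans (PB m).
  by apply: le_measure; rewrite ?inE// => w; apply.
move=> w nB; apply: contrapT => nQ; apply: nB => m _.
by apply: contrapT => /HQ.
Qed.

End AlmostSure.

Section Explosion.
Context (R : realType) (n : nat) d (Omega : measurableType d) (P : probability Omega R).
Variables (E : {fset 'rV[int]_n} -> {RV P >-> bool}) (L : {fset 'rV[int]_n} -> {RV P >-> R}).

Lemma path_length_cat w x (p q : seq 'rV[int]_n) :
  path_length L w x (p ++ q) = path_length L w x p + path_length L w (last x p) q.
Proof. by elim: p x => [|y p IHp] x /=; rewrite ?add0r// IHp addrA. Qed.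

Lemma limn_reach_time_lty w (t : R) :
  0 <= t -> infinite_set (ballL E L w t) -> (limn (reach_time E L w) < +oo)%E.
Proof.
move=> t0 /infiniteP Binf.
have rt k : (reach_time E L w k <= t%:E)%E.
  apply: ereal_inf_lbound; exists t => //; split => //.
  by apply: card_le_trans Binf; exact: subset_card_le.
apply: le_lt_trans (ltry t); apply: lime_le; last exact: nearW.
apply: ereal_nondecreasing_is_cvgn => i j ij.
apply: ereal_inf_le_tmp => _ [s [s0 js] <-]; exists s => //; split => //.
apply: card_le_trans js; apply: subset_card_le => k /= ki; exact: leq_trans ij.
Qed.

(** Induction on the l1 norm, moving one nonzero coordinate by one towards 0. It supplies the path
    from the origin to the first hub, whose length is finite though not controlled. *)
Lemma nearest_neighbour_path w (y : 'rV[int]_n) :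
  (forall x z, eucl_dist R x z = 1 -> E (edge x z) w) ->
  exists2 p, path (Defs.adjacent E w) 0 p & last 0 p = y.
Proof.
move=> NN; have [N] := ubnP (\sum_(i < n) `|y 0%R i|)%N.
elim: N y => // N IHN y; rewrite ltnS => yN.
have [->|y0] := eqVneq y 0; first by exists [::].
have [i yi] : exists i, y 0 i != 0.
  apply: contrapT => H; move/eqP: y0; apply; apply/rowP => i; rewrite mxE.
  by apply/eqP; apply: contrapT => /negP h; apply: H; exists i.
pose e : int := Num.sg (y 0 i).
pose z : 'rV[int]_n := \row_j (if j == i then y 0 i - e else y 0 j).
have zi : (`|y 0%R i| = `|z 0%R i| + 1)%N.
  by rewrite mxE eqxx /e; case: sgrP yi => //; lia.
have zy : eucl_dist R z y = 1.
  rewrite /eucl_dist (bigD1 i)//= big1 ?addr0; last first.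
    by move=> j /negbTE ji; rewrite mxE ji subrr expr0n.
  rewrite mxE eqxx addrAC subrr add0r mulrNz sqrrN /e.
  by case: sgrP yi => // _ _; rewrite ?mulrN1z ?sqrrN expr1n sqrtr1.
have [|p pz lz] := IHN z.
  apply: leq_trans yN; rewrite (bigD1 i)//= [X in (_ < X)%N](bigD1 i)//= zi.
  rewrite [X in (_ + X < _)%N](eq_bigr (fun j => `|y 0%R j|%N)); last first.
    by move=> j /negbTE ji; rewrite mxE ji.
  by lia.
exists (rcons p y); last by rewrite last_rcons.
rewrite rcons_path pz lz /Defs.adjacent /= NN// andbT.
by apply: contra_eq_neq zy => ->; rewrite /eucl_dist big1 ?sqrtr0 1?eq_sym ?oner_neq0// => j _; rewrite subrr expr0n.
Qed.

End Explosion.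

Section Asymptotics.
Context (R : realType).

(** [exp (theta * a) >= (theta / 2 * a) ^ 2], and a quadratic exponent beats the linear one. *)
Lemma stretched_exp_small (B K kappa theta : R) : 0 <= K -> 0 < kappa -> 0 < theta ->
  exists A, forall a, A <= a ->
    B * expR (K * a) * expR (- (kappa * expR (theta * a))) <= expR (- a).
Proof.
move=> K0 k0 t0; pose b := `|B|.
have b0 : 0 <= b by exact: normr_ge0.
have Bb : B <= expR b.
  by apply: le_trans (ler_norm _) _; apply: le_trans (expR_ge1Dx _); rewrite lerDr.
pose k := kappa * (theta / 2) ^+ 2.
have kp : 0 < k by rewrite mulr_gt0// exprn_gt0// divr_gt0.
exists (Num.max 1 ((b + K + 1) / k)) => a; rewrite ge_max => /andP[a1 ka].
have {}ka : b + K + 1 <= k * a by rewrite mulrC -ler_pdivrMr.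
have e2 : (theta / 2 * a) ^+ 2 <= expR (theta * a).
  have -> : theta * a = (theta / 2 * a) * 2%:R by lra.
  rewrite expRM_natr; apply: lerXn2r; rewrite ?nnegrE ?expR_ge0//.
    by rewrite !mulr_ge0 ?invr_ge0//; lra.
  by apply: le_trans (expR_ge1Dx _); lra.
apply: (@le_trans _ _ (expR (b + K * a - kappa * expR (theta * a)))).
  by rewrite expRD expRD; apply: ler_wpM2r; rewrite ?expR_ge0// ler_wpM2r// expR_ge0.
rewrite ler_expR.
have h1 : kappa * (theta / 2 * a) ^+ 2 <= kappa * expR (theta * a) by rewrite ler_pM2l.
have h2 : kappa * (theta / 2 * a) ^+ 2 = k * a * a by rewrite /k; ring.
have h3 : (b + K + 1) * a <= k * a * a by apply: ler_wpM2r => //; lra.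
have h4 : b * 1 <= b * a by rewrite ler_wpM2l.
by rewrite h2 in h1; lra.
Qed.

Lemma bernoulli_exprn (c : R) (j : nat) : 1 <= c -> 1 + j%:R * (c - 1) <= c ^+ j.
Proof.
move=> c1; elim: j => [|j IHj]; first by rewrite mul0r addr0 expr0.
rewrite exprS -natr1; have c0 : 0 <= c - 1 by lra.
have : c * (1 + j%:R * (c - 1)) <= c * c ^+ j by apply: ler_wpM2l => //; lra.
apply: le_trans; have : 0 <= j%:R * (c - 1) * (c - 1) by rewrite !mulr_ge0.
by move: (j%:R : R) => y; nra.
Qed.

End Asymptotics.

(** * Cubes and chains of hubs *)

Section Cubes.
Context (n : nat).

(** The corner is at [(N, ..., N)], so that cubes are disjoint once the side doubles, and their
    points leave every finite set as [N] grows. *)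
Definition cube (N : nat) : seq 'rV[int]_n :=
  [seq \row_i ((N + f i)%N : int) | f : {ffun 'I_n -> 'I_N}].

Lemma size_cube N : size (cube N) = (N ^ n)%N.
Proof. by rewrite /cube size_image card_ffun !card_ord. Qed.

Lemma uniq_cube N : uniq (cube N).
Proof.
rewrite map_inj_uniq ?enum_uniq// => f g /rowP fg; apply/ffunP => i; apply/val_inj.
by have := fg i; rewrite !mxE => -[] /addnI.
Qed.

Lemma mem_cube N x : x \in cube N ->
  forall i, exists2 k, x 0 i = k%:Z & (N <= k < N + N)%N.
Proof.
move=> /mapP[f _ ->] i; exists (N + f i)%N; first by rewrite mxE.
by rewrite leq_addr ltn_add2l ltn_ord.
Qed.

Lemma cube_dist N N' x y : (N <= N')%N -> x \in cube N -> y \in cube N' ->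
  forall i, (`|x 0%R i - y 0%R i| <= N' + N')%N.
Proof.
move=> NN' /mem_cube Hx /mem_cube Hy i.
by have [k -> k1] := Hx i; have [l -> l1] := Hy i; lia.
Qed.

Lemma cube_neq N N' x y : (0 < n)%N -> (N + N <= N')%N -> x \in cube N -> y \in cube N' ->
  x != y.
Proof.
move=> n0 NN' /mem_cube Hx /mem_cube Hy; apply/eqP => xy; rewrite xy in Hx.
have [k xk k1] := Hx (Ordinal n0); have [l xl l1] := Hy (Ordinal n0).
by move: xk; rewrite xl => -[lk]; lia.
Qed.

End Cubes.

Section ChainExplosion.
Context (R : realType) (n : nat) d (Omega : measurableType d) (P : probability Omega R).
Variables (E : {fset 'rV[int]_n} -> {RV P >-> bool}) (L : {fset 'rV[int]_n} -> {RV P >-> R}).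
Variables (r : nat -> nat) (heavy : nat -> 'rV[int]_n -> bool) (eps : nat -> R) (S : R).

Lemma explosive_hub_chain w : (0 < n)%N ->
  (forall B, exists k, (B <= r k)%N) -> (forall N, \sum_(k < N) eps k <= S) ->
  (forall x z, eucl_dist R x z = 1 -> E (edge x z) w) ->
  (exists2 x, x \in cube n (r 0) & heavy 0 x) ->
  (forall k x, x \in cube n (r k) -> heavy k x -> exists y,
     [/\ y \in cube n (r k.+1), heavy k.+1 y, Defs.adjacent E w x y &
         L (edge x y) w <= eps k]) ->
  (limn (reach_time E L w) < +oo)%E.
Proof.
move=> n0 runb epsS NN [x0 x0c x0h] Hstep.
have [p0 p0path p0last] := nearest_neighbour_path x0 NN.
pose T0 := path_length L w 0 p0.
have chain k : exists p, [/\ path (Defs.adjacent E w) 0 p, last 0 p \in cube n (r k),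
    heavy k (last 0 p) & path_length L w 0 p <= T0 + \sum_(j < k) eps j].
  elim: k => [|k [p [pp pc ph pl]]].
    by exists p0; rewrite p0last big_ord0 addr0.
  have [y [yc yh ya yL]] := Hstep k _ pc ph.
  exists (rcons p y); rewrite last_rcons rcons_path pp ya; split => //.
  rewrite -cats1 path_length_cat /= addr0 big_ord_recr/= addrA.
  exact: lerD.
pose t := Num.max 0 (T0 + S).
apply: (@limn_reach_time_lty _ _ _ _ _ _ _ w t); first by rewrite le_max lexx.
move=> /finite_seqP[s Bs].
pose i0 := Ordinal n0.
(* A scale beyond the first coordinates of all vertices of the supposedly finite ball. *)
have [k Hk] := runb (\max_(y <- s) `|y 0%R i0|).+1%N.
have [p [pp pc _ pl]] := chain k.
have ps : last 0 p \in s.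
  suff : ballL E L w t (last 0 p) by rewrite Bs.
  apply: ge_ereal_inf => /=; exists (path_length L w 0 p)%:E; last first.
    by rewrite lee_fin /t le_max; apply/orP; right; apply: le_trans pl _; rewrite lerD2l.
  by exists p.
have := @leq_bigmax_seq _ s xpredT (fun y : 'rV[int]_n => `|y 0%R i0|%N) _ ps isT.
have [l -> /andP[l1 _]] := mem_cube pc i0.
by move=> h; move: (leq_trans Hk l1); rewrite ltnNge /= h.
Qed.

End ChainExplosion.

Lemma powR_expR (R : realType) (x s : R) : expR x `^ s = expR (s * x).
Proof. by rewrite /powR gt_eqF ?expR_gt0// expRK. Qed.

(** * Failure probabilities for the chain of hubs *)

Section SFPExplosion.
Context (R : realType) (n : nat) d (Omega : measurableType d) (P : probability Omega R).
Variables (W : 'rV[int]_n -> {RV P >-> R}) (E : {fset 'rV[int]_n} -> {RV P >-> bool})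
  (L : {fset 'rV[int]_n} -> {RV P >-> R}).
Variables (alpha lambda : R) (muW muL : probability R R).
Hypotheses (n0 : (0 < n)%N) (alpha0 : 0 < alpha) (lambda0 : 0 < lambda).
Hypothesis SFP : is_SFP W E L alpha lambda muW muL.
(** At scale [a] the cube has side about [exp a] and a hub has weight above [exp (omega * a)]. A
    vertex is a hub with probability at least of order [exp (- rho * omega * a)], and [dim_budget]
    splits what remains of the [exp (n * a)] vertices: one [beta] pays for a short edge, the other
    is the surplus of candidates. For hubs at the scales [a] and [c * a] the exponent of
    [W W / dist ^ alpha] is at least [theta * a], up to constants. *)
Variables (omega rho beta c kappa t0 : R).
Hypotheses (omega0 : 0 < omega) (beta0 : 0 < beta) (c1 : 1 < c) (kappa0 : 0 < kappa).
Hypothesis dim_budget : rho * omega + beta + beta = n%:R.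
Let theta := omega + omega * c - alpha * c.
Hypothesis theta0 : 0 < theta.
Hypothesis tailW : forall t, t0 <= t -> ((kappa / t `^ rho)%:E <= muW `]t, +oo[%classic)%E.
Variables (eps : nat -> R) (S : R).
Hypotheses (eps0 : forall k, 0 <= eps k)
  (epsF : forall k, expR (- c ^+ k) <= cumul muL (eps k))
  (epsS : forall N, \sum_(k < N) eps k <= S).

(** With scales [a = K * c ^ j], the bound [beta * K >= 1] gives [c ^ j <= beta * a]: the edge is
    short with probability at least [exp (- beta * a)]. The factor [4 * n] in [lambda'] accounts for
    the distance between consecutive cubes. *)
Let K := 1 + beta^-1.
Let lambda' := lambda / (4 * n%:R) `^ alpha.

Let c10 : 0 < c - 1. Proof. by rewrite subr_gt0. Qed.
Let c0 : 0 <= c. Proof. by rewrite (le_trans ler01)// ltW. Qed.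
Let K1 : 1 <= K. Proof. by rewrite lerDl invr_ge0 ltW. Qed.

Let n0R : 0 < n%:R :> R. Proof. by rewrite ltr0n. Qed.

Let lambda'0 : 0 < lambda'.
Proof. by rewrite divr_gt0// powR_gt0// mulr_gt0. Qed.

(** What a scale has to satisfy: the weight threshold is in the range of [tailW]; [exp a] grows at
    least fourfold to the next scale, which separates the cubes; and the union bounds over a cube,
    and over pairs from consecutive cubes, leave [exp (- a)]. *)
Definition large (a : R) : Prop := [/\ 0 <= a, t0 <= expR (omega * a), 2 <= (c - 1) * a,
  (2 * expR a) ^+ n * expR (- (kappa * expR (beta * a))) <= expR (- a) &
  (2 * expR a) ^+ n * (2 * expR (c * a)) ^+ n * expR (- (lambda' * expR (theta * a)))
    <= expR (- a)].

Let eventually_large : exists A, forall a, A <= a -> large a.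
Proof.
have [A1 HA1] := @stretched_exp_small R (2 ^+ n) n%:R kappa beta (ltW n0R) kappa0 beta0.
have K2 : 0 <= n%:R + n%:R * c by rewrite addr_ge0// mulr_ge0.
have [A2 HA2] := @stretched_exp_small R (2 ^+ n * 2 ^+ n) (n%:R + n%:R * c) lambda' theta
  K2 lambda'0 theta0.
exists (Num.max 0 (Num.max (t0 / omega) (Num.max (2 / (c - 1)) (Num.max A1 A2)))) => a.
rewrite !ge_max => /and5P[a0 a1 a2 a3 a4]; split => //.
- apply: le_trans (expR_ge1Dx _); move: a1; rewrite ler_pdivrMr//; lra.
- by move: a2; rewrite ler_pdivrMr//; lra.
- by apply: le_trans (HA1 a a3); rewrite exprMn -expRM_natl.
have e : (n%:R + n%:R * c) * a = n%:R * a + n%:R * (c * a) by ring.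
apply: le_trans (HA2 a a4); rewrite !exprMn -!expRM_natl e expRD.
by apply: ler_wpM2r; rewrite ?expR_ge0// le_eqVlt; apply/orP; left; apply/eqP; ring.
Qed.

Section Scale.
Variable m : nat.
Let a k := K * c ^+ (k + m).
Hypothesis a_large : forall k, large (a k).
Let r k := (Num.truncn (expR (a k))).+1.
Let h k := expR (omega * a k).

Let aS k : a k.+1 = c * a k.
Proof. by rewrite /a addSn exprS mulrCA. Qed.

Let r_bounds k : expR (a k) <= (r k)%:R <= 2 * expR (a k).
Proof.
have e0 : 0 <= expR (a k) by exact: expR_ge0.
have [ak _ _ _ _] := a_large k.
have e1 : 1 <= expR (a k) by rewrite -[leLHS]expR0 ler_expR.
apply/andP; split; first exact: ltW (truncnS_gt _).
by rewrite /r -natr1; have /andP[+ _] := truncn_itv e0; lra.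
Qed.

Let rS k : (r k + r k <= r k.+1)%N.
Proof.
rewrite -(@ler_nat R) natrD.
have [ak _ a2 _ _] := a_large k.
have /andP[_ r1] := r_bounds k; have /andP[r2 _] := r_bounds k.+1.
have : 4 * expR (a k) <= expR (a k.+1).
  have -> : a k.+1 = (c - 1) * a k + a k by rewrite aS; lra.
  rewrite expRD ler_pM2r ?expR_gt0//.
  apply: (@le_trans _ _ (expR (1 * 2%:R))); last by rewrite ler_expR mul1r.
  have e2 : 2 <= expR 1 :> R by apply: le_trans (expR_ge1Dx _); lra.
  by rewrite expRM_natr expr2; nra.
lra.
Qed.

Let heavy_event k x : set Omega := W x @^-1` `]h k, +oo[.
Let short_event k x y : set Omega := L (edge x y) @^-1` `]-oo, eps (k + m).+1].

Let m_heavy k x : measurable (heavy_event k x).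
Proof. exact: measurable_funPTI. Qed.

Let m_short k x y : measurable (short_event k x y).
Proof. exact: measurable_funPTI. Qed.

(** Lengths are attached to all pairs, so shortness can be demanded before it is known whether the
    pair is an edge. This event involves only [W] and [L], for which a product rule holds; absent
    edges between hubs are treated separately in [missing]. *)
Let no_hub k x : set Omega :=
  \bigcap_(y in [set` cube n (r k.+1)]) ~` (heavy_event k.+1 y `&` short_event k x y).
Let missing k x y : set Omega :=
  (heavy_event k x `&` heavy_event k.+1 y) `&` E (edge x y) @^-1` [set false].
Let Bad k : set Omega := \bigcup_(x in [set` cube n (r k)])
  (no_hub k x `|` \bigcup_(y in [set` cube n (r k.+1)]) missing k x y).
Let BadRoot : set Omega := \bigcap_(x in [set` cube n (r 0)]) ~` heavy_event 0 x.

Let m_no_hub k x : measurable (no_hub k x).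
Proof.
apply: fin_bigcap_measurable => // y _; apply: measurableC.
by apply: measurableI; [exact: m_heavy|exact: m_short].
Qed.

Let m_missing k x y : measurable (missing k x y).
Proof. by apply: measurableI; [exact: measurableI|exact: measurable_funPTI]. Qed.

Let m_missing_U k x : measurable (\bigcup_(y in [set` cube n (r k.+1)]) missing k x y).
Proof. by apply: fin_bigcup_measurable. Qed.

Let m_Bad k : measurable (Bad k).
Proof. by apply: fin_bigcup_measurable => // x _; exact: measurableU. Qed.

Let m_BadRoot : measurable BadRoot.
Proof. by apply: fin_bigcap_measurable => // y _; exact: measurableC. Qed.

Let tail_heavy k : kappa * expR (- (rho * omega * a k)) <= fine (muW `]h k, +oo[%classic).
Proof.
have [_ hk _ _ _] := a_large k.
rewrite -lee_fin fineK ?fin_num_measure//; apply: le_trans (tailW hk).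
by rewrite lee_fin /h powR_expR -expRN; apply: ler_wpM2l; [exact: ltW|rewrite ler_expR mulrA].
Qed.

Let fine_le1 (mu : probability R R) B : measurable B -> fine (mu B) <= 1.
Proof. by move=> mB; rewrite -lee_fin fineK ?fin_num_measure//; exact: probability_le1. Qed.

Let beta_a k : c ^+ (k + m).+1 <= beta * a k.+1.
Proof.
rewrite /a addSn mulrA ler_peMl ?exprn_ge0//.
by rewrite /K mulrDr mulr1 mulfV ?gt_eqF// lerDr ltW.
Qed.

Let size_cube_le k : ((size (cube n (r k)))%:R : R) <= (2 * expR (a k)) ^+ n.
Proof.
have /andP[_ r2] := r_bounds k.
by rewrite size_cube natrX; apply: lerXn2r; rewrite ?nnegrE// mulr_ge0// expR_ge0.
Qed.

Let size_cube_ge k : expR (n%:R * a k) <= (size (cube n (r k)))%:R :> R.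
Proof.
have /andP[r1 _] := r_bounds k.
by rewrite size_cube natrX expRM_natl; apply: lerXn2r; rewrite ?nnegrE// expR_ge0.
Qed.

Let prob_no_hub k x : x \in cube n (r k) ->
  (P (no_hub k x) <= (expR (- (kappa * expR (beta * a k))))%:E)%E.
Proof.
move=> xk; have [iidW _ iidL indep] := SFP.
have xy y : y \in cube n (r k.+1) -> x != y by exact: cube_neq.
pose q := fine (muW `]h k.+1, +oo[%classic) * fine (muL `]-oo, eps (k + m).+1]%classic).
have rule : product_rule P (cube n (r k.+1))
    (fun y => heavy_event k.+1 y `&` short_event k x y) q.
  apply: (iid_pair_product_rule (f := id) (g := edge x) iidW iidL) => //.
  - move=> A B WA LB; rewrite setIC muleC; apply: indep => //.
    by apply: sub_sigma_algebra; left.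
  - by move=> y z /xy xy1 /xy xz; exact: edge_inj.
  - by move=> y /xy xy1; exact: edge_all_edges.
have qlow : kappa * expR (- ((rho * omega + beta) * a k.+1)) <= q.
  apply: (@le_trans _ _ (kappa * expR (- (rho * omega * a k.+1)) * expR (- (beta * a k.+1)))).
    by rewrite -mulrA -expRD mulrDl opprD.
  apply: ler_pM; rewrite ?expR_ge0//; first by rewrite mulr_ge0 ?expR_ge0// ltW.
  by apply: (le_trans _ (epsF (k + m).+1)); rewrite ler_expR lerN2.
have q1 : q <= 1.
  by apply: mulr_ile1; rewrite ?fine_ge0// fine_le1.
rewrite (prob_none (uniq_cube _ _) _ rule); last by move=> y _; exact: measurableI.
rewrite lee_fin; apply: one_minus_exprn => //.
have ak : 0 <= a k by have [] := a_large k.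
apply: (@le_trans _ _ (kappa * expR (beta * a k.+1))).
  rewrite ler_pM2l// ler_expR ler_pM2l// aS; have : 0 <= (c - 1) * a k by rewrite mulr_ge0// ltW.
  by lra.
have -> : beta * a k.+1 = - ((rho * omega + beta) * a k.+1) + n%:R * a k.+1.
  by rewrite -dim_budget; lra.
by rewrite expRD mulrA; apply: ler_pM; rewrite ?expR_ge0// mulr_ge0 ?expR_ge0// ltW.
Qed.

Let prob_missing k x y : x \in cube n (r k) -> y \in cube n (r k.+1) ->
  (P (missing k x y) <= (expR (- (lambda' * expR (theta * a k))))%:E)%E.
Proof.
move=> xk yk; have xy : x != y by exact: cube_neq xk yk.
apply: (prob_non_edge SFP) => //.
- by apply: sigma_algebra_setI; exact: sigma_rvs_preimage.
- by rewrite expR_ge0/= -[leRHS]expR0 ler_expR oppr_le0 mulr_ge0 ?expR_ge0// ltW.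
move=> w []; rewrite /heavy_event /= !in_itv/= !andbT => Wx Wy.
rewrite /conn_prob; case: ifP => _; first by rewrite gerBl expR_ge0.
rewrite lerD2l lerN2 ler_expR lerN2.
have dist0 := eucl_dist_gt0 R xy.
have dist_le : eucl_dist R x y <= 4 * n%:R * expR (a k.+1).
  apply: (le_trans (eucl_dist_le R (cube_dist _ xk yk))).
    by apply: leq_trans (rS k); exact: leq_addr.
  have /andP[_ r2] := r_bounds k.+1.
  rewrite natrM natrD.
  have -> : 4 * n%:R * expR (a k.+1) = n%:R * (2 * expR (a k.+1) + 2 * expR (a k.+1)) by ring.
  by rewrite ler_pM2l// lerD.
have e0 : 0 < expR (a k.+1) by exact: expR_gt0.
have n4 : 0 < 4 * n%:R :> R by rewrite mulr_gt0.
have dalpha : eucl_dist R x y `^ alpha <= (4 * n%:R) `^ alpha * expR (alpha * a k.+1).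
  rewrite -(powR_expR (a k.+1) alpha) -powRM; [|exact: ltW|exact: ltW].
  apply: ge0_ler_powR; rewrite ?nnegrE//; try exact: ltW.
have WW : h k * h k.+1 <= W x w * W y w by apply: ler_pM; rewrite ?expR_ge0// ltW.
have -> : expR (theta * a k) = h k * h k.+1 / expR (alpha * a k.+1).
  by rewrite /h -expRD -expRN -expRD aS /theta; congr expR; ring.
have p1 : 0 < eucl_dist R x y `^ alpha by exact: powR_gt0.
have p2 : 0 < (4 * n%:R) `^ alpha by exact: powR_gt0.
rewrite /lambda' ler_pdivlMr//.
have -> : lambda / (4 * n%:R) `^ alpha * (h k * h k.+1 / expR (alpha * a k.+1)) =
  lambda * (h k * h k.+1) / ((4 * n%:R) `^ alpha * expR (alpha * a k.+1)).
  by field; rewrite !gt_eqF ?expR_gt0.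
rewrite mulrAC ler_pdivrMr; last by rewrite mulr_gt0 ?expR_gt0.
apply: ler_pM => //; try exact: ltW.
  by rewrite !mulr_ge0 ?expR_ge0// ltW.
by rewrite -mulrA ler_pM2l.
Qed.

Let prob_Bad k : (P (Bad k) <= (2 * expR (- a k))%:E)%E.
Proof.
have [_ _ _ l1 l2] := a_large k.
pose b1 := expR (- (kappa * expR (beta * a k))).
pose b2 := expR (- (lambda' * expR (theta * a k))).
apply: (@le_trans _ _ ((size (cube n (r k)))%:R * (b1 + (size (cube n (r k.+1)))%:R * b2))%:E).
  apply: union_bound_seq => x xk; first by apply: measurableU.
  apply: le_trans (measureU2 _ _ _) _ => //.
  rewrite EFinD; apply: leeD; first exact: prob_no_hub.
  by apply: union_bound_seq => y yk //; exact: prob_missing.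
rewrite lee_fin mulrDr (_ : 2 * expR (- a k) = expR (- a k) + expR (- a k)); last by ring.
apply: lerD.
  by apply: le_trans l1; apply: ler_wpM2r; rewrite ?expR_ge0.
apply: le_trans l2; rewrite mulrA; apply: ler_wpM2r; first by rewrite expR_ge0.
by apply: ler_pM => //; have := size_cube_le k.+1; rewrite aS.
Qed.

Let prob_BadRoot : (P BadRoot <= (expR (- a 0))%:E)%E.
Proof.
have [iidW _ _ _] := SFP; have [ak _ _ l1 _] := a_large 0.
pose q := fine (muW `]h 0, +oo[%classic).
have rule : product_rule P (cube n (r 0)) (heavy_event 0) q.
  by move=> t ut ts; exact: (iid_bigcap (f := id) iidW).
rewrite (prob_none (uniq_cube _ _) _ rule)// lee_fin.
apply: (@le_trans _ _ (expR (- (kappa * expR (beta * a 0))))).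
  apply: one_minus_exprn; first exact: fine_le1.
  apply: (@le_trans _ _ (kappa * expR (- (rho * omega * a 0)) * expR (n%:R * a 0))).
    rewrite -mulrA -expRD ler_pM2l// ler_expR -dim_budget.
    have : 0 <= beta * a 0 by rewrite mulr_ge0// ltW.
    by lra.
  by apply: ler_pM; rewrite ?expR_ge0// mulr_ge0 ?expR_ge0// ltW.
apply: le_trans l1; rewrite -[leLHS]mul1r; apply: ler_wpM2r; first by rewrite expR_ge0.
apply: exprn_ege1; have : 1 <= expR (a 0) by rewrite -[leLHS]expR0 ler_expR.
by lra.
Qed.

Definition hub_failure : set Omega := BadRoot `|` \bigcup_k Bad k.

Lemma measurable_hub_failure : measurable hub_failure.
Proof. by apply: measurableU => //; exact: bigcup_measurable. Qed.

Let q := expR (- (c - 1)).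

Lemma prob_hub_failure : (P hub_failure <= ((1 + 2 / (1 - q)) * q ^+ m)%:E)%E.
Proof.
have q0 : 0 < q by exact: expR_gt0.
have q1 : q < 1 by rewrite expR_lt1 oppr_lt0.
(* Bernoulli's inequality [c ^ j >= j * (c - 1)] turns doubly exponential decay into geometric
   decay. *)
have aq k : expR (- a k) <= q ^+ m * q ^+ k.
  rewrite -exprD -expRM_natl ler_expR mulrN lerN2.
  apply: (@le_trans _ _ (c ^+ (k + m))).
    by have := bernoulli_exprn (k + m) (ltW c1); rewrite addnC; lra.
  by rewrite ler_peMl ?exprn_ge0.
have mU : measurable (\bigcup_k Bad k) by exact: bigcup_measurable.
apply: le_trans (measureU2 _ _ _) _ => //.
rewrite mulrDl mul1r EFinD; apply: leeD.
  by apply: le_trans prob_BadRoot _; rewrite lee_fin; have := aq 0%N; rewrite expr0 mulr1.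
rewrite mulrAC; apply: union_bound_geometric => //.
- by rewrite mulr_ge0// exprn_ge0// ltW.
- by rewrite ltW.
move=> k; apply: le_trans (prob_Bad k) _; rewrite lee_fin -mulrA ler_pM2l//.
Qed.

Lemma hub_success w : ~ hub_failure w ->
  (forall x z, eucl_dist R x z = 1 -> E (edge x z) w) -> (limn (reach_time E L w) < +oo)%E.
Proof.
move=> /not_orP[nroot nbad] NN.
apply: (@explosive_hub_chain _ _ _ _ _ E L r (fun k x => h k < W x w)
   (fun k => eps (k + m).+1) S w) => //.
- move=> B; have [j Hj] := exprn_unbounded B%:R c1; exists j.
  have /andP[r1 _] := r_bounds j; rewrite -(@ler_nat R); apply: le_trans r1.
  apply: le_trans (expR_ge1Dx _); have : c ^+ j <= a j; last by lra.
  apply: (@le_trans _ _ (c ^+ (j + m))); first by rewrite ler_weXn2l ?leq_addr// ltW.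
  by rewrite ler_peMl ?exprn_ge0.
- move=> N; apply: le_trans (epsS (m.+1 + N)%N); rewrite big_split_ord/=.
  rewrite [X in _ <= _ + X](eq_bigr (fun k : 'I_N => eps (k + m).+1)); last first.
    by move=> i _; rewrite addSn addnC.
  by rewrite lerDr sumr_ge0.
- apply: contrapT => H; apply: nroot => x xc; rewrite /heavy_event /= in_itv/= andbT => hx.
  by apply: H; exists x.
move=> k x xk hx; apply: contrapT => H; apply: nbad; exists k => //; exists x => //.
have [[y yk my]|nmiss] := pselect ((\bigcup_(y in [set` cube n (r k.+1)]) missing k x y) w).
  by right; exists y.
left => y yk [hy ly]; apply: H; exists y; split => //.
- by move: hy; rewrite /heavy_event /= in_itv/= andbT.
- rewrite /Defs.adjacent (cube_neq n0 (rS k) xk yk)/=; apply: contrapT => /negP/negbTE nE.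
  apply: nmiss; exists y => //; split; last exact: nE.
  by split => //; rewrite /heavy_event /= in_itv/= andbT.
Qed.

End Scale.

(** Each such pair has connection probability 1, hence is absent with probability at most 0, and
    there are countably many pairs. *)
Lemma nearest_neighbour_ae :
  {ae P, forall w, forall x z : 'rV[int]_n, eucl_dist R x z = 1 -> E (edge x z) w}.
Proof.
apply: ae_forall_countable => x; apply: ae_forall_countable => z.
have [xz1|xz1] := pselect (eucl_dist R x z = 1); last exact: aeW.
have xz : x != z.
  by apply: contra_eq_neq xz1 => ->; rewrite /eucl_dist big1 ?sqrtr0 1?eq_sym ?oner_neq0// => j _; rewrite subrr expr0n.
apply: (ae_of_prob0 (A := E (edge x z) @^-1` [set false])).
- exact: measurable_funPTI.
- apply/eqP; rewrite eq_le measure_ge0 andbT.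
  rewrite -[E (edge x z) @^-1` _]setTI; apply: (prob_non_edge SFP) => //; last first.
  - by move=> w _; rewrite /conn_prob xz1 eqxx subr0.
  - by rewrite lexx ler01.
  - exact: (@measurableT _ (g_sigma_algebraType _)).
- by move=> w nE _; move: nE => /=; case: (E _ w).
Qed.

Lemma SFP_explosive : explosive_profile E L.
Proof.
have [A HA] := eventually_large.
have [m0 Hm0] := exprn_unbounded A c1.
have aL m k : large (K * c ^+ (k + (m0 + m))).
  apply: HA; apply: le_trans Hm0 _; apply: (@le_trans _ _ (c ^+ (k + (m0 + m)))).
    by rewrite ler_weXn2l//; [exact: ltW|rewrite addnCA leq_addr].
  by rewrite ler_peMl ?exprn_ge0.
(* [m0] makes all scales large; letting [m] grow then sends the failure probability to 0. *)
have ae1 : {ae P, forall w,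
    (forall x z : 'rV[int]_n, eucl_dist R x z = 1 -> E (edge x z) w) ->
    (limn (reach_time E L w) < +oo)%E}.
  apply: (@ae_of_geometric _ _ _ _ (fun m => hub_failure (m0 + m))
    ((1 + 2 / (1 - expR (- (c - 1)))) * expR (- (c - 1)) ^+ m0) (expR (- (c - 1)))).
  - by rewrite expR_gt0 expR_lt1 oppr_lt0.
  - by move=> m; exact: measurable_hub_failure.
  - by move=> m; rewrite -mulrA -exprD; exact: prob_hub_failure.
  - by move=> m w; exact: hub_success.
by apply: filterS2 nearest_neighbour_ae ae1 => w NN; apply.
Qed.

End SFPExplosion.

Lemma real_tail_lower (R : realType) (muW : probability R R) (rho rho' : R) :
  power_law_tail (fun t : R => muW `]t, +oo[%classic) rho -> 0 < rho' -> rho < rho' ->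
  exists2 kappa, 0 < kappa & exists t0, forall t, t0 <= t ->
    ((kappa / t `^ rho')%:E <= muW `]t, +oo[%classic)%E.
Proof.
move=> pl r0 rr; pose g (t : R) := 1 - cumul muW t.
have tailg t : 0 < t -> muW `]t, +oo[%classic = (g t)%:E by move=> _; exact: tail_cumul.
have g_mono t s : t <= s -> g s <= g t by move=> ts; rewrite lerD2l lerN2; exact: cumul_le.
have [kappa k0 [t0 _ Ht]] := power_law_lower tailg g_mono pl r0 rr.
by exists kappa => //; exists t0 => t tt; rewrite tail_cumul lee_fin; exact: Ht.
Qed.

Lemma criterion_W_SFP (R : realType) (n : nat) (alpha lambda tau : R)
    (muW muL : probability R R) :
  (1 <= n)%N -> 0 < lambda -> 1 < tau ->
  power_law_tail (fun t : R => muW `]t, +oo[%classic) (tau - 1) ->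
  1 < alpha * (tau - 1) / n%:R < 2 ->
  muL `[0, +oo[%classic = 1%E ->
  (forall c, 1 < c -> explosion_criterion muL c) -> W_SFP n alpha lambda muW muL.
Proof.
move=> n0 lambda0 tau1 pl /andP[g1 g2] muL0 crit; split => // d Omega P W E L SFP.
have n0R : 0 < n%:R :> R by rewrite ltr0n.
set rho := tau - 1 in pl g1 g2; have rho0 : 0 < rho by rewrite subr_gt0.
move: g1 g2; rewrite ltr_pdivlMr// ltr_pdivrMr// mul1r => g1 g2.
have alpha0 : 0 < alpha by rewrite -(pmulr_lgt0 _ rho0); exact: lt_trans g1.
have ar : alpha / 2 < n%:R / rho by rewrite ltr_pdivlMr// mulrAC ltr_pdivrMr//; lra.
(* [gamma < 2] means [alpha / 2 < n / rho]. The lower bound on [omega] makes [theta] positive at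
   [c = 1], the upper one leaves vertices to spare in the dimension budget. *)
pose omega := (alpha / 2 + n%:R / rho) / 2.
have om1 : alpha / 2 < omega by rewrite /omega; lra.
have om2 : omega < n%:R / rho by rewrite /omega; lra.
have omega0 : 0 < omega by lra.
have rn : rho < n%:R / omega by rewrite ltr_pdivlMr// mulrC -ltr_pdivlMr.
(* Slightly more than the true tail exponent, to absorb the slowly varying factor. *)
pose rho' := (rho + n%:R / omega) / 2.
have r1 : rho < rho' by rewrite /rho'; lra.
have r2 : rho' < n%:R / omega by rewrite /rho'; lra.
have r2' : rho' * omega < n%:R by rewrite -ltr_pdivlMr.
pose beta := (n%:R - rho' * omega) / 2.
have beta0 : 0 < beta by rewrite divr_gt0// subr_gt0.
have budget : rho' * omega + beta + beta = n%:R by rewrite /beta; lra.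
(* With [c = 1 + nu], [theta] is half of its value at [c = 1] plus [nu * omega]. *)
pose nu := (2 * omega - alpha) / (2 * alpha).
have om3 : 0 < 2 * omega - alpha by lra.
have nu0 : 0 < nu by rewrite divr_gt0// mulr_gt0.
have c1 : 1 < 1 + nu by rewrite ltrDl.
have nua : nu * alpha = (2 * omega - alpha) / 2 by rewrite /nu; field; rewrite gt_eqF.
have theta0 : 0 < omega + omega * (1 + nu) - alpha * (1 + nu).
  have : 0 < nu * omega by rewrite mulr_gt0.
  by lra.
have rho'0 : 0 < rho' by lra.
have [kappa k0 [t0 tailW]] := real_tail_lower pl rho'0 r1.
have [eps [eps0 epsF [S epsS]]] := crit _ c1.
exact: (SFP_explosive n0 alpha0 lambda0 SFP omega0 beta0 c1 k0 budget theta0 tailW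
  eps0 epsF epsS).
Qed.

(** * Scale-free percolation: non-explosion *)

Section Clamp.
Context (R : realType) (mu : probability R R) (b : R).
Hypothesis mub : mu `[b, +oo[%classic = 1%E.

Lemma measurable_clamp : measurable_fun setT (fun f => Num.max b (quantile_bits mu f)).
Proof. by apply: measurable_maxr => //; exact: measurable_funPT. Qed.

(* Clamping at [b] does not change the law, but makes the bound hold everywhere. *)
Definition clamped_bits : {mfun bit_space >-> R} := to_mfun measurable_clamp.

Lemma distribution_clamped_bits B : measurable B ->
  distribution (coin R) clamped_bits B = mu B.
Proof.
move=> mB.
have mC : measurable (Num.max b @^-1` B).
  by apply: measurable_preimage => //; exact: measurable_maxr.
rewrite [LHS](_ : _ = distribution (coin R) (quantile_bits mu) (Num.max b @^-1` B))//.
rewrite distribution_quantile_bits//.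
have mb : measurable (`[b, +oo[%classic : set R) by [].
have nullC : mu (~` `[b, +oo[%classic) = 0%E by rewrite probability_setC// mub subee.
have restrict (S : set R) : measurable S -> mu S = mu (S `&` `[b, +oo[%classic).
  move=> mS; rewrite (@measureDI _ _ _ mu S `[b, +oo[%classic)//.
  rewrite [X in (X + _)%E](_ : _ = 0%E) ?add0e//.
  apply/eqP; rewrite eq_le measure_ge0 andbT -nullC.
  by apply: le_measure; rewrite ?inE; [exact: measurableD|exact: measurableC|move=> x []].
rewrite restrict// [RHS]restrict//; congr (mu _).
apply/seteqP; split => x /=; rewrite in_itv/= andbT => -[Bx bx]; split => //.
  by move: Bx; rewrite (max_idPr bx).
by rewrite (max_idPr bx).
Qed.

End Clamp.

Lemma sigma_algebra_preimage_events d d' (T : measurableType d) (T' : measurableType d')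
    (f : T -> T') : sigma_algebra setT [set f @^-1` A | A in measurable].
Proof.
have := @sigma_algebra_preimage T T' measurable setT f (@sigma_algebra_measurable _ T').
by congr (sigma_algebra _ _); apply/seteqP; split => _ [A mA <-]; exists A => //; rewrite setTI.
Qed.

Lemma unif_itvNyc (R : realType) (c : R) : 0 <= c <= 1 -> unif R `]-oo, c]%classic = c%:E.
Proof.
move=> /andP[c0 c1]; rewrite unifE//.
have -> : `]-oo, c]%classic `&` `[0, 1]%classic = `[0, c]%classic :> set R.
  by apply/seteqP; split => x /=; rewrite !in_itv/=; lra.
rewrite [LHS](@lebesgue_measure_itv R `[0, c])/= lte_fin oppr0 adde0.
by move: c0; rewrite le_eqVlt => /orP[/eqP <-|->//]; rewrite ltxx.
Qed.

Lemma conn_probC (R : realType) n (alpha lambda : R) (x y : 'rV[int]_n) (a b : R) :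
  conn_prob alpha lambda x y a b = conn_prob alpha lambda y x b a.
Proof. by rewrite /conn_prob (eucl_distC R x y) -!(mulrA lambda) (mulrC a b). Qed.

Lemma conn_prob_bounds (R : realType) n (alpha lambda : R) (x y : 'rV[int]_n) (a b : R) :
  0 <= lambda -> 0 <= a -> 0 <= b -> 0 <= conn_prob alpha lambda x y a b <= 1.
Proof.
move=> l0 a0 b0; rewrite /conn_prob; case: ifP => _; first by rewrite ler01 lexx.
have : expR (- (lambda * a * b / eucl_dist R x y `^ alpha)) <= 1.
  by rewrite -expR0 ler_expR oppr_le0 divr_ge0 ?powR_ge0// !mulr_ge0.
have := expR_ge0 (- (lambda * a * b / eucl_dist R x y `^ alpha)).
by move=> h1 h2; rewrite subr_ge0 h2 gerBl h1.
Qed.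

Lemma edge_eq n (x y u v : 'rV[int]_n) : x != y -> u != v -> edge x y = edge u v ->
  (u, v) = (x, y) \/ (u, v) = (y, x).
Proof.
move=> xy uv /fsetP e.
have := e u; have := e v; rewrite !inE !eqxx orbT /=.
move=> /orP[]/eqP vE /orP[]/eqP uE; move: uv; rewrite uE vE ?eqxx//.
  by right.
by left.
Qed.

Lemma independent_bigcap d d' (Omega : measurableType d) (T : measurableType d')
    (R : realType) (P : probability Omega R) (I : choiceType) (K : eqType) (J : set I)
    (X : I -> {RV P >-> T}) (t : seq K) (f : K -> I) (B : I -> set T) :
  independent_rvs J X -> uniq (map f t) -> (forall i, i \in t -> J (f i)) ->
  (forall i, measurable (B i)) ->
  P (\bigcap_(i in [set` t]) X (f i) @^-1` B (f i)) =
    (\prod_(i <- t) P (X (f i) @^-1` B (f i)))%E.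
Proof.
move=> indep umap fJ mB.
pose F := [fset x in map f t]%fset.
have FE : enum_fset F =i map f t by move=> x; rewrite in_fset.
have -> : \bigcap_(i in [set` t]) X (f i) @^-1` B (f i) = \bigcap_(j in [set` F]) X j @^-1` B j.
  apply/seteqP; split => w Hw i.
    by move=> /=; rewrite in_fset => /mapP[k kt ->]; exact: Hw.
  by move=> it; apply: Hw => /=; rewrite in_fset; exact: map_f.
rewrite (indep F B)//; last first.
  by move=> j /=; rewrite in_fset => /mapP[k kt ->]; exact: fJ.
rewrite (perm_big (map f t)); last by apply: uniq_perm => //; exact: fset_uniq.
by rewrite big_map.
Qed.

(** * A realization of scale-free percolation *)

Section SFPRealization.
Context (R : realType) (n : nat) (alpha lambda : R) (muW muL : probability R R).
Hypothesis lambda0 : 0 < lambda.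
Context d1 (O1 : measurableType d1) (P1 : probability O1 R)
  d2 (O2 : measurableType d2) (P2 : probability O2 R)
  d3 (O3 : measurableType d3) (P3 : probability O3 R).
Local Notation V := 'rV[int]_n.
Variables (W1 : V -> {RV P1 >-> R}) (U : {fset V} -> {RV P2 >-> R})
  (L3 : {fset V} -> {RV P3 >-> R}).
Hypotheses (iidW : iid muW setT W1) (iidU : iid (unif R) setT U)
  (iidL : iid muL (@all_edges n) L3) (W1_ge1 : forall x f, 1 <= W1 x f).

Let P12 : probability (O1 * O2)%type R := prod_prob P1 P2.
Let Q : probability (O1 * O2 * O3)%type R := prod_prob P12 P3.

Let conn x y f := conn_prob alpha lambda x y (W1 x f) (W1 y f).

Let conn_bounds x y f : 0 <= conn x y f <= 1.
Proof.
by apply: conn_prob_bounds; [exact: ltW|exact: le_trans (W1_ge1 _ _)|exact: le_trans (W1_ge1 _ _)].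
Qed.

Let measurable_conn x y : measurable_fun setT (conn x y).
Proof. exact: measurable_conn_prob. Qed.

(* One of the two orders of the pair; the junk value on other sets is irrelevant. *)
Definition edge_ends (e : {fset V}) : V * V :=
  xget (0, 0) [set p : V * V | p.1 != p.2 /\ e = edge p.1 p.2].

Let edge_conn (e : {fset V}) := conn (edge_ends e).1 (edge_ends e).2.

Let edge_connE x y f : x != y -> edge_conn (edge x y) f = conn x y f.
Proof.
move=> xy; rewrite /edge_conn /edge_ends.
case: xgetP => [[u v] _ [/= uv /(edge_eq xy uv)]|/(_ (x, y))]; last by case.
case=> -[-> ->]; first by [].
exact: conn_probC.
Qed.

Let measurable_edge e : measurable_fun setT
  (fun z : O1 * O2 => U e z.2 <= edge_conn e z.1).
Proof.
apply: measurable_fun_ler; first exact: (measurableT_comp (measurable_funPT (U e))).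
exact: (measurableT_comp (measurable_conn _ _)).
Qed.

(** An edge is present when its uniform mark is below the connection probability: for fixed weights
    the edges are independent with the prescribed probabilities. *)
Let E2 e : {RV P12 >-> bool} := to_mfun (measurable_edge e).

(** Fubini: for fixed weights [f] the section is an intersection of independent events on distinct
    marks. The product measure is by definition the integral of its sections. *)
Lemma prob_present_edges (s : seq (V * V)) (A : set O1) :
  all (fun p => p.1 != p.2) s -> uniq [seq edge p.1 p.2 | p <- s] -> measurable A ->
  P12 (fst @^-1` A `&` \bigcap_(p in [set` s]) (E2 (edge p.1 p.2) @^-1` [set true])) =
  (\int[P1]_(f in A) (\prod_(p <- s) conn p.1 p.2 f)%:E)%E.
Proof.
move=> /allP sN us mA.
transitivity (\int[P1]_f P2 (xsection (fst @^-1` A `&`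
    \bigcap_(p in [set` s]) (E2 (edge p.1 p.2) @^-1` [set true])) f))%E; first by [].
rewrite [RHS]integral_mkcond; apply: eq_integral => f _ /=.
rewrite patchE; case: ifPn => [/set_mem Af|/negP Af]; last first.
  rewrite (_ : xsection _ _ = set0) ?measure0//.
  apply/seteqP; split => // g; rewrite /xsection /= inE /= => -[Af' _].
  by apply: Af; exact/mem_set.
have -> : xsection (fst @^-1` A `&`
    \bigcap_(p in [set` s]) (E2 (edge p.1 p.2) @^-1` [set true])) f =
  \bigcap_(p in [set` s]) (U (edge p.1 p.2) @^-1` `]-oo, edge_conn (edge p.1 p.2) f]%classic).
  apply/seteqP; split => g; rewrite /xsection /= inE /=.
    by move=> [_ H] p ps; rewrite /= in_itv/=; exact: (H p ps).
  move=> H; split => // p ps; have := H p ps; by rewrite /= in_itv/=.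
rewrite (independent_bigcap (f := fun p => edge p.1 p.2)
  (B := fun e => `]-oo, edge_conn e f]%classic) (proj2 iidU))//.
rewrite [LHS]big_seq [in RHS]big_seq -prodEFin; apply: eq_bigr => p ps.
rewrite [LHS](iid_prob iidU)// unif_itvNyc; last exact: conn_bounds.
by rewrite edge_connE//; exact: sN.
Qed.

Let proj_W (w : O1 * O2 * O3) := w.1.1.

Let measurable_proj_W : measurable_fun setT proj_W.
Proof. exact: (measurableT_comp measurable_fst measurable_fst). Qed.

Let prob_proj_W A : measurable A -> Q (proj_W @^-1` A) = P1 A.
Proof.
move=> mA; rewrite -[RHS](prob_fst P1 P2 mA) -[RHS](prob_fst P12 P3)//.
by rewrite -[X in measurable X]setTI; exact: measurable_fst.
Qed.

Lemma is_SFP_realization : is_SFP (fun x => lift_fst P3 (lift_fst P2 (W1 x)))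
  (fun e => lift_fst P3 (E2 e)) (fun e => lift_snd P12 (L3 e)) alpha lambda muW muL.
Proof.
split.
- by do 2! apply: iid_lift_fst.
- move=> s A sN us WA.
  (* Events of the weights are preimages under the projection, so the integral becomes one over [O1]
     by change of variables. *)
  have [A1 mA1 AE] : [set proj_W @^-1` B | B in measurable] A.
    move: WA; apply: smallest_sub; first exact: sigma_algebra_preimage_events.
    by move=> _ [x _ [B mB <-]]; exists (W1 x @^-1` B) => //; exact: measurable_funPTI.
  rewrite -AE.
  have := prob_present_edges sN us mA1.
  rewrite -(prob_fst P12 P3); last first.
    apply: measurableI; first by rewrite -[X in measurable X]setTI; exact: measurable_fst.
    by apply: fin_bigcap_measurable => // p _; exact: measurable_funPTI.
  move=> H; rewrite [LHS]H.
  pose g f := (\prod_(p <- s) conn p.1 p.2 f)%:E.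
  rewrite -[LHS](@eq_measure_integral _ _ _ A1 P1 (pushforward Q proj_W) g); last first.
    by move=> B mB _; exact: prob_proj_W.
  have mg : measurable_fun A1 g.
    apply/measurable_EFinP; apply: measurable_funTS; apply: measurable_prod => p _.
    exact: measurable_conn.
  have g0 : {in A1, forall f, (0 <= g f)%E}.
    move=> f _; rewrite lee_fin; apply: prodr_ge0 => p _.
    by case/andP: (conn_bounds p.1 p.2 f).
  exact: (ge0_integral_pushforward measurable_proj_W).
- exact: iid_lift_snd.
- move=> A B LA WEB; rewrite setIC muleC; apply: independent_fst_snd; last first.
    by apply: sub_snd_events LA.
  move: WEB; apply: smallest_sub; first exact: sigma_algebra_fst_events.
  by move=> C [|]; exact: sub_fst_events.
Qed.

End SFPRealization.

(** The bounds hold at every [w], not merely almost surely; this is what the clamping provides, and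
    path lengths become nonnegative pointwise. *)
Lemma exists_SFP (R : realType) n (alpha lambda : R) (muW muL : probability R R) :
  0 < lambda -> muW `[1, +oo[%classic = 1%E -> muL `[0, +oo[%classic = 1%E ->
  exists d (Omega : measurableType d) (P : probability Omega R)
    (W : 'rV[int]_n -> {RV P >-> R}) (E : {fset 'rV[int]_n} -> {RV P >-> bool})
    (L : {fset 'rV[int]_n} -> {RV P >-> R}),
  [/\ is_SFP W E L alpha lambda muW muL, forall x w, 1 <= W x w & forall e w, 0 <= L e w].
Proof.
move=> l0 W1 L0.
pose W x : {RV coin R >-> R} := iid_copy R (clamped_bits muW 1) (x : 'rV[int]_n).
pose U e : {RV coin R >-> R} := iid_copy R (quantile_bits (unif R)) (e : {fset 'rV[int]_n}).
pose L e : {RV coin R >-> R} := iid_copy R (clamped_bits muL 0) (e : {fset 'rV[int]_n}).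
have Wge1 x f : 1 <= W x f by rewrite /W /= le_max lexx.
have Lge0 e f : 0 <= L e f by rewrite /L /= le_max lexx.
have iidW : iid muW setT W by apply: iid_iid_copy; exact: distribution_clamped_bits.
have iidU : iid (unif R) setT U by apply: iid_iid_copy; exact: distribution_quantile_bits.
have iidL : iid muL (@all_edges n) L by apply: iid_iid_copy; exact: distribution_clamped_bits.
do 6! eexists; split; first exact: (is_SFP_realization alpha l0 iidW iidU iidL Wge1).
- by move=> x w; exact: Wge1.
- by move=> e w; exact: Lge0.
Qed.

Lemma real_tail_upper (R : realType) (mu : probability R R) (rho s : R) :
  power_law_tail (fun t : R => mu `]t, +oo[%classic) rho -> 0 < s < rho ->
  exists2 K, 0 < K & forall t, 1 <= t -> (mu `]t, +oo[%classic <= (K / t `^ s)%:E)%E.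
Proof.
move=> pl /andP[s0 sr]; pose g (t : R) := 1 - cumul mu t.
have tailg t : 0 < t -> mu `]t, +oo[%classic = (g t)%:E by move=> _; exact: tail_cumul.
have g_mono t u : t <= u -> g u <= g t by move=> tu; rewrite lerD2l lerN2; exact: cumul_le.
have g1 t : g t <= 1 by rewrite gerBl cumul_ge0.
have g0 t : 0 <= g t by rewrite subr_ge0 cumul_le1.
have [K K0 HK] := power_law_upper tailg g_mono pl g1 g0 s0 sr.
by exists K => // t t1; rewrite tail_cumul lee_fin; exact: HK.
Qed.

(** * Moments of the weights and long edges *)

Section PowersOfTwo.
Context (R : realType).
Implicit Types x y : R.

Lemma powR2E x : 2 `^ x = expR (x * ln 2).
Proof. by rewrite /powR gt_eqF. Qed.

Lemma powR2D x y : 2 `^ (x + y) = 2 `^ x * 2 `^ y :> R.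
Proof. by rewrite powRD// pnatr_eq0 implybT. Qed.

Lemma powR2_lt1 x : x < 0 -> 2 `^ x < 1 :> R.
Proof.
have l2 : 0 < ln (2 : R) by apply: ln_gt0; rewrite ltr1n.
by move=> x0; rewrite powR2E -[ltRHS]expR0 ltr_expR pmulr_llt0.
Qed.

Lemma powR2_nat (k : nat) : 2 `^ (k%:R) = 2 ^+ k :> R.
Proof. by rewrite powR_mulrn. Qed.

Lemma powR2_exprn (k : nat) x : (2 `^ x) ^+ k = 2 `^ (k%:R * x) :> R.
Proof. by rewrite -powR_mulrn ?powR_ge0// -powRrM mulrC. Qed.

End PowersOfTwo.

(** Dyadic layers: [X ^ s] is at most the sum of [2 ^ (s * (j + 1))] over [2 ^ j <= X], and the
    expectations decay with ratio [2 ^ (s - s1)]. The bound is chosen before the realization. *)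
Lemma moment_bound (R : realType) (mu : probability R R) (s s1 K : R) :
  0 < s < s1 -> (forall t, 1 <= t -> (mu `]t, +oo[%classic <= (K / t `^ s1)%:E)%E) ->
  exists2 M, 0 <= M & forall d (Omega : measurableType d) (P : probability Omega R)
    (X : {RV P >-> R}), (forall B, measurable B -> P (X @^-1` B) = mu B) ->
    (forall w, 1 <= X w) -> (\int[P]_w (X w `^ s)%:E <= M%:E)%E.
Proof.
move=> /andP[s0 ss1] tail.
(* The 1 covers the layer [j = 0]; the factor [2 ^ s1] pays for replacing the closed ray at
   [2 ^ j.+1] by the open one at [2 ^ j]. *)
pose K' := Num.max 1 (K * 2 `^ s1); pose q : R := 2 `^ (s - s1).
have K'1 : 1 <= K' by rewrite le_max lexx.
have q01 : 0 <= q < 1 by rewrite powR_ge0 powR2_lt1// subr_lt0.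
exists (2 `^ s * K' / (1 - q)).
  by rewrite divr_ge0 ?mulr_ge0 ?powR_ge0 ?(le_trans _ K'1)//; lra.
move=> d Omega P X lawX X1.
pose A (j : nat) := X @^-1` `[2 ^+ j, +oo[%classic.
have mA j : measurable (A j) by exact: measurable_funPTI.
have PA j : (P (A j) <= (K' * (2 `^ (- s1)) ^+ j)%:E)%E.
  case: j => [|j].
    rewrite expr0 mulr1; apply: (@le_trans _ _ 1%E); first exact: probability_le1.
    by rewrite lee_fin.
  apply: (@le_trans _ _ (P (X @^-1` `]2 ^+ j, +oo[%classic))).
    apply: le_measure; rewrite ?inE//; first exact: measurable_funPTI.
    move=> w; rewrite /A /= !in_itv/= !andbT; apply: lt_le_trans.
    by rewrite ltr_eXn2l// ltr1n.
  rewrite [leLHS]lawX//; apply: le_trans (tail _ _) _; first by rewrite exprn_ege1// ler1n.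
  rewrite lee_fin -powR2_nat -powRrM powR2_exprn -powRN.
  apply: (@le_trans _ _ (K * 2 `^ s1 * 2 `^ (j.+1%:R * - s1))).
    rewrite -mulrA -powR2D (_ : s1 + j.+1%:R * - s1 = - (j%:R * s1)) ?lexx//.
    by rewrite -(natr1 j); ring.
  by rewrite ler_wpM2r ?powR_ge0// le_max lexx orbT.
pose u j w := (2 `^ (s * j.+1%:R) * \1_(A j) w)%:E : \bar R.
have u0 j w : (0 <= u j w)%E by rewrite lee_fin mulr_ge0 ?powR_ge0.
have mu_ j : measurable_fun setT (u j).
  by apply/measurable_EFinP; apply: measurable_funM => //; exact: measurable_indic.
apply: (@le_trans _ _ (\int[P]_w \sum_(0 <= j <oo) u j w)%E).
  apply: ge0_le_integral => //.
  - by move=> w _; rewrite lee_fin powR_ge0.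
  - apply/measurable_EFinP.
    exact: (measurableT_comp (measurable_powR s) (measurable_funPT X)).
  - by apply: ge0_emeasurable_sum => // j w _ _; exact: u0.
  move=> w _; have [j /andP[j1 j2]] := dyadic_floor (X1 w).
  apply: (@le_trans _ _ (u j w)); last first.
    apply: le_trans (@nneseries_lim_ge _ (u ^~ w) xpredT 0 j.+1 _); last by move=> k _ _; exact: u0.
    rewrite big_nat_recr//= leeDr// sume_ge0// => k _; exact: u0.
  rewrite /u lee_fin indicE mem_set/=; last by rewrite /A /= in_itv/= j1.
  rewrite mulr1 mulrC powRrM powR2_nat.
  by apply: ge0_ler_powR; rewrite ?nnegrE ?(ltW s0) ?exprn_ge0 ?ltW// (lt_le_trans _ (X1 w)).
rewrite integral_nneseries//.
apply: nneseries_geometric_le => //.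
- by rewrite mulr_ge0 ?powR_ge0// (le_trans _ K'1).
- by move=> j; apply: integral_ge0 => w _; exact: u0.
move=> j; rewrite /u.
under eq_integral do rewrite EFinM.
rewrite ge0_integralZl_EFin ?powR_ge0//; last by apply/measurable_EFinP; exact: measurable_indic.
rewrite integral_indic// setIT.
apply: (@le_trans _ _ ((2 `^ (s * j.+1%:R))%:E * (K' * (2 `^ (- s1)) ^+ j)%:E)%E).
  by apply: lee_wpmul2l; [rewrite lee_fin powR_ge0|exact: PA].
have e1 : s * j.+1%:R = s * j%:R + s by rewrite -(natr1 j); ring.
have e2 : j%:R * (s - s1) = s * j%:R + j%:R * - s1 by ring.
rewrite -EFinM lee_fin /q !powR2_exprn e1 e2 !powR2D.
by rewrite le_eqVlt; apply/orP; left; apply/eqP; ring.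
Qed.

Section LongEdges.
Context (R : realType) (n : nat) d (Omega : measurableType d) (P : probability Omega R).
Variables (W : 'rV[int]_n -> {RV P >-> R}) (E : {fset 'rV[int]_n} -> {RV P >-> bool})
  (L : {fset 'rV[int]_n} -> {RV P >-> R}).
Variables (alpha lambda : R) (muW muL : probability R R).
Hypothesis lambda0 : 0 < lambda.
Hypothesis SFP : is_SFP W E L alpha lambda muW muL.

(** The left side is at most [min 1 u], hence at most [u ^ s]. This trades an expectation of the
    weight, possibly infinite, for a fractional moment. *)
Lemma one_minus_expRN_le (u s : R) : 0 <= u -> 0 < s <= 1 -> 1 - expR (- u) <= u `^ s.
Proof.
move=> u0 /andP[s0 s1].
have [u1|u1] := lerP u 1; last first.
  apply: (@le_trans _ _ 1); first by rewrite gerBl expR_ge0.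
  by rewrite -[leLHS](powRr0 u); apply: ler_powR; rewrite ltW.
have -> : 1 - expR (- u) <= u `^ s = (1 - u `^ s <= expR (- u)) by apply/idP/idP; lra.
apply: le_trans (expR_ge1Dx _); rewrite lerD2l lerN2.
move: u0; rewrite le_eqVlt => /orP[/eqP <-|u0]; first exact: powR_ge0.
by rewrite -[leLHS](powRr1 (ltW u0)); apply: ger_powR => //; rewrite u0.
Qed.

(** Only the near end [x] has its weight bounded by [w0]; the weight of [y] is integrated out by its
    moment of order [s]. The decay [r ^ (- alpha * s)] is summable over the lattice when
    [alpha * s > n]. *)
Lemma prob_long_edge x y (w0 r s M : R) : x != y -> 0 < s <= 1 -> 0 <= w0 -> 1 < r ->
  r <= eucl_dist R x y -> 0 < alpha -> (forall z w, 1 <= W z w) ->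
  (\int[P]_w (W y w `^ s)%:E <= M%:E)%E ->
  (P (W x @^-1` `]-oo, w0]%classic `&` E (edge x y) @^-1` [set true]) <=
    ((lambda * w0 / r `^ alpha) `^ s * M)%:E)%E.
Proof.
move=> xy s01 w00 r1 rxy a0 W1 HM; have /andP[s0 _] := s01.
rewrite (prob_edge SFP)//; last exact: sigma_rvs_preimage.
have mS : measurable (W x @^-1` `]-oo, w0]%classic) by exact: measurable_funPTI.
pose c := lambda * w0 / r `^ alpha.
have r0 : 0 < r by exact: lt_trans r1.
have c0 : 0 <= c by rewrite divr_ge0 ?powR_ge0// mulr_ge0// ltW.
have mWs : measurable_fun setT (fun w => W y w `^ s).
  exact: (measurableT_comp (measurable_powR s) (measurable_funPT (W y))).
apply: (@le_trans _ _ (\int[P]_(w in W x @^-1` `]-oo, w0]%classic) ((c `^ s)%:E * (W y w `^ s)%:E))%E).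
  apply: ge0_le_integral => //.
  - move=> w _; rewrite lee_fin; case/andP: (conn_prob_bounds alpha x y (ltW lambda0) (le_trans ler01 (W1 x w)) (le_trans ler01 (W1 y w))) => //.
  - by apply/measurable_EFinP; apply: measurable_funTS; exact: measurable_conn_prob.
  - apply/measurable_EFinP; apply: measurable_funTS; exact: measurable_funM.
  move=> w; rewrite /= in_itv/= => ww0; rewrite -EFinM lee_fin.
  have dr1 : 1 < eucl_dist R x y by exact: lt_le_trans rxy.
  rewrite /conn_prob gt_eqF//.
  have Wx := W1 x w; have Wy := W1 y w.
  have d0 : 0 < eucl_dist R x y `^ alpha by apply: powR_gt0; exact: lt_trans dr1.
  have u0 : 0 <= lambda * W x w * W y w / eucl_dist R x y `^ alpha.
    by rewrite divr_ge0 ?(ltW d0)// !mulr_ge0 ?(ltW lambda0)//; lra.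
  apply: le_trans (one_minus_expRN_le u0 s01) _.
  rewrite -powRM//; last by lra.
  apply: ge0_ler_powR; rewrite ?nnegrE ?(ltW s0)//; first by rewrite mulr_ge0//; lra.
  rewrite /c.
  have h1 : (eucl_dist R x y `^ alpha)^-1 <= (r `^ alpha)^-1.
    rewrite lef_pV2 ?posrE ?(powR_gt0 _ r0)//.
    by apply: ge0_ler_powR; rewrite ?nnegrE ?(ltW r0) ?(ltW a0)//; lra.
  have h2 : lambda * W x w <= lambda * w0 by rewrite ler_pM2l.
  rewrite [leLHS]mulrAC.
  apply: ler_wpM2r; first by lra.
  by apply: ler_pM => //; rewrite ?mulr_ge0 ?invr_ge0 ?(ltW lambda0) ?powR_ge0//; lra.
rewrite ge0_integralZl_EFin ?powR_ge0//; last 2 first.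
- by move=> w _; rewrite lee_fin powR_ge0.
- by apply/measurable_EFinP; exact: measurable_funTS.
rewrite EFinM; apply: lee_wpmul2l; first by rewrite lee_fin powR_ge0.
apply: le_trans HM; apply: ge0_subset_integral => //.
- by apply/measurable_EFinP.
- by move=> w _; rewrite lee_fin powR_ge0.
Qed.

End LongEdges.

(** * Slow escape through nested boxes *)

Section SlowEscape.
Context (R : realType) (n : nat) d (Omega : measurableType d) (P : probability Omega R).
Variables (E : {fset 'rV[int]_n} -> {RV P >-> bool}) (L : {fset 'rV[int]_n} -> {RV P >-> R}).
Variables (B : nat -> pred 'rV[int]_n) (delta : nat -> R) (m : nat) (w : Omega).
Hypotheses (L_ge0 : forall e, 0 <= L e w) (delta_ge0 : forall j, 0 <= delta j).
Hypothesis Bmono : forall i j x, (i <= j)%N -> B i x -> B j x.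
Hypothesis no_jump : forall j x y, (m <= j)%N -> B j x -> ~~ B j.+1 y -> ~~ E (edge x y) w.
Hypothesis no_short : forall j x y, (m <= j)%N -> x != y -> B j.+1 x -> B j.+1 y ->
  delta j <= L (edge x y) w.

Lemma path_length_ge0 x (p : seq 'rV[int]_n) : 0 <= path_length L w x p.
Proof. by elim: p x => //= y p IHp x; rewrite addr_ge0. Qed.

(* Before leaving the box [B N], the path crosses each [B i.+1] by an edge between
   two of its points, which costs at least [delta i]. *)
Lemma escape_length x p j N : (m <= j)%N -> B j x -> path (Defs.adjacent E w) x p ->
  ~~ B N (last x p) -> \sum_(j <= i < N) delta i <= path_length L w x p.
Proof.
elim: p x j => [|y p IHp] x j mj Bx /=.
  move=> _ /negP NB; rewrite big_geq// leqNgt; apply/negP => jN.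
  by apply: NB; apply: Bmono Bx; exact: ltnW.
move=> /andP[/andP[xy Exy] pp] NB.
have By : B j.+1 y by apply: contraTT Exy; exact: no_jump.
have [jN|Nj] := ltnP j N; last by rewrite big_geq// addr_ge0// path_length_ge0.
rewrite big_ltn//; apply: lerD; last by apply: IHp => //; exact: leqW.
by apply: (no_short mj xy) => //; exact: Bmono Bx.
Qed.

(** For every [t] the ball of radius [t] stays inside one finite box, so it has too few vertices for
    large [k]. *)
Lemma limn_reach_time_pinfty : B m 0 ->
  (forall N, exists s : seq 'rV[int]_n, forall x, B N x -> x \in s) ->
  (forall S, exists N, S < \sum_(m <= i < N) delta i) ->
  limn (reach_time E L w) = +oo%E.
Proof.
move=> B0 Bfin sums; apply/cvg_lim => //; apply/cvgeyPge => t.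
have [N tN] := sums t; have [s Bs] := Bfin N.
have [M sM] := finite_seq s.
have ball_sub t' : t' <= t -> ballL E L w t' `<=` [set` s].
  move=> tt y /= dy; apply: Bs; apply: contraPT dy => NB.
  apply/negP; rewrite -ltNge; apply: (@lt_le_trans _ _ (\sum_(m <= i < N) delta i)%:E).
    by rewrite lte_fin; exact: le_lt_trans tN.
  apply: le_ereal_inf_tmp => _ [p [pp py] <-]; rewrite lee_fin.
  by apply: escape_length => //; rewrite py.
near=> k; apply: le_ereal_inf_tmp => _ [t' [t'0 kt] <-]; rewrite lee_fin leNgt.
apply/negP => /ltW /ball_sub sub.
have := card_le_trans kt (subset_card_le sub).
rewrite (card_le_eqr sM) card_le_II leqNgt => /negP; apply.
by near: k; exact: nbhs_infty_gt.
Unshelve. all: by end_near. Qed.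

End SlowEscape.

Section Boxes.
Context (n : nat).

Definition in_box (N : nat) (x : 'rV[int]_n) : bool := [forall i, `|x 0%R i| < N]%N.

(** The shifted range starts at [- N], which [in_box] excludes; hence the filter. *)
Definition box (N : nat) : seq 'rV[int]_n :=
  [seq x <- [seq \row_i ((f i)%:Z - N%:Z) | f : {ffun 'I_n -> 'I_(N + N)}] | in_box N x].

Lemma size_box N : (size (box N) <= (N + N) ^ n)%N.
Proof.
rewrite /box size_filter; apply: leq_trans (count_size _ _) _.
by rewrite size_image card_ffun !card_ord.
Qed.

Lemma mem_box N x : (x \in box N) = in_box N x.
Proof.
rewrite mem_filter; have [/forallP xN|//] := boolP (in_box N x).
have fN i : (`|(x 0%R i + N%:Z)%R| < N + N)%N by move: (xN i); move: (x _ _) => z; lia.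
apply/mapP; exists [ffun i => Ordinal (fN i)]; first by rewrite mem_enum.
apply/rowP => i; rewrite mxE ffunE /=; move: (xN i); move: (x _ _) => z; lia.
Qed.

Lemma in_box0 N : (0 < N)%N -> in_box N 0.
Proof. by move=> N0; apply/forallP => i; rewrite mxE. Qed.

Lemma in_boxS N N' x : (N <= N')%N -> in_box N x -> in_box N' x.
Proof. by move=> NN' /forallP H; apply/forallP => i; exact: leq_trans (H i) NN'. Qed.

Lemma box_dist (R : realType) N x y : in_box N x -> ~~ in_box (N + N) y ->
  N%:R <= eucl_dist R x y.
Proof.
move=> /forallP xN; rewrite negb_forall => /existsP[i yi].
apply: le_trans (eucl_dist_ge R x y i); rewrite ler_nat.
by have := xN i; lia.
Qed.

End Boxes.

Lemma in_box_exists n (y : 'rV[int]_n) : exists N, in_box (2 ^ N) y.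
Proof.
exists (\sum_(i < n) `|y 0%R i|)%N; apply/forallP => i.
by apply: leq_ltn_trans (ltn_expl _ (ltnSn 1)); rewrite (bigD1 i)//= leq_addr.
Qed.

(** For [prob_short], with [c = C ^ j] and [r = C ^ j.+1]: at most [2 ^ (2 * (r + 1) * n)] pairs,
    each short with probability at most [2 ^ (- C * r)], leave [2 ^ (- c)]. *)
Lemma box_budget (n C c r : nat) : (4 * n < C)%N -> (0 < c <= r)%N ->
  (c + (r.+1 * n + r.+1 * n) <= C * r)%N.
Proof.
move=> nC /andP[c0 cr]; have h := leq_mul nC (leqnn r).
have h2 : (n <= n * r)%N by rewrite leq_pmulr// (leq_trans c0).
by apply: leq_trans h; rewrite (mulSn (4 * n)) (mulSn r) -mulnA (mulnC r n); lia.
Qed.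

(** Index arithmetic for [no_jump]: a point whose smallest dyadic box is the [N]-th lies in the
    annulus with index [N - 2]. *)
Lemma predn_jump c N : (0 < c < N)%N ->
  [/\ (c.-1 + (N.-1 - c) = N.-2)%N, N.-2.+2 = N & N.-2.+1 = N.-1].
Proof. by move=> cN; split; lia. Qed.

Lemma natr_pred (R : pzRingType) k : (0 < k)%N -> (k.-1)%:R = k%:R - 1 :> R.
Proof. by case: k => //= k _; rewrite -natr1 addrK. Qed.

(** * Non-explosion with positive probability *)

Section Nonexplosion.
Context (R : realType) (n : nat) d (Omega : measurableType d) (P : probability Omega R).
Variables (W : 'rV[int]_n -> {RV P >-> R}) (E : {fset 'rV[int]_n} -> {RV P >-> bool})
  (L : {fset 'rV[int]_n} -> {RV P >-> R}).
Variables (alpha lambda : R) (muW muL : probability R R).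
Hypotheses (alpha0 : 0 < alpha) (lambda0 : 0 < lambda)
  (SFP : is_SFP W E L alpha lambda muW muL)
  (W_ge1 : forall x w, 1 <= W x w) (L_ge0 : forall e w, 0 <= L e w).
(** In the box of side exponent [r], [q_large] makes weights above [2 ^ (q * r)] unlikely despite
    some [2 ^ (r * n)] vertices. [C_large] makes edges from there beyond the box of exponent [C * r]
    unlikely, as [kappa] is the decay of long edges left after counting their far ends. [C_large']
    does the same for short pairs in a box. *)
Variables (s s1 K M : R) (q C : nat) (delta : nat -> R).
Let kappa := alpha * s - n%:R.
Hypotheses (s01 : 0 < s <= 1) (K0 : 0 <= K) (M0 : 0 <= M)
  (tailW : forall t, 1 <= t -> (muW `]t, +oo[%classic <= (K / t `^ s1)%:E)%E)
  (momentW : forall y, (\int[P]_w (W y w `^ s)%:E <= M%:E)%E)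
  (kappa0 : 0 < kappa) (q_large : n%:R + 1 <= q%:R * s1)
  (C_large : n%:R + q%:R * s + 1 <= kappa * C%:R) (C_large' : (4 * n < C)%N)
  (C2 : (2 <= C)%N)
  (delta0 : forall k, 0 < delta k)
  (deltaF : forall k, cumul muL (delta k) <= expR (- C%:R ^+ k))
  (delta_sums : forall S, exists N, S < \sum_(k < N) delta k).

Let C_gt0 : (0 < C)%N.
Proof. exact: ltnW C2. Qed.

Let C_exp_gt0 j : (0 < C ^ j)%N.
Proof. by rewrite expn_gt0 C_gt0. Qed.

Lemma size_box_powR2 (r : nat) :
  (size (box n (2 ^ r)))%:R <= 2 `^ ((r%:R + 1) * n%:R) :> R.
Proof.
rewrite natr1 powRrM !powR2_nat powR_mulrn ?exprn_ge0// -natrX -natrX ler_nat.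
by apply: leq_trans (size_box _ _) _; rewrite addnn -mul2n -expnS.
Qed.

Let heavy (r : nat) :=
  \bigcup_(x in [set` box n (2 ^ r)]) W x @^-1` `]2 ^+ (q * r), +oo[%classic.

Let measurable_heavy r : measurable (heavy r).
Proof. by apply: fin_bigcup_measurable => // x _; exact: measurable_funPTI. Qed.

Let prob_heavy r : (P (heavy r) <= (K * 2 `^ n%:R * 2 `^ (- r%:R))%:E)%E.
Proof.
have hq : n%:R + 1 <= q%:R * s1 by exact: q_large.
apply: le_trans (@union_bound_seq _ _ _ P _ _ _ (K * 2 `^ (- (q%:R * r%:R * s1))) _ _) _.
- by move=> x _; exact: measurable_funPTI.
- move=> x _; rewrite [leLHS](iid_prob (SFP_weights SFP))//.
  apply: le_trans (tailW _) _; first by rewrite exprn_ege1// ler1n.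
  by rewrite -powR2_nat -powRrM -powRN natrM.
rewrite lee_fin -[leRHS]mulrA -powR2D mulrCA; apply: ler_wpM2l; first exact: K0.
apply: (@le_trans _ _ (2 `^ ((r%:R + 1) * n%:R) * 2 `^ (- (q%:R * r%:R * s1)))).
  by rewrite ler_wpM2r ?powR_ge0// size_box_powR2.
rewrite -powR2D; apply: ler_powR; first by rewrite ler1n.
have h : r%:R * (n%:R + 1) <= r%:R * (q%:R * s1) by rewrite ler_wpM2l.
by move: h; rewrite mulrDr mulr1 (mulrCA r%:R) => h; rewrite mulrDl mul1r; lra.
Qed.

(** Far ends are sorted by dyadic annuli: for [r <= a] an edge here has length at least [2 ^ a],
    there are at most [2 ^ ((a + 3) * n)] choices of [y], and together this gives
    [2 ^ (- kappa * a)]. *)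
Let long (r a : nat) := \bigcup_(x in [set` box n (2 ^ r)])
  \bigcup_(y in [set` [seq y <- box n (2 ^ a.+2) | ~~ in_box (2 ^ a.+1) y]])
    (W x @^-1` `]-oo, 2 ^+ (q * r)]%classic `&` E (edge x y) @^-1` [set true]).

Let measurable_long r a : measurable (long r a).
Proof.
apply: fin_bigcup_measurable => // x _; apply: fin_bigcup_measurable => // y _.
by apply: measurableI; exact: measurable_funPTI.
Qed.

Let prob_long r a : (r <= a)%N -> (0 < a)%N ->
  (P (long r a) <= (M * lambda `^ s * 2 `^ (4 * n%:R) *
    2 `^ (r%:R * (n%:R + q%:R * s)) * 2 `^ (- (kappa * a%:R)))%:E)%E.
Proof.
move=> ra a0; have aR : 1 < 2 ^+ a :> R by rewrite exprn_egt1 ?ltr1n// -lt0n.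
pose b := lambda `^ s * 2 `^ (q%:R * r%:R * s) * 2 `^ (- (a%:R * alpha * s)) * M.
have b0 : 0 <= b by rewrite !mulr_ge0 ?powR_ge0.
apply: (@le_trans _ _ ((size (box n (2 ^ r)))%:R * (2 `^ ((a%:R + 3) * n%:R) * b))%:E).
  apply: union_bound_seq => x xr.
    apply: fin_bigcup_measurable => // y _.
    by apply: measurableI; exact: measurable_funPTI.
  apply: (@le_trans _ _ ((size [seq y <- box n (2 ^ a.+2) | ~~ in_box (2 ^ a.+1) y])%:R * b)%:E).
    apply: union_bound_seq => y; first by move=> _; apply: measurableI; exact: measurable_funPTI.
    rewrite mem_filter => /andP[ya _].
    have xa : in_box (2 ^ a) x.
      by rewrite mem_box in xr; apply: in_boxS xr; rewrite leq_exp2l.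
    have rxy : 2 ^+ a <= eucl_dist R x y.
      by rewrite -natrX; apply: box_dist => //; rewrite addnn -mul2n -expnS.
    have xy : x != y.
      apply: contraNneq ya => <-; apply: in_boxS xa.
      by rewrite leq_exp2l.
    apply: le_trans (prob_long_edge lambda0 SFP xy s01 _ aR rxy alpha0 W_ge1 (momentW y)) _.
      by rewrite exprn_ge0.
    rewrite lee_fin /b ler_wpM2r//.
    rewrite -[X in lambda * X]powR2_nat natrM -[X in X `^ alpha]powR2_nat -!powRrM -powRN.
    by rewrite !powRM ?mulr_ge0 ?powR_ge0 ?(ltW lambda0)// -!powRrM mulNr.
  rewrite lee_fin ler_wpM2r//; apply: le_trans (_ : (size (box n (2 ^ a.+2)))%:R <= _).
    by rewrite ler_nat size_filter; exact: count_size.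
  apply: le_trans (size_box_powR2 _) _.
  by rewrite (_ : a.+2%:R + 1 = a%:R + 3)// -addn2 natrD; ring.
rewrite lee_fin; apply: (@le_trans _ _ (2 `^ ((r%:R + 1) * n%:R) * (2 `^ ((a%:R + 3) * n%:R) * b))).
  by rewrite ler_wpM2r ?size_box_powR2// mulr_ge0// powR_ge0.
have e1 : (r%:R + 1) * n%:R + ((a%:R + 3) * n%:R + (q%:R * r%:R * s + - (a%:R * alpha * s)))
   = 4 * n%:R + (r%:R * (n%:R + q%:R * s) + - (kappa * a%:R)) by rewrite /kappa; ring.
have : 2 `^ ((r%:R + 1) * n%:R + ((a%:R + 3) * n%:R + (q%:R * r%:R * s + - (a%:R * alpha * s)))) =
  2 `^ (4 * n%:R + (r%:R * (n%:R + q%:R * s) + - (kappa * a%:R))) :> R by rewrite e1.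
rewrite !powR2D /b; set p1 := 2 `^ _; set p2 := 2 `^ _; set p3 := 2 `^ _; set p4 := 2 `^ _.
set p5 := 2 `^ _; set p6 := 2 `^ _; set p7 := 2 `^ _ => e2.
rewrite le_eqVlt; apply/orP; left; apply/eqP.
transitivity (M * lambda `^ s * (p1 * (p2 * (p3 * p4)))); first by ring.
by rewrite e2; ring.
Qed.

(** The first annulus starts at the boundary [2 ^ (C * r)] of the next box, hence the
    predecessor. *)
Let far (r : nat) := \bigcup_l long r ((C * r).-1 + l).

Let measurable_far r : measurable (far r).
Proof. by apply: bigcup_measurable => l _; exact: measurable_long. Qed.

Let Kf := M * lambda `^ s * 2 `^ (4 * n%:R) * 2 `^ kappa / (1 - 2 `^ (- kappa)).

Let q01 : 0 <= 2 `^ (- kappa) < 1.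
Proof. by rewrite powR_ge0 powR2_lt1// oppr_lt0. Qed.

Let Kf_ge0 : 0 <= Kf.
Proof.
have /andP[_ h] := q01.
by apply: divr_ge0; [rewrite !mulr_ge0 ?powR_ge0|rewrite subr_ge0 ltW].
Qed.

Let prob_far r : (0 < r)%N -> (P (far r) <= (Kf * 2 `^ (- r%:R))%:E)%E.
Proof.
move=> r0; have Cr : (r < C * r)%N by rewrite ltn_Pmull.
pose K1 := M * lambda `^ s * 2 `^ (4 * n%:R) * 2 `^ (r%:R * (n%:R + q%:R * s)) *
  2 `^ (- (kappa * ((C * r).-1)%:R)).
have K10 : 0 <= K1 by rewrite !mulr_ge0 ?powR_ge0.
have H l : (P (long r ((C * r).-1 + l)) <= (K1 * (2 `^ (- kappa)) ^+ l)%:E)%E.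
  apply: le_trans (prob_long _ _) _.
  - by rewrite (leq_trans _ (leq_addr _ _))// -ltnS prednK// (leq_ltn_trans _ Cr).
  - by rewrite (leq_trans _ (leq_addr _ _))// -ltnS prednK ?(leq_ltn_trans _ Cr)// (leq_ltn_trans r0).
  have -> : 2 `^ (- (kappa * ((C * r).-1 + l)%:R)) =
    2 `^ (- (kappa * ((C * r).-1)%:R)) * (2 `^ (- kappa)) ^+ l.
    by rewrite powR2_exprn -powR2D natrD mulrDr opprD mulrN (mulrC l%:R).
  by rewrite lee_fin mulrA.
apply: le_trans (union_bound_geometric K10 q01 (fun l => measurable_long r _) H) _.
rewrite lee_fin /Kf [leRHS]mulrAC; apply: ler_wpM2r.
  by have /andP[_ h] := q01; rewrite invr_ge0 subr_ge0 ltW.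
rewrite /K1 -!mulrA; do 3! (apply: ler_wpM2l; rewrite ?powR_ge0//).
rewrite -!powR2D; apply: ler_powR; first by rewrite ler1n.
have -> : ((C * r).-1)%:R = C%:R * r%:R - 1 :> R.
  by rewrite natr_pred ?natrM// muln_gt0 C_gt0.
have h : r%:R * (n%:R + q%:R * s + 1) <= r%:R * (kappa * C%:R) by rewrite ler_wpM2l.
by rewrite (_ : kappa * (C%:R * r%:R - 1) = r%:R * (kappa * C%:R) - kappa); [lra|ring].
Qed.

(** An edge leaving box [j] without jumping has both ends in box [j.+1], so that box is searched.
    The threshold [delta j.+2] has the exponent [C ^ j.+2] needed against its size. *)
Let short (j : nat) := \bigcup_(x in [set` box n (2 ^ (C ^ j.+1))])
  \bigcup_(y in [set` [seq y <- box n (2 ^ (C ^ j.+1)) | x != y]])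
    L (edge x y) @^-1` `]-oo, delta j.+2]%classic.

Let measurable_short j : measurable (short j).
Proof.
apply: fin_bigcup_measurable => // x _; apply: fin_bigcup_measurable => // y _.
exact: measurable_funPTI.
Qed.

Let prob_short j : (P (short j) <= (2 `^ (- (C ^ j)%:R))%:E)%E.
Proof.
pose r := (C ^ j.+1)%N; pose b : R := 2 `^ (- (C * r)%:R).
have b0 : 0 <= b by exact: powR_ge0.
have sz x : (size [seq y <- box n (2 ^ r) | x != y])%:R <= 2 `^ ((r%:R + 1) * n%:R) :> R.
  apply: le_trans (size_box_powR2 r).
  by rewrite ler_nat size_filter; exact: count_size.
apply: (@le_trans _ _ ((size (box n (2 ^ r)))%:R * (2 `^ ((r%:R + 1) * n%:R) * b))%:E).
  apply: union_bound_seq => x xr.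
    by apply: fin_bigcup_measurable => // y _; exact: measurable_funPTI.
  apply: (@le_trans _ _ ((size [seq y <- box n (2 ^ r) | x != y])%:R * b)%:E).
    apply: union_bound_seq => y; first by move=> _; exact: measurable_funPTI.
    rewrite mem_filter => /andP[xy _].
    rewrite [leLHS](iid_prob (SFP_lengths SFP))//; last exact: edge_all_edges.
    rewrite cumulE lee_fin; apply: le_trans (deltaF _) _.
    rewrite /b /r -expnS -natrX; have /andP[_ h] := expRN_nat_bounds R (C ^ j.+2).
    by apply: le_trans h _; rewrite powRN powR2_nat exprVn.
  by rewrite lee_fin ler_wpM2r.
rewrite lee_fin; apply: (@le_trans _ _ (2 `^ ((r%:R + 1) * n%:R) * (2 `^ ((r%:R + 1) * n%:R) * b))).
  by rewrite ler_wpM2r ?size_box_powR2// mulr_ge0// powR_ge0.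
rewrite -!powR2D; apply: ler_powR; first by rewrite ler1n.
have := box_budget (r := r) C_large' (c := C ^ j).
rewrite C_exp_gt0 leq_exp2l// leqnSn => /(_ isT).
by rewrite -(ler_nat R) (natrD _ (C ^ j)) natrD !(natrM _ r.+1) -natr1; lra.
Qed.

Let bad j := heavy (C ^ j) `|` far (C ^ j) `|` short j.

Let measurable_bad j : measurable (bad j).
Proof. by apply: measurableU => //; exact: measurableU. Qed.

Let Kb := K * 2 `^ n%:R + Kf + 1.

Let Kb_ge0 : 0 <= Kb.
Proof. by apply: addr_ge0 ler01; apply: addr_ge0 Kf_ge0; rewrite mulr_ge0 ?powR_ge0. Qed.

Let prob_bad j : (P (bad j) <= (Kb * 2^-1 ^+ j)%:E)%E.
Proof.
apply: (@le_trans _ _ (Kb * 2 `^ (- (C ^ j)%:R))%:E); last first.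
  rewrite lee_fin; apply: ler_wpM2l; first exact: Kb_ge0.
  rewrite powRN powR2_nat -exprVn.
  by apply: ler_wiXn2l; rewrite ?invr_ge0 ?invf_le1 ?ler1n// ltnW// ltn_expl.
rewrite /Kb 2!mulrDl mul1r !EFinD.
have h : (P (bad j) <= P (heavy (C ^ j) `|` far (C ^ j)) + P (short j))%E.
  by apply: measureU2 => //; exact: measurableU.
apply: le_trans h _; apply: leeD; last exact: prob_short.
have h : (P (heavy (C ^ j) `|` far (C ^ j)) <= P (heavy (C ^ j)) + P (far (C ^ j)))%E.
  exact: measureU2.
by apply: le_trans h _; apply: leeD; [exact: prob_heavy|exact: prob_far].
Qed.

Let no_jump j x y w : ~ bad j w -> in_box (2 ^ C ^ j) x -> ~~ in_box (2 ^ C ^ j.+1) y ->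
  ~~ E (edge x y) w.
Proof.
move=> gw xj yj; apply/negP => Exy; apply: gw; set r := (C ^ j)%N in xj *.
have [h|h] := pselect (heavy r w); first by left; left.
left; right.
have Wx : W x w <= 2 ^+ (q * r).
  rewrite leNgt; apply/negP => Wx; apply: h; exists x; first by rewrite /= mem_box.
  by rewrite /= in_itv/= andbT.
(* The smallest dyadic box containing [y] determines its annulus. *)
have [N yN Nmin] := ex_minnP (in_box_exists y).
have CN : (C * r < N)%N.
  rewrite ltnNge; apply: contra yj => NC; apply: in_boxS yN.
  by rewrite expnS leq_exp2l.
have r0 : (0 < C * r)%N by rewrite muln_gt0 C_gt0 C_exp_gt0.
exists (N.-1 - C * r)%N => //; exists x; first by rewrite /= mem_box.
have [-> N2 N1] := predn_jump (introT andP (conj r0 CN)).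
exists y; last by split => //=; rewrite in_itv/=.
rewrite /= mem_filter mem_box N2 N1 yN andbT; apply/negP => /Nmin.
by rewrite -N1 -[X in (X <= _)%N]N2 ltnn.
Qed.

Let no_short j x y w : ~ bad j w -> x != y -> in_box (2 ^ C ^ j.+1) x ->
  in_box (2 ^ C ^ j.+1) y -> delta j.+2 <= L (edge x y) w.
Proof.
move=> gw xy xj yj; rewrite leNgt; apply/negP => Lxy; apply: gw; right.
exists x; first by rewrite /= mem_box.
exists y; first by rewrite /= mem_filter xy mem_box.
by rewrite /= in_itv/= ltW.
Qed.

Let limn_good m w : (forall k, ~ bad (k + m) w) -> limn (reach_time E L w) = +oo%E.
Proof.
move=> gw.
have gw' j : (m <= j)%N -> ~ bad j w by move=> mj; rewrite -(subnK mj); exact: gw.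
apply: (@limn_reach_time_pinfty _ _ _ _ _ _ _ (fun j => in_box (2 ^ C ^ j))
  (fun j => delta j.+2) m) => //.
- move=> i j x ij; apply: in_boxS; rewrite leq_exp2l// leq_pexp2l//; lia.
- by move=> j x y mj; apply: no_jump; exact: gw'.
- by move=> j x y mj; apply: no_short; exact: gw'.
- by apply: in_box0; rewrite expn_gt0.
- by move=> N; exists (box n (2 ^ C ^ N)) => x; rewrite mem_box.
move=> S; have [N HN] := unbounded_shift m.+2 delta0 delta_sums S.
exists (m + N)%N; rewrite -{1}[m]add0n big_addn addKn big_mkord.
by under eq_bigr do rewrite -!addnS.
Qed.

Lemma SFP_not_explosive : ~ explosive_profile E L.
Proof.
move=> [A [mA A0 HA]].
(* From scale [m] on, the bad events have total probability at most [2 * Kb * 2 ^ (- m) < 1], so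
   together with a null set they cannot cover the space. *)
have [m mK] : exists m, 2 * Kb < 2 ^+ m by have [|m hm] := @exprn_unbounded R 2 (2 * Kb + 1); [rewrite ltr1n|exists m; apply: lt_le_trans hm; rewrite ltrDl].
pose K2 := Kb * 2^-1 ^+ m.
have K20 : 0 <= K2 by rewrite mulr_ge0// exprn_ge0.
have PB : (P (\bigcup_k bad (k + m)) <= (K2 / (1 - 2^-1))%:E)%E.
  apply: union_bound_geometric => //; first by apply/andP; split; lra.
  by move=> k; rewrite /K2 -mulrA -exprD addnC; exact: prob_bad.
have : (P setT <= P (A `|` \bigcup_k bad (k + m)))%E.
  apply: le_measure; rewrite ?inE//.
    by apply: measurableU => //; exact: bigcup_measurable.
  move=> w _; have [h|h] := pselect ((\bigcup_k bad (k + m)) w); [by right|left].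
  apply: HA => /=; rewrite (limn_good (m := m)) ?ltxx// => k bk; apply: h.
  by exists k.
rewrite probability_setT => h.
have h2 : (P (A `|` \bigcup_k bad (k + m)) <= P A + P (\bigcup_k bad (k + m)))%E.
  by apply: measureU2 => //; exact: bigcup_measurable.
have := le_trans h (le_trans h2 (leeD (le_refl (P A)) PB)).
rewrite A0 add0e lee_fin leNgt => /negP; apply.
have -> : K2 / (1 - 2^-1) = 2 * K2 by field.
rewrite /K2 mulrA exprVn ltr_pdivrMr ?mul1r// exprn_gt0//.
Qed.

End Nonexplosion.

Lemma exists_nat_ge (R : realType) (x : R) : exists k : nat, x <= k%:R.
Proof. by exists (Num.truncn x).+1; rewrite ltW// truncnS_gt. Qed.

Lemma W_SFP_criterion (R : realType) (n : nat) (alpha lambda tau : R)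
    (muW muL : probability R R) :
  (1 <= n)%N -> n%:R < alpha -> 0 < lambda ->
  muW `[1, +oo[%classic = 1%E ->
  power_law_tail (fun t : R => muW `]t, +oo[%classic) (tau - 1) ->
  1 < alpha * (tau - 1) / n%:R ->
  W_SFP n alpha lambda muW muL -> exists2 C, 1 < C & explosion_criterion muL C.
Proof.
have large k : (1 < k + 4 * n.+1)%N /\ (4 * n < k + 4 * n.+1)%N by split; lia.
move=> n1 na l0 W1 pl g1 [L0 explL].
have n0 : 0 < n%:R :> R by rewrite ltr0n.
have a0 : 0 < alpha by exact: lt_trans na.
move: pl g1; set rho := tau - 1 => pl; rewrite ltr_pdivlMr// mul1r => g1.
(* [alpha > n] and [gamma > 1] put [n / alpha] below 1 and below [tau - 1]. Above [n / alpha], [s]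
   gives summable long edges; below 1 it suits [one_minus_expRN_le]; below [tau - 1] it has a finite
   moment, with [u] in between for the tail bound. *)
pose s := (n%:R / alpha + Num.min 1 rho) / 2.
have na1 : n%:R / alpha < Num.min 1 rho.
  by rewrite lt_min !ltr_pdivrMr// mul1r na mulrC.
have na0 : 0 < n%:R / alpha by rewrite divr_gt0.
have s_lt : s < Num.min 1 rho by rewrite /s; lra.
have s_gt : n%:R / alpha < s by rewrite /s; lra.
move: s_lt; rewrite lt_min => /andP[s1 sr].
have s0 : 0 < s by exact: lt_trans s_gt.
pose u := (s + rho) / 2.
have su : 0 < s < u by rewrite s0 /u/=; lra.
have ur : 0 < u < rho by rewrite /u; lra.
have [K K0 tailW] := real_tail_upper pl ur.
have [M M0 momentW] := moment_bound su tailW.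
have kappa0 : 0 < alpha * s - n%:R by rewrite subr_gt0 mulrC -ltr_pdivrMr.
have u0 : 0 < u by case/andP: ur.
have [q hq] := exists_nat_ge ((n%:R + 1) / u); rewrite ler_pdivrMr// in hq.
have [C0 hC] := exists_nat_ge ((n%:R + q%:R * s + 1) / (alpha * s - n%:R)).
(* [C0] serves [C_large], the other summand serves [C_large'] and [C2]. *)
pose C := (C0 + 4 * n.+1)%N.
have [C2 C4] := large C0.
have C1 : 1 < C%:R :> R by rewrite ltr1n.
exists C%:R => //; apply: contrapT => /(not_explosion_criterion C1)[delta [d0 dF dS]].
case: (exists_SFP n alpha l0 W1 L0) => d' [Om [P [W [E [L [SFP Wge1 Lge0]]]]]].
apply: (@SFP_not_explosive R n d' Om P W E L alpha lambda muW muL a0 l0 SFP Wge1 Lge0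
  s u K M q C delta) => //.
- by rewrite s0 ltW.
- exact: ltW.
- by move=> y; apply: momentW => // B mB; exact: iid_prob (SFP_weights SFP) _ mB.
- rewrite ler_pdivrMr// in hC; apply: le_trans hC _.
  by rewrite mulrC ler_pM2l// ler_nat leq_addr.
- exact: explL SFP.
Qed.

Theorem corollary1p2 (R : realType) (n : nat) (alpha lambda tau : R)
    (muW : probability R R)
    (hn : (1 <= n)%N) (halpha : n%:R < alpha) (hlambda : 0 < lambda)
    (htau : 1 < tau)
    (hW1 : muW `[1, +oo[%classic = 1%E)
    (hW : power_law_tail (fun t : R => muW `]t, +oo[%classic) (tau - 1))
    (hgamma : 1 < alpha * (tau - 1) / n%:R < 2) :
  W_SFP n alpha lambda muW = W_BP R.
Proof.
apply/seteqP; split => muL expl.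
  have [C C1 crit] := W_SFP_criterion hn halpha hlambda hW1 hW (proj1 (andP hgamma)) expl.
  apply: criterion_W_BP; first exact: (proj1 expl).
  by apply: explosion_criterion_change crit; rewrite ?ltr1n.
have [C C1 crit] := W_BP_criterion expl.
apply: (criterion_W_SFP hn hlambda htau hW hgamma); first exact: (proj1 expl).
by move=> c c1; exact: explosion_criterion_change crit.
Qed.
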